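(* Let $\Omega$ be a bounded domain in $\mathbb{R}^n$, $p>1$, and let $f$ satisfy the standing assumptions, with $k=(f')^{-1}$. Let $\nu\in\mathcal{P}(\Omega)$ be of the form $\nu=\nu^s+v\cdot\mathcal{L}^n$ with $\nu^s\perp\mathcal{L}^n$, $v\in L^\infty(\Omega)$ and $v>0$ a.e. in $\Omega$. Let $\mu=u\cdot\mathcal{L}^n$ minimize $\mathfrak{F}^p_\nu$ over $\mathcal{P}(\Omega)$, and let $\psi$ be a Kantorovich potential for the transport between $\mu$ and $\nu$ with cost $|x-y|^p$ (under these hypotheses it is unique up to additive constants). Then there exists a constant $l\in\mathbb{R}$ such that $l-\psi\geq 0$ a.e. and $$u=k(l-\psi)\quad\text{a.e. in }\Omega.$$
   Context: A bounded domain is a bounded set $\Omega\subset\mathbb{R}^n$ which is the closure of a nonempty connected open set and whose boundary is Lebesgue-negligible. $\mathcal{P}(\Omega)$ is the set of Borel probability measures on $\Omega$. Standing assumptions on $f$: $f:[0,+\infty)\to[0,+\infty)$ is strictly convex and $C^1$, $f(0)=0$, $f'(0)=0$, and $\lim_{t\to+\infty}f(t)/t=+\infty$; $k=(f')^{-1}:[0,+\infty)\to[0,+\infty)$ is then continuous and strictly increasing. $T_p(\mu,\nu)=\inf_\gamma\int|x-y|^p\,d\gamma$ over transport plans $\gamma$ (probability measures on $\Omega\times\Omega$ with marginals $\mu,\nu$). $F(\mu)=\int_\Omega f(u)\,dx$ if $\mu=u\cdot\mathcal{L}^n$, $+\infty$ otherwise. $\mathfrak{F}^p_\nu(\mu)=T_p(\mu,\nu)+F(\mu)$.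 For $c(x,y)=|x-y|^p$ and $\chi:\Omega\to\mathbb{R}$, the $c$-transform is $\chi^c(y)=\inf_{x\in\Omega}\big(c(x,y)-\chi(x)\big)$; $\chi$ is $c$-concave if $\chi=\phi^c$ for some $\phi$. A Kantorovich potential between $\mu$ and $\nu$ is a $c$-concave function $\psi$ maximizing $\int\varphi\,d\mu+\int\varphi^c\,d\nu$ among $c$-concave $\varphi$; the maximum equals $T_p(\mu,\nu)$. *)

(* Defs.v *)
From HB Require Import structures.
From mathcomp Require Import all_boot all_order all_algebra.
From mathcomp Require Import all_classical all_reals all_analysis.
Import Order.TTheory GRing.Theory Num.Theory.
Import numFieldNormedType.Exports.
Local Open Scope ring_scope.
Local Open Scope classical_set_scope.

(* Points of R^n are represented as n-tuples of reals; the measurable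
   structure on [n.-tuple R] is the product (= Borel) sigma-algebra. *)

Definition edist {R : realType} {n : nat} (x y : n.-tuple R) : R :=
  Num.sqrt (\sum_(i < n) (tnth x i - tnth y i) ^+ 2).

(* identification of n-tuples with row vectors, used to transport the
   (standard) topology of R^n *)
Definition rv {R : realType} {n : nat} (x : n.-tuple R) : 'rV[R]_n :=
  \row_(i < n) tnth x i.

(* [leb] is the Lebesgue measure on (the Borel sets of) R^n:
   it gives to every closed box its volume (this determines it uniquely). *)
Definition is_lebesgue {R : realType} {n : nat}
  (leb : {measure set (n.-tuple R) -> \bar R}) : Prop :=
  forall a b : n.-tuple R, (forall i, tnth a i <= tnth b i) ->
    leb [set x | forall i, tnth a i <= tnth x i <= tnth b i] =
    (\prod_(i < n) (tnth b i - tnth a i))%:E.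

Definition bounded_domain {R : realType} {n : nat}
  (leb : {measure set (n.-tuple R) -> \bar R}) (Om : set (n.-tuple R)) : Prop :=
  bounded_set (rv @` Om) /\
  (exists O : set 'rV[R]_n,
      open O /\ connected O /\ O !=set0 /\ rv @` Om = closure O) /\
  leb.-negligible (rv @^-1` (closure (rv @` Om) `\` interior (rv @` Om))).

Definition in_P {R : realType} {n : nat} (Om : set (n.-tuple R))
  (mu : probability (n.-tuple R) R) : Prop := mu Om = 1%E.

Definition is_density {R : realType} {n : nat}
  (leb : {measure set (n.-tuple R) -> \bar R}) (Om : set (n.-tuple R))
  (mu : {measure set (n.-tuple R) -> \bar R}) (u : n.-tuple R -> R) : Prop :=
  measurable_fun Om u /\ (forall x, Om x -> 0 <= u x) /\
  forall A, measurable A ->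
    mu A = (\int[leb]_(x in A `&` Om) (u x)%:E)%E.

Definition transport_plan {R : realType} {n : nat} (Om : set (n.-tuple R))
  (mu nu : probability (n.-tuple R) R)
  (g : probability (n.-tuple R * n.-tuple R)%type R) : Prop :=
  g (Om `*` Om) = 1%E /\
  forall A, measurable A -> g (A `*` setT) = mu A /\ g (setT `*` A) = nu A.

Definition Tp {R : realType} {n : nat} (p : R) (Om : set (n.-tuple R))
  (mu nu : probability (n.-tuple R) R) : \bar R :=
  ereal_inf [set (\int[g]_z ((edist z.1 z.2) `^ p)%:E)%E
            | g in transport_plan Om mu nu].

(* F(mu) = \int f(u) dx if mu = u . L^n, +oo otherwise
   (the infimum over the empty set of densities is +oo; all densities
   agree a.e., hence give the same value) *)
Definition Fent {R : realType} {n : nat} (f : R -> R)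
  (leb : {measure set (n.-tuple R) -> \bar R}) (Om : set (n.-tuple R))
  (mu : probability (n.-tuple R) R) : \bar R :=
  ereal_inf [set (\int[leb]_(x in Om) (f (u x))%:E)%E
            | u in is_density leb Om mu].

Definition Ffun {R : realType} {n : nat} (p : R) (f : R -> R)
  (leb : {measure set (n.-tuple R) -> \bar R}) (Om : set (n.-tuple R))
  (nu mu : probability (n.-tuple R) R) : \bar R :=
  (Tp p Om mu nu + Fent f leb Om mu)%E.

Definition ctrans {R : realType} {n : nat} (p : R) (Om : set (n.-tuple R))
  (chi : n.-tuple R -> R) (y : n.-tuple R) : \bar R :=
  ereal_inf [set ((edist x y) `^ p - chi x)%:E | x in Om].

Definition c_concave {R : realType} {n : nat} (p : R) (Om : set (n.-tuple R))
  (chi : n.-tuple R -> R) : Prop :=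
  exists phi : n.-tuple R -> R,
    forall y, Om y -> (chi y)%:E = ctrans p Om phi y.

Definition kdual {R : realType} {n : nat} (p : R) (Om : set (n.-tuple R))
  (mu nu : probability (n.-tuple R) R) (phi : n.-tuple R -> R) : \bar R :=
  (\int[mu]_(x in Om) (phi x)%:E + \int[nu]_(y in Om) ctrans p Om phi y)%E.

Definition kantorovich_potential {R : realType} {n : nat} (p : R)
  (Om : set (n.-tuple R)) (mu nu : probability (n.-tuple R) R)
  (psi : n.-tuple R -> R) : Prop :=
  c_concave p Om psi /\
  forall phi, c_concave p Om phi -> (kdual p Om mu nu phi <= kdual p Om mu nu psi)%E.

(* Main.v *)
(* Perturb mu by moving the fraction e of its mass on a set B to a set A. The entropy changes at
   first order by the means of f'(u); the transport cost changes by the means of the potentials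
   phi_e of the perturbed measures, which exist up to an arbitrarily small error by strong duality
   (a finite linear program solved with a logarithmic barrier, on ever finer partitions of Omega).
   They converge to psi up to constants: if phi is nearly optimal then so is (phi + psi) / 2, hence
   for every y in the support of nu some x nearly realizes both c-transforms at y, and telescoping
   along segments shows that the transforms differ by almost a constant, since c is C^1 (p > 1)
   and nu charges every open subset of the connected domain.
   Optimality of mu then forces psi + f'(u) >= l a.e., with equality where u > 0. Finally
   {psi >= l} is negligible, because lowering psi by t on {psi > l - t} would otherwise improve the
   dual functional; so u > 0 a.e. and f'(u) = l - psi. *)
Require Import Defs.
From HB Require Import structures.
From mathcomp Require Import all_boot all_order all_algebra.
From mathcomp Require Import ring lra.
From mathcomp Require Import all_classical all_reals all_analysis.
From mathcomp Require Import measurable_realfun.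
Import Order.TTheory GRing.Theory Num.Theory.
Import numFieldNormedType.Exports.
Local Open Scope ring_scope.
Local Open Scope classical_set_scope.

(** The perturbed measures change with e, whereas [psi] belongs to [mu] alone. The link is
    near-optimality: a function nearly optimal for the perturbed measure is nearly optimal for [mu],
    because c-concave functions oscillate by at most the bound C of the cost and the mass moved is
    at most e. Errors are kept proportional to e times the mass moved, so that they can be compared
    with the first-order gain. The sets exchanged are level sets, A = {psi <= al, u <= a} and B =
    {psi >= be, u >= b}. The four constants bound potentials and densities uniformly, so one-sided
    estimates suffice: al + f'(a) < be + f'(b) is impossible when A has positive Lebesgue measure
    and B positive [mu]-measure. The constant l is the infimum of al + f'(a) over the sets A of
    positive measure. All c-transforms of bounded functions share the modulus of continuity of the
    cost. Finite partitions into small cells therefore serve for measurability, for integration, for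
    passing from the finite program to Omega and for the uniformity of the stability estimate. *)

(** * Sup-norm neighbourhoods and finite grids *)

Definition near_by {R : realType} {n : nat} (d : R) (x y : n.-tuple R) : Prop :=
  forall i, `|tnth x i - tnth y i| <= d.

Definition boxed {R : realType} {n : nat} (B : R) (x : n.-tuple R) : Prop :=
  forall i, `|tnth x i| <= B.

(* [k] encodes a finite measurable partition, by its fibres. *)
Definition cells {d : measure_display} {T : measurableType d} {I : finType}
  (k : T -> I) : Prop := forall S : set I, measurable (k @^-1` S).

Section Grid.
Context {R : realType} {n : nat}.
Implicit Types x y z : n.-tuple R.

Lemma near_by_sym (d : R) x y : near_by d x y -> near_by d y x.
Proof. by move=> h i; rewrite distrC. Qed.

Lemma near_by_refl (d : R) x : 0 <= d -> near_by d x x.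
Proof. by move=> d0 i; rewrite subrr normr0. Qed.

Lemma near_by_le (d e : R) x y : d <= e -> near_by d x y -> near_by e x y.
Proof. by move=> de h i; exact: le_trans (h i) de. Qed.

Lemma near_by_trans (d e : R) y x z :
  near_by d x y -> near_by e y z -> near_by (d + e) x z.
Proof.
move=> h1 h2 i; rewrite -(subrKA (tnth y i)).
by apply: le_trans (ler_normD _ _) _; rewrite lerD.
Qed.

Lemma measurable_tnth_preimage (i : 'I_n) (Y : set R) : measurable Y ->
  measurable [set x : n.-tuple R | Y (tnth x i)].
Proof.
by move=> mY; have := @measurable_tnth _ R n i measurableT _ mY; rewrite setTI.
Qed.

Lemma measurable_tnth_lt (i : 'I_n) (t : R) (b : bool) :
  measurable [set x : n.-tuple R | (tnth x i < t) = b].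
Proof.
have m1 : measurable [set x : n.-tuple R | tnth x i < t].
  rewrite (_ : [set _ | _] = [set x : n.-tuple R | `]-oo, t[%classic (tnth x i)]).
    exact: measurable_tnth_preimage.
  by apply/seteqP; split => x /=; rewrite in_itv.
case: b => //.
rewrite (_ : [set _ | _] = ~` [set x : n.-tuple R | tnth x i < t]).
  exact: measurableC.
by apply/seteqP; split => x /=; [move=> -> | move/negP/negbTE].
Qed.

(** The cell of a point records, for each coordinate, on which side of each threshold [- B + j * e]
    it lies; a gap larger than [e] between two coordinates always contains a threshold. *)
Lemma grid_cells (B e : R) : 0 < e ->
  exists (I : finType) (k : n.-tuple R -> I), cells k /\
    forall x y, boxed B x -> boxed B y -> k x = k y -> near_by e x y.
Proof.
(* A coordinate in [-B, B] lies strictly below the threshold whose index is one more than the floor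
   of 2B/e; as indices start at 0, two extra units are needed. *)
move=> e0; pose K := (Num.truncn (2 * B / e)).+2.
pose k x := [ffun ij : 'I_n * 'I_K => tnth x ij.1 < - B + ij.2%:R * e].
exists {ffun 'I_n * 'I_K -> bool}, k; split.
  move=> S; rewrite (_ : _ @^-1` _ = \bigcup_(s in S) \bigcap_(ij in [set: 'I_n * 'I_K])
      [set x : n.-tuple R | (tnth x ij.1 < - B + ij.2%:R * e) = s ij]).
    apply: fin_bigcup_measurable; first exact: finite_finset.
    move=> s _; apply: fin_bigcap_measurable; first exact: finite_finset.
    by move=> ij _; exact: measurable_tnth_lt.
  apply/seteqP; split => x /=.
    by move=> Sx; exists (k x) => // ij _ /=; rewrite ffunE.
  by move=> [s Ss h]; suff -> : k x = s by []; apply/ffunP => ij;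
    rewrite ffunE; exact: h.
move=> x y bx by_ kxy.
suff H z w : boxed B z -> boxed B w -> k z = k w -> forall i,
    tnth z i - tnth w i <= e.
  by move=> i; rewrite ler_norml H// lerNl opprB H.
move=> bz bw kzw i; rewrite leNgt; apply/negP => zw.
have := bz i; have := bw i; rewrite !ler_norml => /andP[w1 w2] /andP[z1 z2].
have q0 : 0 <= (tnth w i + B) / e by apply: divr_ge0; lra.
have /andP[t1 t2] := truncn_itv q0.
set t := Num.truncn _ in t1 t2.
have tK : (t.+1 < K)%N.
  rewrite ltnS /t; apply: le_truncn.
  by rewrite ler_pM2r ?invr_gt0//; lra.
have := congr1 (fun f : {ffun _ -> bool} => f (i, Ordinal tK)) kzw.
rewrite /= !ffunE /=.
rewrite ltr_pdivrMr// in t2; rewrite ler_pdivlMr// in t1.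
have -> : tnth w i < - B + t.+1%:R * e by lra.
apply/negP; rewrite -leNgt -natr1; nra.
Qed.

End Grid.

(** * Topology and measurability of the domain *)

Section Domain.
Context {R : realType} {n : nat} (leb : {measure set (n.-tuple R) -> \bar R}).
Context (Om : set (n.-tuple R)) (HOm : bounded_domain leb Om).
Implicit Types x y z : n.-tuple R.

Lemma rvE x i : rv x ord0 i = tnth x i.
Proof. by rewrite mxE. Qed.

Lemma rv_inj : injective (@rv R n).
Proof.
move=> x y h; apply: eq_from_tnth => i.
by rewrite -!rvE h.
Qed.

Lemma rv_surj (a : 'rV[R]_n) : rv [tuple a ord0 i | i < n] = a.
Proof. by apply/rowP => i; rewrite mxE tnth_mktuple. Qed.

(** Translates the topology of row vectors into closed coordinatewise boxes, so that later arguments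
    stay on tuples. *)
Lemma rv_nbhs (A : set 'rV[R]_n) x : nbhs (rv x) A <->
  exists2 d : R, 0 < d & forall y, near_by d x y -> A (rv y).
Proof.
split.
- move=> /nbhs_ballP[e /= e0 h]; exists (e / 2); first by rewrite divr_gt0.
  move=> y xy; apply: h; split => // i j; rewrite ord1 !rvE.
  by apply: (le_lt_trans (xy j)); rewrite ltr_pdivrMr// ltr_pMr// ltr1n.
- move=> [d d0 h]; apply/nbhs_ballP; exists d => //= a [_ xa].
  rewrite -(rv_surj a); apply: h => i; rewrite tnth_mktuple -rvE.
  by apply: ltW; exact: xa.
Qed.

Lemma domain_boxed : exists B, 0 <= B /\ forall x, Om x -> boxed B x.
Proof.
have [+ _] := HOm; move=> -[M [_ hM]].
exists (`|M| + 1); split; first by rewrite addr_ge0.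
move=> x Ox i.
have : `|rv x| <= `|M| + 1 by apply: hM; [rewrite ltr_pwDr// ler_norm|exists x].
apply: le_trans; rewrite -rvE.
have -> : `|rv x| = mx_norm (rv x) by [].
rewrite mx_normrE; exact: (le_bigmax _ _ (ord0, i)).
Qed.

(** Connectedness is put in the form in which it is consumed: a symmetric and transitive relation
    that holds locally holds between any two points of the open core. *)
Lemma domain_core : exists O : set (n.-tuple R), [/\
  O !=set0, O `<=` Om,
  (forall y, O y -> exists2 d : R, 0 < d & near_by d y `<=` O),
  (forall x, Om x <-> forall d : R, 0 < d -> exists2 y, O y & near_by d x y) &
  forall E : n.-tuple R -> n.-tuple R -> Prop,
    (forall x y, E x y -> E y x) -> (forall y x z, E x y -> E y z -> E x z) ->
    (forall y, O y -> exists2 d : R, 0 < d & near_by d y `<=` E y) ->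
    forall y z, O y -> O z -> E y z].
Proof.
have [_ [[U [oU [cO [[a0 Ua0] OmE]]]] _]] := HOm.
exists (rv @^-1` U); split.
- by exists [tuple a0 ord0 i | i < n]; rewrite /= rv_surj.
- move=> x Ox; suff [y Oy /rv_inj <-//] : (rv @` Om) (rv x).
  by rewrite OmE; exact: subset_closure.
- move=> y Oy; have /rv_nbhs[d d0 h] : nbhs (rv y) U by rewrite nbhsE; exists U.
  by exists d => // z /h.
- move=> x; split.
  + move=> Ox d d0; have : closure U (rv x) by rewrite -OmE; exists x.
    move=> /(_ [set a | exists2 z, a = rv z & near_by d x z]).
    case; first by apply/rv_nbhs; exists d => // y xy; exists y.
    by move=> a [Oa [z az xz]]; exists z => //=; rewrite -az.
  + move=> h; suff : (rv @` Om) (rv x) by case=> y Oy /rv_inj <-.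
    rewrite OmE => A /rv_nbhs[d d0 hA].
    have [y Oy xy] := h _ d0; exists (rv y); split => //; exact: hA.
- move=> E Es Et Eo y z Oy Oz.
  (* The class of [y] and its complement in [U] are both open, so the class is all of [U]. *)
  pose C := [set a | U a /\ exists2 w, a = rv w & E y w].
  have EE w : U (rv w) -> E w w.
    by move=> Ow; have [d d0] := Eo _ Ow; apply; apply: near_by_refl; exact: ltW.
  have nO a : U a -> exists2 w, a = rv w & U (rv w).
    by move=> Oa; exists [tuple a ord0 i | i < n]; rewrite rv_surj.
  have nb w : U (rv w) -> exists2 d : R, 0 < d &
      forall v, near_by d w v -> U (rv v) /\ E w v.
    move=> Ow; have /rv_nbhs[d d0 h] : nbhs (rv w) U by rewrite nbhsE; exists U.
    have [e e0 h'] := Eo _ Ow; exists (Num.min d e); first by rewrite lt_min d0.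
    move=> v wv; split.
      by apply: h; apply: near_by_le wv; rewrite ge_min lexx.
    by apply: h'; apply: near_by_le wv; rewrite ge_min lexx orbT.
  have oC : open C.
    rewrite openE => a [Oa [w aw Ew]]; rewrite aw in Oa *.
    have [d d0 h] := nb _ Oa.
    apply/rv_nbhs; exists d => // v /h[Ov wv]; split => //.
    by exists v => //; exact: Et wv.
  have oD : open (U `\` C).
    rewrite openE => a [Oa Ca]; have [w aw Ow] := nO _ Oa.
    have [d d0 h] := nb _ Ow; rewrite aw.
    apply/rv_nbhs; exists d => // v /h[Ov wv]; split => // -[_ [v' /rv_inj <- yv]].
    by apply: Ca; rewrite aw; split => //; exists w => //; apply: Et yv _; exact: Es.
  have CO : C = U.
    apply: cO; first by exists (rv y); split => //; exists y => //; exact: EE.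
      by exists C => //; apply/seteqP; split => a; [move=> Ca; split => //; case: Ca|case].
    exists (~` (U `\` C)); first by rewrite closedC.
    apply/seteqP; split => a; first by move=> Ca; split; [case: Ca|move=> []].
    by move=> [Oa h]; apply: contrapT => Ca; exact: h.
  have : C (rv z) by rewrite CO.
  by move=> [_ [w /rv_inj <-]].
Qed.

(** The sigma-algebra is the product one, so closedness is used through grids: [Om] is the
    intersection, over finer and finer grids, of the finite unions of cells that meet it. *)
Lemma domain_measurable : measurable Om.
Proof.
have [B [B0 hB]] := domain_boxed.
have [U [_ OOm _ cl _]] := domain_core.
have /choice[A hA] : forall m : nat, exists A : set (n.-tuple R),
    [/\ measurable A, Om `<=` A &
     forall x, boxed B x -> A x -> exists2 y, Om y & near_by m.+1%:R^-1 x y].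
  move=> m; have [|I [k [mk hk]]] := @grid_cells R n B m.+1%:R^-1.
    by rewrite invr_gt0.
  exists (k @^-1` (k @` Om)); split; first exact: mk.
    by move=> x Ox; exists x.
  move=> x bx [y Oy kxy]; exists y => //.
  by apply: hk; [exact: bx|exact: hB|].
pose Bx := [set x : n.-tuple R | boxed B x].
have mB : measurable Bx.
  rewrite (_ : Bx = \bigcap_(i in setT)
     [set x : n.-tuple R | `[- B, B]%classic (tnth x i)]).
    apply: fin_bigcap_measurable; first exact: finite_finset.
    by move=> i _; exact: measurable_tnth_preimage.
  apply/seteqP; split => x /= h i; first by rewrite /= in_itv/= -ler_norml.
  by move: (h i I); rewrite /= in_itv/= -ler_norml.
rewrite (_ : Om = Bx `&` \bigcap_m A m).
  by apply: measurableI => //; apply: bigcapT_measurable => m; case: (hA m).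
apply/seteqP; split => x.
  by move=> Ox; split; [exact: hB|move=> m _; case: (hA m) => _ + _; apply].
move=> [bx hx]; apply/cl => d d0.
have [m hme] : exists m : nat, m.+1%:R^-1 < d / 2.
  exists (Num.truncn (d / 2)^-1); rewrite invf_plt ?posrE ?divr_gt0//; exact: truncnS_gt.
have [_ _ /(_ x bx (hx m I))[y Oy xy]] := hA m.
have [|z Oz yz] := (cl y).1 Oy (d / 2); first by rewrite divr_gt0.
exists z => //; rewrite (splitr d); apply: near_by_trans yz.
by apply: near_by_le xy; exact: ltW.
Qed.

End Domain.

(** * Bernoulli, tangent and continuity estimates for real powers *)

Section PowerFunctions.
Context {R : realType}.
Implicit Types a b s t x : R.

(** Young's inequality for the product of x^b and 1, with conjugate exponents 1/b and 1/(1-b). *)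
Lemma powR_le_bernoulli b x : 0 < b <= 1 -> 0 <= x -> x `^ b <= 1 + b * (x - 1).
Proof.
move=> /andP[b0]; rewrite le_eqVlt => /predU1P[->|b1] x0.
  by rewrite powRr1//; lra.
have := @conjugate_powR R (x `^ b) 1 b^-1 (1 - b)^-1 (powR_ge0 _ _) ler01.
rewrite !invr_gt0 subr_gt0 !invrK => /(_ b0 b1) /(_ _)/wrap[]; first lra.
by rewrite mulr1 -powRrM divff ?gt_eqF// powRr1// powR1; lra.
Qed.

(** Obtained by applying the concave case with exponent 1/a to 1 + a(x - 1). *)
Lemma powR_ge_bernoulli a x : 1 <= a -> 0 <= x -> 1 + a * (x - 1) <= x `^ a.
Proof.
move=> a1 x0; have a0 : 0 < a by lra.
have [z0|z0] := leP (1 + a * (x - 1)) 0; first by rewrite (le_trans z0)// powR_ge0.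
have : (1 + a * (x - 1)) `^ a^-1 <= x.
  apply: (le_trans (powR_le_bernoulli _ _ _ (ltW z0))).
    by rewrite invr_gt0 a0/= invf_le1.
  by rewrite addrAC subrr add0r mulKf ?gt_eqF//; lra.
move=> /(ge0_ler_powR (ltW a0)); rewrite !nnegrE powR_ge0 x0 => /(_ isT isT).
by rewrite -powRrM mulVf ?gt_eqF// powRr1// ltW.
Qed.

(** Bernoulli's inequality at s/t, multiplied by t^a. *)
Lemma powR_tangent a s t : 1 <= a -> 0 <= s -> 0 <= t ->
  t `^ a - s `^ a <= a * t `^ (a - 1) * (t - s).
Proof.
move=> a1 s0; rewrite le_eqVlt => /predU1P[<-|t0].
  have [->|an1] := eqVneq a 1.
    by rewrite subrr powRr0 !powRr1//; lra.
  rewrite !powR0 ?subr_eq0//; last by rewrite gt_eqF//; lra.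
  by rewrite mulr0 mul0r sub0r oppr_le0 powR_ge0.
have := powR_ge_bernoulli a (s / t) a1 (divr_ge0 s0 (ltW t0)).
have ta : t `^ a = t * t `^ (a - 1) by rewrite mulr_powRB1//; lra.
have sa : s `^ a = t `^ a * (s / t) `^ a.
  by rewrite -powRM ?divr_ge0 ?(ltW t0)// mulrC divfK ?gt_eqF.
move=> /(ler_wpM2l (powR_ge0 t a)); rewrite -sa => h.
have e : t `^ a * (1 + a * (s / t - 1)) = t `^ a + a * t `^ (a - 1) * (s - t).
  by rewrite ta; field; rewrite gt_eqF.
rewrite e in h; lra.
Qed.

Lemma powR_subadd b s t : 0 < b <= 1 -> 0 <= s -> 0 <= t ->
  (s + t) `^ b <= s `^ b + t `^ b.
Proof.
move=> /andP[b0 b1]; rewrite le_eqVlt => /predU1P[<- _|s0].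
  by rewrite add0r lerDr powR_ge0.
rewrite le_eqVlt => /predU1P[<-|t0]; first by rewrite addr0 lerDl powR_ge0.
have w0 : 0 < s + t by lra.
have E x : 0 < x -> x <= s + t -> (s + t) `^ b * (x / (s + t)) <= x `^ b.
  move=> x0 xw.
  have -> : x `^ b = (s + t) `^ b * (x / (s + t)) `^ b.
    by rewrite -powRM ?divr_ge0 ?ltW// mulrCA divff ?mulr1 ?gt_eqF.
  rewrite ler_wpM2l ?powR_ge0//.
  by apply: ger1_powR => //; rewrite divr_gt0//= ler_pdivrMr// mul1r.
apply: le_trans (lerD (E s s0 _) (E t t0 _)); [|lra|lra].
by rewrite -mulrDr -mulrDl divff ?gt_eqF// mulr1.
Qed.

Lemma powR_midpoint b s t : 0 < b <= 1 -> 0 <= s -> 0 <= t ->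
  s `^ b + t `^ b <= 2 * ((s + t) / 2) `^ b.
Proof.
move=> b01 s0 t0; have [m0|m0] := leP ((s + t) / 2) 0.
  have -> : s = 0 by lra. have -> : t = 0 by lra.
  by rewrite addr0 mul0r; lra.
have st0 : 0 < s + t by lra.
set m := (s + t) / 2 in m0 *.
have E x : 0 <= x -> x `^ b <= m `^ b * (1 + b * (x / m - 1)).
  move=> x0; have -> : x `^ b = m `^ b * (x / m) `^ b.
    by rewrite -(powRM _ (ltW m0) (divr_ge0 x0 (ltW m0))) mulrCA divff ?mulr1 ?gt_eqF.
  rewrite ler_wpM2l ?powR_ge0//.
  by apply: powR_le_bernoulli => //; rewrite divr_ge0// ltW.
apply: le_trans (lerD (E s s0) (E t t0)) _; rewrite -mulrDr mulrC.
rewrite ler_wpM2r ?powR_ge0//.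
have e : s / m + t / m = 2 by rewrite /m; field; rewrite gt_eqF.
rewrite addrACA -mulrDr addrACA e; lra.
Qed.

(** For b <= 1 subadditivity gives Hölder continuity; for b > 1 the tangent inequality gives a
    Lipschitz constant on [0, Q]. *)
Lemma powR_unif_cont b (Q e : R) : 0 <= b -> 0 < e ->
  exists2 d : R, 0 < d & forall s t, 0 <= s <= Q -> 0 <= t <= Q -> `|s - t| <= d ->
    `|s `^ b - t `^ b| <= e.
Proof.
move=> b0 e0.
suff [d d0 H] : exists2 d : R, 0 < d & forall s t, 0 <= s -> s <= t -> t <= Q ->
    t - s <= d -> t `^ b - s `^ b <= e.
  exists d => // s t /andP[s0 sQ] /andP[t0 tQ].
  wlog st : s t s0 sQ t0 tQ / s <= t.
    move=> hw; case/orP: (le_total s t) => st; first exact: hw.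
    by rewrite distrC (distrC (s `^ b)); exact: hw.
  rewrite distrC ger0_norm ?subr_ge0// => std.
  by rewrite distrC ger0_norm ?H// subr_ge0 ge0_ler_powR// nnegrE.
move: b0; rewrite le_eqVlt => /predU1P[<-|b0].
  by exists 1 => // s t _ _ _ _; rewrite !powRr0 subrr ltW.
have [b1|b1] := leP b 1.
  exists (e `^ b^-1); first exact: powR_gt0.
  move=> s t s0 st tQ std.
  have := powR_subadd b s (t - s) _ s0; rewrite b0 b1 subr_ge0 => /(_ isT st).
  rewrite subrKC => h; rewrite lerBlDl; apply: (le_trans h); rewrite lerD2l.
  move: std => /(ge0_ler_powR (ltW b0)); rewrite !nnegrE subr_ge0 powR_ge0 st.
  by move=> /(_ isT isT); rewrite -powRrM mulVf ?gt_eqF// powRr1// ltW.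
pose L := b * `|Q| `^ (b - 1) + 1.
have L0 : 0 < L by rewrite ltr_wpDl// mulr_ge0 ?powR_ge0 ?ltW.
exists (e / L); first exact: divr_gt0.
move=> s t s0 st tQ; rewrite ler_pdivlMr// => std.
apply: (le_trans (powR_tangent _ _ _ (ltW b1) s0 (le_trans s0 st))).
apply: le_trans std; rewrite mulrC ler_wpM2l ?subr_ge0// /L.
rewrite ler_wpDr// ler_wpM2l ?(ltW b0)//.
have t0 := le_trans s0 st.
apply: ge0_ler_powR; rewrite ?nnegrE ?subr_ge0 ?(ltW b1)//.
by rewrite (le_trans tQ)// ler_norm.
Qed.

Lemma powR_small r (K e : R) : 0 < r -> 0 < e -> 0 <= K ->
  exists N0, forall N, (N0 <= N)%N -> K * N.+1%:R^-1 `^ r <= e.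
Proof.
move=> r0 e0 K0; pose d := (e / (K + 1)) `^ r^-1.
have K1 : 0 < K + 1 by lra.
have d0 : 0 < d by rewrite powR_gt0// divr_gt0.
exists (Num.truncn d^-1) => N hN.
have h : N.+1%:R^-1 <= d.
  rewrite invf_ple ?posrE//; apply: ltW; apply: (lt_le_trans (truncnS_gt _)).
  by rewrite ler_nat ltnS.
have : N.+1%:R^-1 `^ r <= e / (K + 1).
  apply: (@le_trans _ _ (d `^ r)).
    by apply: ge0_ler_powR; rewrite ?nnegrE ?invr_ge0// ltW.
  by rewrite -powRrM mulVf ?gt_eqF// powRr1 ?divr_ge0// ltW.
rewrite ler_pdivlMr// => h2; apply: le_trans h2; rewrite mulrC ler_wpM2l ?powR_ge0//; lra.
Qed.

End PowerFunctions.

(** * The cost and its second differences *)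

(** Working with the squared distance makes the parallelogram identity and the Lipschitz bounds
    polynomial algebra; the cost is its power p/2. *)
Definition sqd {R : realType} {n : nat} (x y : n.-tuple R) : R :=
  \sum_(i < n) (tnth x i - tnth y i) ^+ 2.

Definition cost {R : realType} {n : nat} (p : R) (x y : n.-tuple R) : R :=
  Defs.edist x y `^ p.

Section Cost.
Context {R : realType} {n : nat} (p : R).
Implicit Types x y z : n.-tuple R.

Lemma sqd_ge0 x y : 0 <= sqd x y.
Proof. by apply: sumr_ge0 => i _; exact: sqr_ge0. Qed.

Lemma costE x y : cost p x y = sqd x y `^ (p / 2).
Proof.
by rewrite /cost /Defs.edist -/(sqd x y) -powR12_sqrt ?sqd_ge0// -powRrM mulrC.
Qed.

Lemma cost_sym x y : cost p x y = cost p y x.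
Proof.
rewrite !costE; congr (_ `^ _); apply: eq_bigr => i _.
by rewrite -sqrrN opprB.
Qed.

Lemma cost_ge0 x y : 0 <= cost p x y.
Proof. exact: powR_ge0. Qed.

Lemma cost_diag x : 1 < p -> cost p x x = 0.
Proof.
move=> p1; rewrite costE /sqd big1 ?powR0//; last by move=> i _; rewrite subrr expr0n.
have h : 0 < p / 2 by lra.
by rewrite gt_eqF.
Qed.

Lemma sqd_le (B : R) x y : boxed B x -> boxed B y -> sqd x y <= n%:R * (2 * B) ^+ 2.
Proof.
move=> bx by_; rewrite mulr_natl -[n in leRHS]card_ord -sumr_const ler_sum// => i _.
have := bx i; have := by_ i; rewrite !ler_norml => /andP[? ?] /andP[? ?].
rewrite !expr2; nra.
Qed.

Lemma sqd_lip (B d : R) x x' y : boxed B x -> boxed B x' -> boxed B y ->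
  near_by d x x' -> `|sqd x y - sqd x' y| <= n%:R * (4 * B) * d.
Proof.
move=> bx bx' by_ xx'; rewrite /sqd -sumrB -mulrA mulr_natl.
rewrite -[n in leRHS]card_ord -sumr_const.
apply: le_trans (ler_norm_sum _ _ _) _; apply: ler_sum => i _.
have -> : (tnth x i - tnth y i) ^+ 2 - (tnth x' i - tnth y i) ^+ 2 =
  (tnth x i + tnth x' i - 2 * tnth y i) * (tnth x i - tnth x' i) by ring.
rewrite normrM ler_pM//.
  have := bx i; have := by_ i; have := bx' i; rewrite !ler_norml.
  by move=> /andP[? ?] /andP[? ?] /andP[? ?]; apply/andP; split; lra.
Qed.

Lemma cost_bound (B : R) : 1 < p -> exists2 C : R, 0 <= C &
  forall x y, boxed B x -> boxed B y -> cost p x y <= C.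
Proof.
move=> p1; exists ((n%:R * (2 * B) ^+ 2) `^ (p / 2)); first exact: powR_ge0.
move=> x y bx by_; rewrite costE; apply: ge0_ler_powR.
- lra.
- by rewrite nnegrE sqd_ge0.
- by rewrite nnegrE mulr_ge0// sqr_ge0.
- exact: sqd_le.
Qed.

Lemma cost_unif_cont (B e : R) : 1 < p -> 0 <= B -> 0 < e -> exists2 d : R, 0 < d &
  forall x x' y, boxed B x -> boxed B x' -> boxed B y -> near_by d x x' ->
    `|cost p x y - cost p x' y| <= e.
Proof.
move=> p1 B0 e0.
have [|d d0 hd] := @powR_unif_cont R (p / 2) (n%:R * (2 * B) ^+ 2) e _ e0; first lra.
pose L := n%:R * (4 * B) + 1.
have L0 : 0 < L by rewrite ltr_wpDl// !mulr_ge0.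
exists (d / L); first exact: divr_gt0.
move=> x x' y bx bx' by_ xx'; rewrite !costE; apply: hd.
- by rewrite sqd_ge0 sqd_le.
- by rewrite sqd_ge0 sqd_le.
apply: le_trans (sqd_lip _ _ _ _ _ bx bx' by_ xx') _.
rewrite mulrCA ger_pMr// ler_pdivrMr// mul1r /L lerDl//.
Qed.

(* For p <= 2 the bound comes from the concavity of t^(p/2), for p >= 2 from the
   tangent inequality at the two outer points and the continuity of t^(p/2-1). *)
Lemma cost_second_difference (B e : R) : 1 < p -> 0 <= B -> 0 < e ->
  exists N0, forall N, (N0 <= N)%N -> forall x y y1 y2,
    boxed B x -> boxed B y -> boxed B y1 -> boxed B y2 ->
    (forall i, tnth y1 i - tnth y i = tnth y i - tnth y2 i) ->
    near_by (2 * B / N.+1%:R) y1 y ->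
    cost p x y1 + cost p x y2 - 2 * cost p x y <= e / N.+1%:R.
Proof.
move=> p1 B0 e0.
pose H (y y1 : n.-tuple R) : R := \sum_(i < n) (tnth y1 i - tnth y i) ^+ 2.
have H0 y y1 : 0 <= H y y1 by apply: sumr_ge0 => i _; exact: sqr_ge0.
(* Parallelogram identity: [y] is the midpoint of [y1] and [y2], and [H] is the squared
   half-distance. *)
have paral x y y1 y2 : (forall i, tnth y1 i - tnth y i = tnth y i - tnth y2 i) ->
    sqd x y1 + sqd x y2 = 2 * (sqd x y + H y y1).
  move=> hy; rewrite /sqd /H -!big_split/= mulr_sumr; apply: eq_bigr => i _.
  have -> : tnth y2 i = tnth y i - (tnth y1 i - tnth y i) by rewrite hy; ring.
  ring.
have Hle N y y1 : near_by (2 * B / N.+1%:R) y1 y ->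
    H y y1 <= n%:R * (2 * B) ^+ 2 * (N.+1%:R^-1) ^+ 2.
  move=> hy; rewrite -mulrA -exprMn mulr_natl -[n in leRHS]card_ord -sumr_const.
  apply: ler_sum => i _; rewrite -real_normK ?num_real//.
  by rewrite ler_sqr ?nnegrE// ?hy// mulr_ge0 ?invr_ge0 ?mulr_ge0.
set Q := n%:R * (2 * B) ^+ 2.
have Q0 : 0 <= Q by rewrite mulr_ge0// sqr_ge0.
have [p2|p2] := leP p 2.
- have [||N0 hN0] := @powR_small R (p - 1) (2 * Q `^ (p / 2)) e _ e0; first lra.
    by rewrite mulr_ge0 ?powR_ge0.
  exists N0 => N /hN0 hN x y y1 y2 bx by_ by1 by2 hy nb.
  have b01 : 0 < p / 2 <= 1 by apply/andP; split; lra.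
  rewrite !costE lerBlDl.
  apply: (le_trans (powR_midpoint _ _ _ b01 (sqd_ge0 _ _) (sqd_ge0 _ _))).
  rewrite (paral _ _ _ _ hy) mulrAC divff ?mul1r//.
  apply: (@le_trans _ _ (2 * (sqd x y `^ (p / 2) + H y y1 `^ (p / 2)))).
    by rewrite ler_pM2l// powR_subadd// sqd_ge0.
  rewrite mulrDr lerD2l.
  apply: (@le_trans _ _ (2 * (Q * N.+1%:R^-1 ^+ 2) `^ (p / 2))).
    rewrite ler_pM2l//; apply: ge0_ler_powR; rewrite ?nnegrE ?Hle//; first lra.
    by rewrite mulr_ge0// sqr_ge0.
  rewrite powRM ?sqr_ge0// -(powR_mulrn 2) ?invr_ge0// -powRrM.
  have -> : 2%:R * (p / 2) = p by field.
  rewrite -(@mulr_powRB1 _ _ p) ?invr_ge0//; last lra.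
  set t := N.+1%:R^-1 in hN *.
  have -> : 2 * (Q `^ (p / 2) * (t * t `^ (p - 1))) =
    (2 * Q `^ (p / 2) * t `^ (p - 1)) * t by ring.
  by rewrite ler_wpM2r// invr_ge0.
pose r := p / 2 - 1.
have r0 : 0 <= r by rewrite /r; lra.
pose L := n%:R * (4 * B) * (2 * B).
have L0 : 0 <= L by rewrite !mulr_ge0.
have a0 : 0 < p / 2 by lra.
have e'0 : 0 < e / p / (L + 1) by rewrite !divr_gt0//; lra.
have [d d0 hd] := @powR_unif_cont R r Q _ r0 e'0.
(* [N1] makes the contribution of order 1/N^2 cost at most half of the budget; [N2] brings the two
   outer squared distances within the modulus [d] of t^(p/2-1). *)
have [||N1 hN1] := @powR_small R 1 (p * Q * Q `^ r) (e / 2) ltr01; first lra.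
  by rewrite !mulr_ge0 ?powR_ge0//; lra.
have [N2 hN2] := @powR_small R 1 (2 * L) d ltr01 d0 (mulr_ge0 (ler0n _ 2) L0).
exists (maxn N1 N2) => N; rewrite geq_max => /andP[/hN1 h1 /hN2 h2].
move=> x y y1 y2 bx by_ by1 by2 hy nb.
have nb2 : near_by (2 * B / N.+1%:R) y2 y.
  by move=> i; rewrite distrC -hy; exact: nb.
rewrite !powRr1 ?invr_ge0// in h1 h2.
rewrite !costE.
set q := sqd x y; set q1 := sqd x y1; set q2 := sqd x y2; set h := H y y1.
have qq : q1 + q2 = 2 * (q + h) by exact: paral.
set t := N.+1%:R^-1 in h1 h2 *.
have t0 : 0 < t by rewrite invr_gt0.
have t1 : t <= 1 by rewrite invf_le1// ler1n.
have sqdC (u v : n.-tuple R) : sqd u v = sqd v u by apply: eq_bigr => i _; rewrite -sqrrN opprB.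
have d1 : `|q1 - q| <= L * t.
  rewrite /q1 /q !(sqdC x) /L -(mulrA _ (2 * B)); exact: sqd_lip nb.
have d2 : `|q2 - q| <= L * t.
  rewrite /q2 /q !(sqdC x) /L -(mulrA _ (2 * B)); exact: sqd_lip nb2.
have hle : h <= Q * t ^+ 2 by exact: Hle.
have q0 : 0 <= q by exact: sqd_ge0.
have q10 : 0 <= q1 <= Q by rewrite sqd_ge0 sqd_le.
have q20 : 0 <= q2 <= Q by rewrite sqd_ge0 sqd_le.
have h0 : 0 <= h by exact: H0.
have q12 : `|q1 - q2| <= 2 * L * t.
  rewrite -(subrKA q); apply: le_trans (ler_normD _ _) _.
  by rewrite (distrC q) mulrDl !mul1r mulrDl lerD.
have hr := hd _ _ q10 q20 (le_trans q12 h2).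
have [/andP[q1p q1Q] /andP[q2p q2Q]] := (q10, q20).
have a1 : 1 <= p / 2 by lra.
have T1 := powR_tangent _ _ _ a1 q0 q1p.
have T2 := powR_tangent _ _ _ a1 q0 q2p.
rewrite -/r in T1 T2.
have Qr1 : q1 `^ r <= Q `^ r by apply: ge0_ler_powR; rewrite ?nnegrE.
have Qr2 : q2 `^ r <= Q `^ r by apply: ge0_ler_powR; rewrite ?nnegrE.
set A := q1 `^ r in T1 hr Qr1; set A' := q2 `^ r in T2 hr Qr2.
(* Since q1 + q2 = 2(q + h), the two increments are h plus and minus (q1 - q2)/2. The term in h is
   of order 1/N^2; the other is of order 1/N times the small variation [A - A']. *)
have key : A * (q1 - q) + A' * (q2 - q) = h * (A + A') + (q1 - q2) / 2 * (A - A').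
  have -> : q2 = 2 * (q + h) - q1 by lra.
  by field.
have k1 : h * (A + A') <= 2 * Q * Q `^ r * t ^+ 2.
  apply: (@le_trans _ _ (h * (2 * Q `^ r))); first by rewrite ler_wpM2l//; lra.
  have -> : 2 * Q * Q `^ r * t ^+ 2 = Q * t ^+ 2 * (2 * Q `^ r) by ring.
  by rewrite ler_wpM2r// mulr_ge0 ?powR_ge0.
have k2 : (q1 - q2) / 2 * (A - A') <= L * t * (e / p / (L + 1)).
  apply: le_trans (ler_norm _) _; rewrite normrM ler_pM//.
  by rewrite normrM (@ger0_norm _ 2^-1) ?invr_ge0//; lra.
have k3 : L * t * (e / p / (L + 1)) <= t * (e / p).
  have -> : L * t * (e / p / (L + 1)) = t * (e / p) * (L / (L + 1)).
    by field; apply/andP; split; rewrite gt_eqF//; lra.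
  rewrite ger_pMr; last by rewrite !mulr_gt0 ?invr_gt0//; lra.
  by rewrite ler_pdivrMr ?mul1r ?lerDl//; apply: ltr_wpDl.
have S1 : q1 `^ (p / 2) + q2 `^ (p / 2) - 2 * q `^ (p / 2) <=
    p / 2 * (A * (q1 - q) + A' * (q2 - q)).
  by rewrite mulrDr !mulrA; lra.
apply: (le_trans S1). rewrite key.
apply: (@le_trans _ _ (p / 2 * (2 * Q * Q `^ r * t ^+ 2 + t * (e / p)))).
  by rewrite ler_wpM2l//; lra.
have -> : p / 2 * (2 * Q * Q `^ r * t ^+ 2 + t * (e / p)) =
    (p * Q * Q `^ r * t) * t + e / 2 * t by field; rewrite gt_eqF//; lra.
have : p * Q * Q `^ r * t * t <= e / 2 * t by rewrite ler_wpM2r// ltW.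
lra.
Qed.

End Cost.

(** * Duality for finite transport problems *)

Section FiniteTransport.
Context {R : realType} {I J : finType}.
Implicit Types (P : I -> J -> R).

Definition coupling (a : I -> R) (b : J -> R) P : Prop :=
  [/\ forall i j, 0 <= P i j, forall i, \sum_j P i j = a i
    & forall j, \sum_i P i j = b j].

(* The barrier [prod P_ij] keeps the maximizer in the interior of the polytope of couplings. *)
Lemma barrier_max (a : I -> R) (b : J -> R) (c : I -> J -> R) (e : R) :
  (forall i, 0 < a i) -> (forall j, 0 < b j) ->
  \sum_i a i = 1 -> \sum_j b j = 1 ->
  exists P, [/\ coupling a b P, forall i j, 0 < P i j & forall Q, coupling a b Q ->
    (\prod_i \prod_j Q i j) * expR (- (\sum_i \sum_j c i j * Q i j) / e) <=
    (\prod_i \prod_j P i j) * expR (- (\sum_i \sum_j c i j * P i j) / e)].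
Proof.
move=> a0 b0 a1 b1.
(* Couplings are flattened into row vectors, where closed bounded sets are compact and the extreme
   value theorem applies. *)
pose N := #|{: I * J}|.
pose m (v : 'rV[R]_N) i j : R := v ord0 (enum_rank (i, j)).
pose w P : 'rV[R]_N := \row_k P (enum_val k).1 (enum_val k).2.
have mw P i j : m (w P) i j = P i j by rewrite /m mxE enum_rankK.
pose A := [set v | coupling a b (m v)].
(* The exponential of the usual logarithmic objective: it stays continuous up to the boundary of the
   polytope, where it vanishes. *)
pose G P := (\prod_i \prod_j P i j) * expR (- (\sum_i \sum_j c i j * P i j) / e).
have cm i j : continuous (fun v => m v i j) by move=> v; exact: coord_continuous.
have csum (K : finType) (F : K -> 'rV[R]_N -> R) : (forall k, continuous (F k)) ->
    continuous (fun v => \sum_k F k v).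
  by move=> h; apply: continuous_big => // x; exact: add_continuous.
have cprod (K : finType) (F : K -> 'rV[R]_N -> R) : (forall k, continuous (F k)) ->
    continuous (fun v => \prod_k F k v).
  by move=> h; apply: continuous_big => // x; exact: mul_continuous.
have c1 : continuous (fun v => \prod_i \prod_j m v i j).
  by apply: (cprod) => i; exact: (cprod _ (fun j v => m v i j)).
have c2 : continuous (fun v => \sum_i \sum_j c i j * m v i j).
  apply: (csum) => i; apply: (csum) => j v.
  by apply: (@continuousM _ _ (cst (c i j)) (fun v => m v i j)); [exact: cst_continuous|exact: cm].
have cG : continuous (fun v => G (m v)).
  move=> v; apply: (@continuousM _ _ (fun v => \prod_i \prod_j m v i j)); first exact: c1.
  apply: (@continuous_comp _ _ _ (fun v => - (\sum_i \sum_j c i j * m v i j) / e) expR).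
    apply: (@continuousM _ _ (fun v => - \sum_i \sum_j c i j * m v i j) (cst e^-1)).
      by apply: (@continuousN _ _ _ (fun v => \sum_i \sum_j c i j * m v i j)); exact: c2.
    exact: cst_continuous.
  exact: continuous_expR.
have clA : closed A.
  rewrite (_ : A = \bigcap_(i in [set: I]) \bigcap_(j in [set: J])
       ((fun v => m v i j) @^-1` [set x | 0 <= x]) `&`
     \bigcap_(i in [set: I]) ((fun v => \sum_j m v i j) @^-1` [set x | x = a i]) `&`
     \bigcap_(j in [set: J]) ((fun v => \sum_i m v i j) @^-1` [set x | x = b j])).
    apply: closedI; first apply: closedI.
    - apply: closed_bigI => i _; apply: closed_bigI => j _.
      by apply: preimage_closed => [v _|]; [exact: cm|exact: closed_ge].
    - apply: closed_bigI => i _.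
      apply: preimage_closed => [v _|]; last exact: closed_eq.
      exact: (csum _ (fun j v => m v i j)).
    - apply: closed_bigI => j _.
      apply: preimage_closed => [v _|]; last exact: closed_eq.
      exact: (csum _ (fun i v => m v i j)).
  apply/seteqP; split => v.
    move=> [h1 h2 h3]; split; first split.
    - by move=> i _ j _ /=; exact: h1.
    - by move=> i _; exact: h2.
    - by move=> j _; exact: h3.
  move=> [[h1 h2] h3]; split.
  - by move=> i j; exact: (h1 i Logic.I j Logic.I).
  - by move=> i; exact: (h2 i Logic.I).
  - by move=> j; exact: (h3 j Logic.I).
have bA : bounded_set A.
  exists 1; split; first exact: num_real.
  move=> M M1 v [h1 h2 h3]; apply: le_trans (ltW M1).
  have -> : `|v| = mx_norm v by [].
  rewrite mx_normrE; apply: bigmax_le => // -[i k] _ /=.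
  rewrite ord1 -(enum_valK k); case: (enum_val k) => x y.
  rewrite -/(m v x y) ger0_norm//.
  apply: (@le_trans _ _ (a x)); first by rewrite -h2 (bigD1 y)//= lerDl sumr_ge0.
  by rewrite -a1 (bigD1 x)//= lerDl sumr_ge0// => z _; exact: ltW.
(* The product coupling has only positive entries, so the maximum of [G] is positive and no entry of
   a maximizer can vanish. *)
pose P0 i j := a i * b j.
have P0c : coupling a b P0.
  split; first by move=> i j; rewrite mulr_ge0// ltW.
  - by move=> i; rewrite -mulr_sumr b1 mulr1.
  - by move=> j; rewrite -mulr_suml a1 mul1r.
have wA P : coupling a b P -> A (w P).
  move=> [h1 h2 h3]; split.
  - by move=> i j; rewrite mw.
  - by move=> i; under eq_bigr do rewrite mw.
  - by move=> j; under eq_bigr do rewrite mw.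
have Gw P : G (m (w P)) = G P.
  rewrite /G; congr (_ * expR (- _ / _)).
    by apply: eq_bigr => i _; apply: eq_bigr => j _; rewrite mw.
  by apply: eq_bigr => i _; apply: eq_bigr => j _; rewrite mw.
have [||v /set_mem Av vmax] := @EVT_max_rV R N (fun v => G (m v)) A _ (bounded_closed_compact bA clA).
- by exists (w P0); exact: wA.
- exact: continuous_subspaceT.
exists (m v); split => //; last first.
  by move=> Q /wA/mem_set/vmax; rewrite Gw.
have Gv : 0 < G (m v).
  have := vmax _ (mem_set (wA _ P0c)); apply: lt_le_trans; rewrite Gw.
  by rewrite mulr_gt0 ?expR_gt0// !prodr_gt0// => i _; apply: prodr_gt0 => j _; rewrite mulr_gt0.
move=> i j; have [v0 _ _] := Av; rewrite lt_neqAle v0 andbT; apply/negP => /eqP z.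
move: Gv; rewrite /G (bigD1 i)//= (bigD1 j)//= -z !mul0r.
by rewrite ltxx.
Qed.

(** A second-order lower bound of 1 + x in exponential form, which turns the product of the factors
    of a perturbed coupling into a sum of exponents. It rests on (1 + x)(1 - x + 2x^2) = 1 + x^2(1 +
    2x) >= 1. *)
Lemma exp_le_1Dx (x : R) : - 2^-1 <= x -> expR (x - 2 * x ^+ 2) <= 1 + x.
Proof.
move=> hx; have h : 0 < 1 - (x - 2 * x ^+ 2) by rewrite expr2; nra.
have h1 : expR (- (x - 2 * x ^+ 2)) >= 1 - (x - 2 * x ^+ 2) by exact: expR_ge1Dx.
have h2 : 1 <= (1 + x) * (1 - (x - 2 * x ^+ 2)).
  have -> : (1 + x) * (1 - (x - 2 * x ^+ 2)) = 1 + x ^+ 2 * (1 + 2 * x) by ring.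
  by rewrite lerDl mulr_ge0 ?sqr_ge0//; lra.
rewrite -[x - _]opprK expRN invf_ple ?posrE ?expR_gt0//; last lra.
apply: le_trans h1; rewrite -(@ler_pM2l _ (1 + x)); last lra.
by rewrite divff// gt_eqF//; lra.
Qed.

(** First-order condition at the maximizer, in directions that preserve both marginals. Comparing
    [P] with [P + t E] gives t A <= t^2 C for all small t of either sign, hence A = 0. *)
Lemma barrier_stationary (a : I -> R) (b : J -> R) (c : I -> J -> R) (e : R) P (E : I -> J -> R) :
  0 < e -> coupling a b P -> (forall i j, 0 < P i j) ->
  (forall Q, coupling a b Q ->
    (\prod_i \prod_j Q i j) * expR (- (\sum_i \sum_j c i j * Q i j) / e) <=
    (\prod_i \prod_j P i j) * expR (- (\sum_i \sum_j c i j * P i j) / e)) ->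
  (forall i, \sum_j E i j = 0) -> (forall j, \sum_i E i j = 0) ->
  \sum_i \sum_j E i j * (c i j - e / P i j) = 0.
Proof.
move=> e0 [P0 Pa Pb] Pp Pmax Er Ec.
pose s i j := E i j / P i j.
(* For |t| <= 1/(2M) every relative change [t * s i j] is at most 1/2 in absolute value: the
   perturbed coupling stays nonnegative and [exp_le_1Dx] applies. *)
pose M := \sum_i \sum_j `|s i j| + 1.
have M0 : 0 < M.
  by rewrite ltr_wpDl// sumr_ge0// => i _; rewrite sumr_ge0.
have sM i j : `|s i j| <= M.
  rewrite /M (bigD1 i)//= (bigD1 j)//= -!addrA lerDl !addr_ge0 ?sumr_ge0// => k _.
  by rewrite sumr_ge0.
pose S := \sum_i \sum_j s i j; pose D := \sum_i \sum_j c i j * E i j.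
pose C := \sum_i \sum_j 2 * s i j ^+ 2.
have C0 : 0 <= C.
  by apply: sumr_ge0 => i _; apply: sumr_ge0 => j _; rewrite mulr_ge0 ?sqr_ge0.
have key t : `|t| <= (2 * M)^-1 -> t * (S - D / e) <= t ^+ 2 * C.
  move=> ht; have ts i j : `|t * s i j| <= 2^-1.
    rewrite normrM (le_trans (ler_pM _ _ ht (sM i j)))//.
    by rewrite invfM -mulrA mulVf ?mulr1// gt_eqF.
  pose Q i j := P i j + t * E i j.
  have QE i j : Q i j = P i j * (1 + t * s i j).
    by rewrite /Q /s; field; rewrite gt_eqF.
  have Qc : coupling a b Q.
    split.
    - move=> i j; rewrite QE mulr_ge0//; have := ts i j; rewrite ler_norml; lra.
    - by move=> i; rewrite big_split/= Pa -mulr_sumr Er mulr0 addr0.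
    - by move=> j; rewrite big_split/= Pb -mulr_sumr Ec mulr0 addr0.
  have := Pmax _ Qc.
  have -> : \prod_i \prod_j Q i j = (\prod_i \prod_j P i j) * \prod_i \prod_j (1 + t * s i j).
    rewrite -big_split; apply: eq_bigr => i _ /=; rewrite -big_split.
    by apply: eq_bigr => j _; rewrite QE.
  have -> : \sum_i \sum_j c i j * Q i j = \sum_i \sum_j c i j * P i j + t * D.
    rewrite /D mulr_sumr -big_split; apply: eq_bigr => i _ /=.
    rewrite mulr_sumr -big_split; apply: eq_bigr => j _ /=; rewrite /Q; ring.
  rewrite opprD mulrDl expRD -mulrA ler_pM2l; last first.
    by apply: prodr_gt0 => i _; exact: prodr_gt0.
  rewrite mulrCA ger_pMr ?expR_gt0// => h.
  have : expR (t * S - t ^+ 2 * C) * expR (- (t * D) / e) <= 1.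
    apply: le_trans h; rewrite ler_pM2r ?expR_gt0//.
    have -> : t * S - t ^+ 2 * C = \sum_i \sum_j (t * s i j - 2 * (t * s i j) ^+ 2).
      rewrite /S /C !mulr_sumr -sumrB; apply: eq_bigr => i _.
      rewrite !mulr_sumr -sumrB; apply: eq_bigr => j _; ring.
    rewrite expR_sum; apply: ler_prod => i _; rewrite expR_ge0 expR_sum/=.
    apply: ler_prod => j _; rewrite expR_ge0/= exp_le_1Dx//.
    by have := ts i j; rewrite ler_norml => /andP[].
  rewrite -expRD -[X in _ <= X]expR0 ler_expR; lra.
pose A := S - D / e.
have A0 : A = 0.
  apply/eqP; rewrite -normr_eq0 eq_le normr_ge0 andbT; apply/ler_addgt0Pl => d d0.
  rewrite addr0.
  pose t := Num.min (2 * M)^-1 (d / (C + 1)).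
  have t0 : 0 < t by rewrite lt_min invr_gt0 mulr_gt0// divr_gt0//; lra.
  have t1 : `|t| <= (2 * M)^-1 by rewrite (ger0_norm (ltW t0)) ge_min lexx.
  have t2 : t * (C + 1) <= d.
    by rewrite -ler_pdivlMr ?ge_min ?lexx ?orbT//; lra.
  have h1 := key t t1; have h2 := key (- t); rewrite normrN in h2.
  have {}h2 := h2 t1; rewrite -/A in h1 h2.
  rewrite sqrrN in h2; rewrite expr2 -!mulrA in h1 h2.
  rewrite ler_norml; apply/andP; split; last by rewrite ler_pM2l// in h1; nra.
  have : t * (- A) <= t * (t * C) by lra.
  rewrite ler_pM2l//; nra.
have : e * A = 0 by rewrite A0 mulr0.
rewrite /A mulrBr mulrCA divff ?gt_eqF// mulr1 => h.
have -> : \sum_i \sum_j E i j * (c i j - e / P i j) = D - e * S; last lra.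
rewrite /S /D mulr_sumr -sumrB; apply: eq_bigr => i _.
rewrite mulr_sumr -sumrB; apply: eq_bigr => j _; rewrite /s; ring.
Qed.

(** Stationarity along exchanges between two rows and two columns says that the reduced cost
    [c i j - e' / P i j] is a function of i plus a function of j. These functions are feasible
    potentials, and the slack [e' / P i j] integrated against [P] is exactly [e'] per pair, whence
    the choice of [e']. *)
Lemma finite_transport_duality (a : I -> R) (b : J -> R) (c : I -> J -> R) (e : R) : 0 < e ->
  (forall i, 0 < a i) -> (forall j, 0 < b j) ->
  \sum_i a i = 1 -> \sum_j b j = 1 ->
  exists P phi chi, [/\ coupling a b P, forall i j, phi i + chi j <= c i j &
    \sum_i \sum_j c i j * P i j <= \sum_i phi i * a i + \sum_j chi j * b j + e].
Proof.
move=> e0 a0 b0 a1 b1.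
have [i0 _] : exists i0 : I, True.
  apply: contrapT => h; move: a1; rewrite big1 => [/esym/eqP|i]; first by rewrite oner_eq0.
  by exfalso; apply: h; exists i.
have [j0 _] : exists j0 : J, True.
  apply: contrapT => h; move: b1; rewrite big1 => [/esym/eqP|j]; first by rewrite oner_eq0.
  by exfalso; apply: h; exists j.
pose K : R := (#|I| * #|J|)%:R; have K0 : 0 < K + 1 by rewrite ltr_wpDl.
pose e' := e / (K + 1); have e'0 : 0 < e' by rewrite divr_gt0.
have [P [Pc Pp Pmax]] := @barrier_max a b c e' a0 b0 a1 b1.
pose d i j := c i j - e' / P i j.
have dsq i j : d i j - d i j0 - d i0 j + d i0 j0 = 0.
  pose u (x : I) : R := (x == i)%:R - (x == i0)%:R.
  pose v (y : J) : R := (y == j)%:R - (y == j0)%:R.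
  have sel (X : finType) (x : X) (F : X -> R) : \sum_z (z == x)%:R * F z = F x.
    rewrite (bigD1 x)//= eqxx mul1r big1 ?addr0// => z /negbTE ->.
    by rewrite mul0r.
  have u0 : \sum_x u x = 0.
    rewrite /u sumrB; have := sel _ i (fun=> 1); have := sel _ i0 (fun=> 1).
    by under eq_bigr do rewrite mulr1; under [X in _ -> X = _ -> _]eq_bigr do rewrite mulr1;
      move=> -> ->; rewrite subrr.
  have v0 : \sum_x v x = 0.
    rewrite /v sumrB; have := sel _ j (fun=> 1); have := sel _ j0 (fun=> 1).
    by under eq_bigr do rewrite mulr1; under [X in _ -> X = _ -> _]eq_bigr do rewrite mulr1;
      move=> -> ->; rewrite subrr.
  have := @barrier_stationary a b c e' P (fun x y => u x * v y) e'0 Pc Pp Pmax.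
  move=> /(_ _)/wrap[].
    by move=> x; rewrite -mulr_sumr v0 mulr0.
  move=> /(_ _)/wrap[]; first by move=> y; rewrite -mulr_suml u0 mul0r.
  under eq_bigr do under eq_bigr do rewrite -mulrA.
  under eq_bigr do rewrite -mulr_sumr.
  have su F : \sum_x u x * F x = F i - F i0.
    under eq_bigr do rewrite /u mulrBl.
    by rewrite sumrB !sel.
  have sv F : \sum_x v x * F x = F j - F j0.
    under eq_bigr do rewrite /v mulrBl.
    by rewrite sumrB !sel.
  rewrite su !sv -/(d i j) -/(d i j0) -/(d i0 j) -/(d i0 j0); lra.
exists P, (fun i => d i j0), (fun j => d i0 j - d i0 j0); split => //.
  move=> i j; have : d i j <= c i j by rewrite gerBl divr_ge0// ltW.
  have := dsq i j; lra.
have [P0 Pa Pb] := Pc.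
have -> : \sum_i d i j0 * a i = \sum_i \sum_j d i j0 * P i j.
  by apply: eq_bigr => i _; rewrite -mulr_sumr Pa.
have -> : \sum_j (d i0 j - d i0 j0) * b j = \sum_i \sum_j (d i0 j - d i0 j0) * P i j.
  by rewrite exchange_big; apply: eq_bigr => j _; rewrite -mulr_sumr Pb.
rewrite -big_split/= -lerBlDl -sumrB.
apply: (@le_trans _ _ (\sum_(i : I) \sum_(j : J) e')).
  apply: ler_sum => i _; rewrite -big_split -sumrB /=; apply: ler_sum => j _.
  have hc : c i j = d i j + e' / P i j by rewrite /d subrK.
  rewrite hc; have -> : d i j = d i j0 + d i0 j - d i0 j0 by have := dsq i j; lra.
  have : e' / P i j * P i j = e' by rewrite divfK// gt_eqF.
  lra.
rewrite !sumr_const -mulrnA -mulr_natr /e' -mulrA ger_pMr// mulrC ler_pdivrMr// mul1r.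
by rewrite mulnC lerDl.
Qed.

End FiniteTransport.

(** * c-transforms of bounded functions *)

Definition bnd {R : realType} {X : Type} (Om : set X) (h : X -> R) : Prop :=
  exists M : R, forall x, Om x -> `|h x| <= M.

(** Real-valued counterpart of [ctrans]: the two agree for functions bounded on [Om], by [ct_EFin],
    and all c-concave functions are bounded there. *)
Definition ct {R : realType} {X : Type} (Om : set X) (c : X -> X -> R)
  (h : X -> R) (y : X) : R := inf [set c x y - h x | x in Om].

Record bounded_cost {R : realType} {X : Type} (Om : set X) (c : X -> X -> R) (C : R) := {
  bc_ne : Om !=set0;
  bc_ge0 : forall x y, 0 <= c x y;
  bc_le : forall x y, Om x -> Om y -> c x y <= C;
  bc_sym : forall x y, c x y = c y x }.

Arguments bc_ne {R X Om c C}.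
Arguments bc_ge0 {R X Om c C}.
Arguments bc_le {R X Om c C}.
Arguments bc_sym {R X Om c C}.

Section CTransform.
Context {R : realType} {X : Type} {Om : set X} {c : X -> X -> R} {C : R}.
Context (H : bounded_cost Om c C).
Implicit Types (h : X -> R) (x y : X).
Local Notation ct := (ct Om c).
Local Notation bnd := (bnd Om).

Lemma ct_has_inf h y : bnd h -> has_inf [set c x y - h x | x in Om].
Proof.
move=> [M hM]; split; first by have [x Ox] := bc_ne H; exists (c x y - h x), x.
exists (- M) => _ [x Ox <-].
have := hM x Ox; have := bc_ge0 H x y; rewrite ler_norml => ? /andP[? ?]; lra.
Qed.

Lemma ct_le h x y : bnd h -> Om x -> ct h y <= c x y - h x.
Proof.
move=> bh Ox; apply: ge_inf; last by exists x.
by have [] := ct_has_inf _ y bh.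
Qed.

Lemma ct_ge h y (m : R) : (forall x, Om x -> m <= c x y - h x) -> m <= ct h y.
Proof.
move=> hm; apply: lb_le_inf; first by have [x Ox] := bc_ne H; exists (c x y - h x), x.
by move=> _ [x Ox <-]; exact: hm.
Qed.

Lemma ct_adherent h y (e : R) : bnd h -> 0 < e ->
  exists2 x, Om x & c x y - h x < ct h y + e.
Proof. by move=> bh e0; have [_ [x Ox <-] ?] := inf_adherent e0 (ct_has_inf _ y bh); exists x. Qed.

Lemma ct_EFin h y : bnd h ->
  ereal_inf [set (c x y - h x)%:E | x in Om] = (ct h y)%:E.
Proof.
move=> bh; have [ne lb] := ct_has_inf _ y bh.
rewrite -ereal_inf_EFin//; congr ereal_inf.
apply/seteqP; split => [_ [x Ox <-]|_ [_ [x Ox <-] <-]].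
  by exists (c x y - h x) => //; exists x.
by exists x.
Qed.

Lemma ct_bnd h : bnd h -> bnd (ct h).
Proof.
move=> bh; have [M hM] := bh; exists (M + C) => y Oy.
have [x0 Ox0] := bc_ne H.
have C0 : 0 <= C by exact: le_trans (bc_ge0 H x0 x0) (bc_le H _ _ Ox0 Ox0).
rewrite ler_norml; apply/andP; split.
  apply: ct_ge => x Ox; have := hM x Ox; have := bc_ge0 H x y.
  by rewrite ler_norml => ? /andP[? ?]; lra.
have := ct_le _ _ y bh Ox0; have := hM x0 Ox0; have := bc_le H _ _ Ox0 Oy.
by rewrite ler_norml => ? /andP[? ?]; lra.
Qed.

Lemma ct_anti h h' y : bnd h' -> (forall x, Om x -> h x <= h' x) -> ct h' y <= ct h y.
Proof.
move=> bh' hh; apply: ct_ge => x Ox.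
have := ct_le _ _ y bh' Ox; have := hh x Ox; lra.
Qed.

Lemma ct_ct_ge h y : bnd h -> Om y -> h y <= ct (ct h) y.
Proof.
move=> bh Oy; apply: ct_ge => x Ox.
have := ct_le _ _ x bh Oy; rewrite (bc_sym H y x); lra.
Qed.

Lemma ct_ct_ct h y : bnd h -> Om y -> ct (ct (ct h)) y = ct h y.
Proof.
move=> bh Oy; apply/eqP; rewrite eq_le; apply/andP; split.
  apply: ct_anti; first exact/ct_bnd/ct_bnd.
  by move=> x Ox; exact: ct_ct_ge.
by apply: ct_ct_ge => //; exact: ct_bnd.
Qed.

Lemma bnd_lin h h' (a b : R) : bnd h -> bnd h' -> bnd (fun x => a * h x + b * h' x).
Proof.
move=> [M hM] [M' hM']; exists (`|a| * M + `|b| * M') => x Ox.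
apply: le_trans (ler_normD _ _) _; rewrite !normrM.
by rewrite lerD// ler_wpM2l// ?hM ?hM'.
Qed.

Lemma bnd_cst (a : R) : bnd (fun=> a).
Proof. by exists `|a| => x _. Qed.

(** No bound on [phi] is assumed. Since the transform takes finite values, the bound C on the cost
    limits the oscillation of [psi]; and [phi <= ct psi] on [Om], so transforming again gives
    [ct (ct psi) <= psi]. *)
Lemma concave_bnd_ct psi (phi : X -> R) :
  (forall y, Om y -> (psi y)%:E = ereal_inf [set (c x y - phi x)%:E | x in Om]) ->
  bnd psi /\ forall y, Om y -> psi y = ct (ct psi) y.
Proof.
move=> hp.
have le x y : Om x -> Om y -> psi y <= c x y - phi x.
  by move=> Ox Oy; rewrite -lee_fin hp//; apply: ereal_inf_lbound; exists x.
have ge y (m : R) : Om y -> (forall x, Om x -> m <= c x y - phi x) -> m <= psi y.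
  move=> Oy hm; rewrite -lee_fin hp//; apply: le_ereal_inf_tmp => _ [x Ox <-].
  by rewrite lee_fin hm.
have [x0 Ox0] := bc_ne H.
have bpsi : bnd psi.
  exists (`|C - phi x0| + `|psi x0 - C|) => y Oy.
  have h1 : psi y <= C - phi x0.
    by have := le _ _ Ox0 Oy; have := bc_le H _ _ Ox0 Oy; lra.
  have h2 : psi x0 - C <= psi y.
    apply: ge => // x Ox; have := le _ _ Ox Ox0; have := bc_le H _ _ Ox Ox0.
    by have := bc_ge0 H x y; lra.
  have := ler_norm (C - phi x0); have := ler_norm (- (psi x0 - C)).
  rewrite normrN => ? ?; have := normr_ge0 (C - phi x0); have := normr_ge0 (psi x0 - C).
  by move=> ? ?; rewrite ler_norml; apply/andP; split; lra.
split => // y Oy; apply/eqP; rewrite eq_le ct_ct_ge//=.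
apply: ge => // x Ox.
have h1 := ct_le _ _ y (ct_bnd _ bpsi) Ox.
have : phi x <= ct psi x; last lra.
apply: ct_ge => z Oz; have := le _ _ Ox Oz; rewrite (bc_sym H z x); lra.
Qed.

End CTransform.

(** * Finite partitions, admissible functions and their means *)

Section CellIntegrals.
Context {d : measure_display} {T : measurableType d} {R : realType}.

Lemma cells_fibres {I : finType} (k : T -> I) :
  (forall i, measurable (k @^-1` [set i])) -> cells k.
Proof.
move=> h S; rewrite (_ : _ @^-1` _ = \bigcup_(i in S) (k @^-1` [set i])).
  by apply: fin_bigcup_measurable; [exact: finite_finset|].
by apply/seteqP; split => [x Sx|x [i Si /= ->]]; [exists (k x)|].
Qed.

Lemma cells_measurable_fun {I : finType} (k : T -> I) (w : I -> R) D :
  measurable D -> cells k -> measurable_fun D (w \o k).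
Proof.
move=> mD ck _ Y mY; apply: measurableI => //.
by rewrite comp_preimage; exact: ck.
Qed.

Lemma integral_cells (m : {measure set T -> \bar R}) {I : finType} (k : T -> I) (w : I -> R) D :
  measurable D -> cells k -> (forall i, 0 <= w i) ->
  (\int[m]_(x in D) (w (k x))%:E = \sum_i (w i)%:E * m (D `&` k @^-1` [set i]))%E.
Proof.
move=> mD ck w0.
have E x : ((w (k x))%:E = \sum_i (w i)%:E * (\1_(k @^-1` [set i]) x)%:E)%E.
  rewrite (bigD1 (k x))//= indicE mem_set// mule1 big1 ?adde0// => i ik.
  rewrite indicE memNset ?mule0//= => e; by rewrite e eqxx in ik.
under eq_integral do rewrite E.
rewrite ge0_integral_sum//; last 2 first.
- move=> i; apply: measurable_funeM; apply/measurable_EFinP.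
  by apply: measurable_indic; exact: ck.
- by move=> i x _; rewrite mule_ge0// lee_fin.
have mk i : measurable (k @^-1` [set i]) by exact: ck.
apply: eq_bigr => i _; rewrite ge0_integralZl_EFin//.
- by rewrite (integral_indic _ mD (mk i)) setIC.
- by apply/measurable_EFinP; apply: measurable_indic; exact: ck.
Qed.

End CellIntegrals.

Definition admissible {d : measure_display} {T : measurableType d} {R : realType}
  (Om : set T) (h : T -> R) : Prop := bnd Om h /\ measurable_fun Om h.

Section Means.
Context {d : measure_display} {T : measurableType d} {R : realType}.
Context {Om : set T} (mO : measurable Om).
Local Notation adm := (admissible Om).
Local Notation bnd := (bnd Om).
Implicit Types (h g : T -> R) (mu : probability T R).

Definition mean (D : set T) mu h : R := Rintegral mu D h.

Lemma adm_integrable mu h : adm h -> mu.-integrable Om (EFin \o h).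
Proof.
move=> [[M hM] mh]; apply: measurable_bounded_integrable => //.
  exact: le_lt_trans (probability_le1 _ mO) (ltry _).
exists M; split; first exact: num_real.
by move=> N MN x Ox; exact: le_trans (hM x Ox) (ltW MN).
Qed.

Lemma mean_EFin mu h : adm h ->
  (\int[mu]_(x in Om) (h x)%:E)%E = (mean Om mu h)%:E.
Proof. by move=> ah; rewrite /mean /Rintegral fineK// integrable_fin_num//; exact: adm_integrable. Qed.

Lemma adm_lin h g (a b : R) : adm h -> adm g -> adm (fun x => a * h x + b * g x).
Proof.
move=> [bh mh] [bg mg]; split; first exact: bnd_lin.
by apply: measurable_funD; apply: measurable_funM.
Qed.

Lemma adm_cst (a : R) : adm (fun=> a).
Proof. by split; [exact: bnd_cst|exact: measurable_cst]. Qed.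

Lemma mean_le mu h g : adm h -> adm g -> (forall x, Om x -> h x <= g x) ->
  mean Om mu h <= mean Om mu g.
Proof. by move=> ah ag hg; apply: le_Rintegral => //; exact: adm_integrable. Qed.

Lemma mean_lin mu h g (a b : R) : adm h -> adm g ->
  mean Om mu (fun x => a * h x + b * g x) = a * mean Om mu h + b * mean Om mu g.
Proof.
move=> ah ag.
have z (k : T -> R) (e : R) : adm k -> adm (fun x => e * k x).
  move=> ak; have := adm_lin _ _ e 0 ak ak; congr adm.
  by apply/funext => x; rewrite mul0r addr0.
rewrite /mean RintegralD//; try (by apply: adm_integrable; exact: z).
by rewrite !RintegralZl//; exact: adm_integrable.
Qed.

Lemma mean_cst mu (a : R) : mu Om = 1%E -> mean Om mu (fun=> a) = a.
Proof.
move=> h; transitivity (a * fine (mu Om)); first exact: Rintegral_cst.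
by rewrite h mulr1.
Qed.

Lemma mean_eq mu h g : (forall x, Om x -> h x = g x) -> mean Om mu h = mean Om mu g.
Proof. by move=> hg; apply: eq_Rintegral => x /set_mem; exact: hg. Qed.

Lemma mean_shift mu h (a : R) : mu Om = 1%E -> adm h ->
  mean Om mu (fun x => h x + a) = mean Om mu h + a.
Proof.
move=> m1 ah; have := mean_lin mu h (fun=> a) 1 1 ah (adm_cst a).
by rewrite !mul1r mean_cst// => <-; apply: mean_eq => x _; rewrite !mul1r.
Qed.

Lemma adm_cells {I : finType} (k : T -> I) (w : I -> R) : cells k -> adm (w \o k).
Proof.
move=> ck; split; last exact: cells_measurable_fun.
exists (\sum_i `|w i|) => x _ /=; rewrite (bigD1 (k x))//= lerDl.
by apply: sumr_ge0.
Qed.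

Lemma mean_cells mu {I : finType} (k : T -> I) (w : I -> R) : mu Om = 1%E -> cells k ->
  mean Om mu (w \o k) = \sum_i w i * fine (mu (Om `&` k @^-1` [set i])).
Proof.
move=> m1 ck.
have mf i : mu (Om `&` k @^-1` [set i]) \is a fin_num.
  by rewrite fin_num_measure//; apply: measurableI => //; exact: ck.
have pos (v : I -> R) : (forall i, 0 <= v i) ->
    mean Om mu (v \o k) = \sum_i v i * fine (mu (Om `&` k @^-1` [set i])).
  move=> v0; apply: EFin_inj; rewrite -mean_EFin ?integral_cells//; last exact: adm_cells.
  rewrite -sumEFin; apply: eq_bigr => i _; rewrite EFinM fineK//.
(* Signed weights are reduced to nonnegative ones by adding [M], whose contribution to both sides is
   the total mass 1 times [M]. *)
pose M := \sum_i `|w i|.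
have wM i : 0 <= w i + M.
  have : `|w i| <= M by rewrite /M (bigD1 i)//= lerDl sumr_ge0.
  by rewrite ler_norml => /andP[? ?]; lra.
have one : \sum_i fine (mu (Om `&` k @^-1` [set i])) = 1.
  have := pos (fun=> 1) (fun=> ler01); under eq_bigr do rewrite mul1r.
  by move=> <-; rewrite mean_cst.
have := pos _ wM.
rewrite -[LHS]/(mean Om mu (fun x => (w \o k) x + M)) mean_shift//; last exact: adm_cells.
under eq_bigr do rewrite mulrDl.
by rewrite big_split/= -mulr_sumr one mulr1 => /addIr.
Qed.

Lemma adm_indic (E : set T) : measurable E -> adm (\1_E : T -> R).
Proof.
move=> mE; split; last exact: measurable_indic.
by exists 1 => z _; rewrite indicE; case: (_ \in _); rewrite ?normr1 ?normr0.
Qed.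

Lemma mean_indic mu (E : set T) : measurable E -> E `<=` Om ->
  mean Om mu (\1_E : T -> R) = fine (mu E).
Proof.
move=> mE EO; rewrite /mean /Rintegral; congr fine.
transitivity (mu (E `&` Om)); first exact: integral_indic.
by congr (mu _); apply/setIidPl.
Qed.

End Means.

(** * The domain as seen by the transport problem, and the dual functional *)

(** Collects the facts on [Om] and the cost on which the duality theory rests. The modulus [dl] is a
    parameter so that equicontinuity can be stated with one and the same function for all
    potentials. *)
Record transport_domain {R : realType} {n : nat} (p C : R) (Om : set (n.-tuple R))
    (dl : R -> R) := {
  td_p : 1 < p;
  td_bc : bounded_cost Om (cost p) C;
  td_m : measurable Om;
  td_dl : forall e, 0 < e -> 0 < dl e;
  td_mod : forall e, 0 < e -> forall x x' y, Om x -> Om x' -> Om y ->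
    near_by (dl e) x x' -> `|cost p x y - cost p x' y| <= e;
  td_cells : forall e : R, 0 < e -> exists (I : finType) (k : n.-tuple R -> I),
    cells k /\ forall x y, Om x -> Om y -> k x = k y -> near_by e x y }.

Arguments td_p {R n p C Om dl}.
Arguments td_bc {R n p C Om dl}.
Arguments td_m {R n p C Om dl}.
Arguments td_dl {R n p C Om dl}.
Arguments td_mod {R n p C Om dl}.
Arguments td_cells {R n p C Om dl}.

Lemma transport_domain_ex {R : realType} {n : nat} (p : R)
  (leb : {measure set (n.-tuple R) -> \bar R}) (Om : set (n.-tuple R)) :
  1 < p -> bounded_domain leb Om -> exists C dl, transport_domain p C Om dl.
Proof.
move=> p1 HOm; have [B [B0 hB]] := domain_boxed _ _ HOm.
have [C C0 hC] := @cost_bound R n p B p1.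
have /choice[dl hdl] : forall e : R, exists d : R, 0 < e -> 0 < d /\
    forall x x' y : n.-tuple R, boxed B x -> boxed B x' -> boxed B y ->
      near_by d x x' -> `|cost p x y - cost p x' y| <= e.
  move=> e; have [e0|e0] := ltP 0 e; last by exists 0.
  by have [d d0 hd] := @cost_unif_cont R n p B e p1 B0 e0; exists d.
exists C, dl; split => //.
- split.
  + by have [U [[x Ux] UO _ _ _]] := domain_core _ _ HOm; exists x; exact: UO.
  + by move=> x y; exact: cost_ge0.
  + by move=> x y Ox Oy; apply: hC; exact: hB.
  + by move=> x y; exact: cost_sym.
- exact: domain_measurable HOm.
- by move=> e /hdl[].
- by move=> e /hdl[_ h] x x' y Ox Ox' Oy; apply: h; exact: hB.
- move=> e e0; have [I [k [ck hk]]] := @grid_cells R n B e e0.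
  by exists I, k; split => // x y Ox Oy; apply: hk; exact: hB.
Qed.

Section DualFunctional.
Context {R : realType} {n : nat} {p C : R} {Om : set (n.-tuple R)} {dl : R -> R}.
Context (H : transport_domain p C Om dl).
Local Notation T := (n.-tuple R).
Local Notation c := (cost p).
Local Notation ct := (ct Om (cost p)).
Local Notation bnd := (bnd Om).
Local Notation adm := (admissible Om).
Implicit Types (h g phi psi : T -> R) (x y : T) (mu nu : probability T R).

Definition equi h : Prop := forall e, 0 < e -> forall x y, Om x -> Om y ->
  near_by (dl e) x y -> `|h x - h y| <= e.

(** A superlevel set {h > r} is, inside [Om], a countable union of finite unions of cells: at stage
    m, the cells on which h > r throughout, which cover {h > r + 1/(m+1)}. *)
Lemma equi_measurable h : equi h -> measurable_fun Om h.
Proof.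
move=> eh; have mO := td_m H.
suff E (r : R) : exists A : nat -> set T, (forall m, measurable (A m)) /\
    Om `&` h @^-1` `]r, +oo[%classic = \bigcup_m (Om `&` A m).
  apply: (measurability _ (RGenOInfty.measurableE R)) => _ [_ [r ->] <-].
  have [B [mB ->]] := E r; apply: bigcupT_measurable => m; exact: measurableI.
have /choice[B hB] : forall m : nat, exists B : set T, measurable B /\
    (forall x, Om x -> B x -> r < h x) /\
    (forall x, Om x -> r + m.+1%:R^-1 < h x -> B x).
  move=> m; have m0 : 0 < m.+1%:R^-1 :> R by rewrite invr_gt0.
  have [I [k [ck hk]]] := td_cells H _ (td_dl H _ m0).
  exists (k @^-1` [set i | forall y, Om y -> k y = i -> r < h y]); split; first exact: ck.
  split=> [x Ox /= /(_ x Ox erefl)//|x Ox rx /= y Oy kyx].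
  have := eh _ m0 _ _ Oy Ox (hk _ _ Oy Ox kyx); rewrite ler_norml => /andP[h1 _].
  by move: h1 rx; set t := m.+1%:R^-1; clear; move=> h1 rx; lra.
exists B; split; first by move=> m; case: (hB m).
apply/seteqP; split => x.
  move=> [Ox] /=; rewrite in_itv/= andbT => rx.
  have rx0 : 0 < h x - r by rewrite subr_gt0.
  exists (Num.truncn (h x - r)^-1) => //; split => //.
  have [_ [_]] := hB (Num.truncn (h x - r)^-1); apply=> //.
  by rewrite -ltrBrDl invf_plt ?posrE//; exact: truncnS_gt.
move=> [m _ [Ox Bx]]; split => //=; rewrite in_itv/= andbT.
by have [_ [+ _]] := hB m; apply.
Qed.

Lemma ct_equi h : bnd h -> equi (ct h).
Proof.
move=> bh e e0; suff E x y : Om x -> Om y -> near_by (dl e) x y -> ct h x - ct h y <= e.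
  move=> x y Ox Oy xy; rewrite ler_norml E// andbT lerNl opprB E//.
  exact: near_by_sym.
move=> Ox Oy xy; rewrite lerBlDl -lerBlDr; apply: (ct_ge (td_bc H)) => z Oz.
have := ct_le (td_bc H) _ _ x bh Oz.
have := td_mod H _ e0 _ _ _ Ox Oy Oz xy; rewrite !(cost_sym _ z) ler_norml => /andP[? ?].
lra.
Qed.

Lemma ct_adm h : bnd h -> adm (ct h).
Proof. by move=> bh; split; [exact: ct_bnd (td_bc H) _ bh|apply: equi_measurable; exact: ct_equi]. Qed.

Definition dual mu nu h : R := mean Om mu h + mean Om nu (ct h).

Lemma kdualE mu nu h : adm h -> kdual p Om mu nu h = (dual mu nu h)%:E.
Proof.
move=> ah; have [bh _] := ah; rewrite /kdual /dual EFinD (mean_EFin (td_m H))//.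
congr (_ + _)%E; rewrite -(mean_EFin (td_m H)); last exact: ct_adm.
by apply: eq_integral => y _; rewrite -(ct_EFin (td_bc H)).
Qed.

Lemma c_concave_ct h : bnd h -> c_concave p Om (ct h).
Proof. by move=> bh; exists h => y Oy; rewrite -(ct_EFin (td_bc H)). Qed.

Lemma c_concave_bnd psi : c_concave p Om psi ->
  bnd psi /\ forall y, Om y -> psi y = ct (ct psi) y.
Proof. by move=> [phi hphi]; exact: (concave_bnd_ct (td_bc H) psi phi). Qed.

Lemma equi_eq h g : (forall x, Om x -> h x = g x) -> equi h -> equi g.
Proof. by move=> hg eh e e0 x y Ox Oy xy; rewrite -!hg//; exact: eh. Qed.

Lemma c_concave_equi psi : c_concave p Om psi -> equi psi.
Proof.
move=> /c_concave_bnd[bp pE]; apply: (@equi_eq (ct (ct psi))).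
  by move=> x Ox; rewrite -pE.
by apply: ct_equi; exact: ct_bnd (td_bc H) _ bp.
Qed.

Lemma c_concave_adm psi : c_concave p Om psi -> adm psi.
Proof.
move=> cp; split; first by have [] := c_concave_bnd _ cp.
by apply: equi_measurable; exact: c_concave_equi.
Qed.

(** The double transform raises the first term and leaves the second unchanged, because a triple
    transform is a single one. *)
Lemma dual_le_ct mu nu h : adm h -> dual mu nu h <= dual mu nu (ct (ct h)).
Proof.
move=> ah; have [bh _] := ah; have bc := ct_bnd (td_bc H) _ bh.
rewrite /dual lerD//.
  apply: (mean_le (td_m H)) => //; first exact: ct_adm.
  by move=> x Ox; exact: (ct_ct_ge (td_bc H)).
rewrite (mean_eq nu (ct (ct (ct h))) (ct h))// => x Ox; exact: (ct_ct_ct (td_bc H)).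
Qed.

(** Extends maximality from c-concave competitors to all bounded measurable ones, such as midpoints
    and truncated perturbations of [psi]. *)
Lemma potential_max mu nu psi h : kantorovich_potential p Om mu nu psi -> adm h ->
  dual mu nu h <= dual mu nu psi.
Proof.
move=> [cp maxp] ah; apply: (le_trans (dual_le_ct _ _ _ ah)).
have [bh _] := ah; have bc := ct_bnd (td_bc H) _ bh.
have := maxp _ (c_concave_ct _ bc).
by rewrite !kdualE ?lee_fin//; [exact: c_concave_adm|exact: ct_adm].
Qed.

Lemma measurable_cost : measurable_fun setT (fun z : T * T => c z.1 z.2).
Proof.
rewrite (_ : (fun z : T * T => _) = (@powR R ^~ (p / 2)) \o (fun z : T * T => sqd z.1 z.2)).
  apply: measurableT_comp; first exact: measurable_powR.
  apply: measurable_sum => i; apply: measurable_funX; apply: measurable_funB.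
  - by apply: (measurableT_comp (measurable_tnth i)); exact: measurable_fst.
  - by apply: (measurableT_comp (measurable_tnth i)); exact: measurable_snd.
by apply/funext => z /=; rewrite costE.
Qed.

(** Change of variables along a projection [f]. A constant is added to make the integrand
    nonnegative, and the part of the preimage of [Om] outside [Om * Om] is negligible for the
    plan. *)
Lemma plan_mean (g : probability (T * T)%type R) mu (f : T * T -> T) h :
  measurable_fun setT f -> (forall A, measurable A -> g (f @^-1` A) = mu A) ->
  g (Om `*` Om) = 1%E -> (forall z, (Om `*` Om) z -> Om (f z)) ->
  adm h -> mu Om = 1%E ->
  mean Om mu h = mean (Om `*` Om) g (h \o f).
Proof.
move=> mf gf g1 fO ah m1; have mO := td_m H.
have mOO : measurable (Om `*` Om) by exact: measurableX.
have ahf : admissible (Om `*` Om) (h \o f).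
  have [[M hM] mh] := ah; split; first by exists M => z /fO/hM.
  apply: (measurable_comp mO _ mh) => [_ [z /fO Oz <-]//|]; exact: measurable_funTS.
have gfO : g (f @^-1` Om) = 1%E by rewrite gf.
have [[M hM] mh] := ah.
pose hM' x := h x + M.
have pos x : Om x -> 0 <= hM' x by move=> /hM; rewrite ler_norml /hM' => /andP[? ?]; lra.
have ahM : adm hM'.
  have := adm_lin h (fun=> M) 1 1 ah (adm_cst M); congr adm.
  by apply/funext => x; rewrite !mul1r.
apply: (addIr M); rewrite -(mean_shift mO)// -(mean_shift mOO)//.
apply: EFin_inj; rewrite -(mean_EFin mO)//.
rewrite -(mean_EFin mOO); last first.
  have := adm_lin (Om := Om `*` Om) _ (fun=> M) 1 1 ahf (adm_cst M); congr admissible.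
  by apply/funext => x; rewrite !mul1r.
rewrite -(@eq_measure_integral _ _ _ _ mu (pushforward g f)); last first.
  by move=> A mA _; exact: gf.
have mhM : measurable_fun Om (EFin \o hM') by apply/measurable_EFinP; case: ahM.
rewrite ge0_integral_pushforward//; last first.
  by move=> y /set_mem Oy; rewrite lee_fin pos.
have mfO : measurable (f @^-1` Om) by rewrite -[_ @^-1` _]setTI; exact: mf.
have sub : Om `*` Om `<=` f @^-1` Om by move=> z /fO.
have N0 : g (f @^-1` Om `\` Om `*` Om) = 0%E.
  apply/eqP; rewrite eq_le measure_ge0 andbT.
  have <- : g (~` (Om `*` Om)) = 0%E by rewrite probability_setC// g1 subee.
  apply: le_measure; rewrite ?inE; [exact: measurableD|exact: measurableC|].
  by move=> z [].
rewrite (ge0_negligible_integral _ mfO _ _ N0).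
- by rewrite setDD (setIidr sub).
- exact: measurableD.
- apply: (measurable_comp mO _ mhM); last exact: measurable_funTS.
  by move=> _ [z Oz <-].
- by move=> z Oz; rewrite lee_fin pos.
Qed.

End DualFunctional.

(** * Weak and strong duality on the domain *)

Lemma sum_sub_support {R : realType} (K : finType) (A : {pred K}) (F : K -> R) :
  (forall i, i \notin A -> F i = 0) ->
  \sum_i F i = \sum_(x : {i | i \in A}) F (val x).
Proof.
move=> h; rewrite -(big_sub A F) [RHS]big_mkcond/=; apply: eq_bigr => i _.
by case: ifPn => // /h.
Qed.

Lemma ler_sum_norm {R : realType} (K : finType) (F : K -> R) (i : K) :
  `|F i| <= \sum_k `|F k|.
Proof. by rewrite (bigD1 i)//= lerDl sumr_ge0. Qed.

(* Indices of zero mass receive potentials negative enough to satisfy the constraints. *)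
Lemma finite_transport_duality_ge0 {R : realType} {I J : finType}
    (a : I -> R) (b : J -> R) (c : I -> J -> R) (e : R) : 0 < e ->
  (forall i, 0 <= a i) -> (forall j, 0 <= b j) ->
  \sum_i a i = 1 -> \sum_j b j = 1 ->
  exists P phi chi, [/\ coupling a b P, forall i j, phi i + chi j <= c i j &
    \sum_i \sum_j c i j * P i j <= \sum_i phi i * a i + \sum_j chi j * b j + e].
Proof.
move=> e0 a0 b0 a1 b1.
pose A := [pred i | 0 < a i]; pose B := [pred j | 0 < b j].
pose I' := {i | i \in A}; pose J' := {j | j \in B}.
have aN i : i \notin A -> a i = 0.
  by rewrite inE -leNgt => h; apply/eqP; rewrite eq_le h a0.
have bN j : j \notin B -> b j = 0.
  by rewrite inE -leNgt => h; apply/eqP; rewrite eq_le h b0.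
have [||||P' [f' [g' [[P0 Pa Pb] fg opt]]]] := @finite_transport_duality R I' J'
    (fun x => a (val x)) (fun y => b (val y)) (fun x y => c (val x) (val y)) e e0.
- by move=> x; exact: (valP x).
- by move=> x; exact: (valP x).
- by rewrite -sum_sub_support.
- by rewrite -sum_sub_support.
pose P i j := if (insub i : option I', insub j : option J') is (Some x, Some y)
  then P' x y else 0.
pose M := \sum_i \sum_j `|c i j|.
have cM i j : - M <= c i j.
  have h1 := ler_sum_norm J (c i) j.
  have h2 : \sum_j `|c i j| <= M.
    by rewrite /M (bigD1 i)//= lerDl sumr_ge0// => k _; rewrite sumr_ge0.
  by have := ler_norm (- c i j); rewrite normrN => h3; lra.
pose chi j := if (insub j : option J') is Some y then g' y else - (M + \sum_x `|f' x|).
(* Defined after [chi], since its default value must compensate every value of [chi], the default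
   one included. *)
pose phi i := if (insub i : option I') is Some x then f' x else - (M + \sum_j `|chi j|).
have PE x y : P (val x) (val y) = P' x y by rewrite /P !valK.
have P0l i j : i \notin A -> P i j = 0 by move=> iA; rewrite /P insubN.
have P0r i j : j \notin B -> P i j = 0.
  by move=> jB; rewrite /P; case: insub => // x; rewrite insubN.
have phiE x : phi (val x) = f' x by rewrite /phi valK.
have chiE y : chi (val y) = g' y by rewrite /chi valK.
exists P, phi, chi; split.
- split.
  + by move=> i j; rewrite /P; case: insub => // x; case: insub.
  + move=> i; have [iA|iA] := boolP (i \in A); last first.
      by rewrite big1 ?aN// => j _; rewrite P0l.
    rewrite (sum_sub_support _ B); last by move=> j /P0r.
    rewrite -[i]/(val (exist _ i iA : I')) -Pa.
    by apply: eq_bigr => y _; rewrite PE.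
  + move=> j; have [jB|jB] := boolP (j \in B); last first.
      by rewrite big1 ?bN// => i _; rewrite P0r.
    rewrite (sum_sub_support _ A); last by move=> i /P0l.
    rewrite -[j]/(val (exist _ j jB : J')) -Pb.
    by apply: eq_bigr => x _; rewrite PE.
- move=> i j; have [iA|iA] := boolP (i \in A); last first.
    have -> : phi i = - (M + \sum_j `|chi j|) by rewrite /phi insubN.
    have := ler_sum_norm J chi j; have := cM i j; have := ler_norm (chi j); lra.
  pose x : I' := exist _ i iA; have -> : phi i = f' x by rewrite -phiE.
  have [jB|jB] := boolP (j \in B).
    pose y : J' := exist _ j jB; have -> : chi j = g' y by rewrite -chiE.
    exact: fg.
  have -> : chi j = - (M + \sum_x `|f' x|) by rewrite /chi insubN.
  have := ler_sum_norm I' f' x; have := cM i j; have := ler_norm (f' x); lra.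
- rewrite (sum_sub_support _ A); last first.
    by move=> i iA; rewrite big1// => j _; rewrite P0l ?mulr0.
  rewrite [X in _ <= X + _ + _](sum_sub_support _ A); last first.
    by move=> i /aN ->; rewrite mulr0.
  rewrite [X in _ <= _ + X + _](sum_sub_support _ B); last first.
    by move=> i /bN ->; rewrite mulr0.
  under [X in _ <= X + _ + _]eq_bigr do rewrite phiE.
  under [X in _ <= _ + X + _]eq_bigr do rewrite chiE.
  apply: le_trans opt; apply: ler_sum => x _.
  rewrite (sum_sub_support _ B); last by move=> j jB; rewrite P0r ?mulr0.
  by apply: ler_sum => y _; rewrite PE.
Qed.

Section DensityMeasure.
Context {d : measure_display} {T : measurableType d} {R : realType}.
Context (m : {measure set T -> \bar R}) (f : T -> \bar R).
Context (mf : measurable_fun setT f) (f0 : forall x, (0 <= f x)%E).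
Context (f1 : (\int[m]_x f x = 1)%E).

(** The proofs are arguments so that the measure structures declared below can be inferred from the
    term alone. *)
Definition density_measure (_ : measurable_fun setT f) (_ : forall x, (0 <= f x)%E)
  (_ : (\int[m]_x f x = 1)%E) (A : set T) : \bar R := (\int[m]_(x in A) f x)%E.

Local Notation g := (density_measure mf f0 f1).

Let g0 : g set0 = 0%E. Proof. by rewrite /density_measure integral_set0. Qed.
Let gge0 A : (0 <= g A)%E. Proof. exact: integral_ge0. Qed.
Let gsa : semi_sigma_additive g. Proof. exact: semi_sigma_additive_nng_induced. Qed.

HB.instance Definition _ := isMeasure.Build _ _ _ g g0 gge0 gsa.

Let gT : g setT = 1%E. Proof. exact: f1. Qed.

HB.instance Definition _ := @Measure_isProbability.Build _ _ _ g gT.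

Lemma density_probability : exists P : probability T R,
  forall A, P A = (\int[m]_(x in A) f x)%E.
Proof. by exists g. Qed.

End DensityMeasure.

Section ProbabilityFacts.
Context {d : measure_display} {T : measurableType d} {R : realType}.

Lemma prob_full_setI (P : probability T R) (A B : set T) : measurable A -> measurable B ->
  P A = 1%E -> P (A `&` B) = P B.
Proof.
move=> mA mB PA.
have CA : P (~` A) = 0%E by rewrite probability_setC// PA subee.
apply/eqP; rewrite eq_le; apply/andP; split.
  by apply: le_measure; rewrite ?inE//; exact: measurableI.
have {1}-> : B = (A `&` B) `|` (~` A `&` B) by rewrite -setIUl setUv setTI.
apply: (@le_trans _ _ (P (A `&` B) + P (~` A `&` B)))%E.
  by apply: measureU2; apply: measurableI => //; exact: measurableC.
rewrite -[leRHS]adde0 leeD2l// -CA; apply: le_measure; rewrite ?inE.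
- by apply: measurableI => //; exact: measurableC.
- exact: measurableC.
- exact: subIsetl.
Qed.

Lemma measure_cells (m : {measure set T -> \bar R}) {I : finType} (k : T -> I) (A : set T) :
  measurable A -> cells k -> (\sum_i m (A `&` k @^-1` [set i]) = m A)%E.
Proof.
move=> mA ck; have := integral_cells m k (fun=> 1) A mA ck (fun=> ler01).
rewrite integral_cst// mul1e => ->.
by apply: eq_bigr => i _; rewrite mul1e.
Qed.

End ProbabilityFacts.

Section Duality.
Context {R : realType} {n : nat} {p C : R} {Om : set (n.-tuple R)} {dl : R -> R}.
Context (H : transport_domain p C Om dl).
Local Notation T := (n.-tuple R).
Local Notation c := (cost p).
Local Notation ct := (ct Om (cost p)).
Local Notation dual := (@dual R n p Om).
Implicit Types (mu nu : probability T R).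

Lemma weak_duality mu nu h : in_P Om mu -> in_P Om nu -> admissible Om h ->
  ((dual mu nu h)%:E <= Tp p Om mu nu)%E.
Proof.
move=> m1 n1 ah; have mO := td_m H; have [bh _] := ah.
have ach := ct_adm H _ bh.
have mOO : measurable (Om `*` Om) by exact: measurableX.
apply: le_ereal_inf_tmp => _ [g [g1 marg] <-].
have marg1 A : measurable A -> g (fst @^-1` A) = mu A.
  move=> mA; have [<- _] := marg A mA; congr (g _).
  by apply/seteqP; split => [z Az|z []].
have marg2 A : measurable A -> g (snd @^-1` A) = nu A.
  move=> mA; have [_ <-] := marg A mA; congr (g _).
  by apply/seteqP; split => [z Az|z []].
rewrite /dual.
rewrite (plan_mean H g mu fst h measurable_fst marg1 g1 _ ah m1); last by move=> z [].
rewrite (plan_mean H g nu snd _ measurable_snd marg2 g1 _ ach n1); last by move=> z [].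
have a1 : admissible (Om `*` Om) (h \o fst).
  have [[M hM] mh] := ah; split; first by exists M => z [/hM].
  apply: (measurable_comp mO _ mh) => [_ [z [Oz _] <-]//|].
  by apply: measurable_funTS; exact: measurable_fst.
have a2 : admissible (Om `*` Om) (ct h \o snd).
  have [[M hM] mh] := ach; split; first by exists M => z [_ /hM].
  apply: (measurable_comp mO _ mh) => [_ [z [_ Oz] <-]//|].
  by apply: measurable_funTS; exact: measurable_snd.
have mc : measurable_fun setT (fun z : T * T => (c z.1 z.2)%:E).
  by apply/measurable_EFinP; exact: measurable_cost.
have ac : admissible (Om `*` Om) (fun z : T * T => c z.1 z.2).
  split; last by apply: measurable_funTS; exact: measurable_cost.
  exists C => z [Oz1 Oz2]; rewrite ger0_norm ?cost_ge0//; exact: (bc_le (td_bc H)).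
apply: (@le_trans _ _ (\int[g]_(z in Om `*` Om) (c z.1 z.2)%:E)%E); last first.
  apply: ge0_subset_integral => //.
  by move=> z _; rewrite lee_fin cost_ge0.
rewrite (mean_EFin mOO)// lee_fin.
have := mean_lin mOO g _ _ 1 1 a1 a2; rewrite !mul1r => <-.
apply: (mean_le mOO) => //; first exact: adm_lin.
move=> z [Oz1 Oz2] /=; rewrite !mul1r.
have := ct_le (td_bc H) _ _ z.2 bh Oz1; lra.
Qed.

Lemma Tp_ge0 mu nu : (0 <= Tp p Om mu nu)%E.
Proof.
apply: le_ereal_inf_tmp => _ [g _ <-]; apply: integral_ge0 => z _.
by rewrite lee_fin cost_ge0.
Qed.

(** A discrete coupling becomes a plan with density [P i j / (a i * b j)] with respect to the
    product measure, constant on products of cells. Where a cell has zero mass the quotient is 0,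
    consistently with [P i j = 0]. *)
Lemma cell_plan mu nu (I : finType) (k : T -> I) (P : I -> I -> R) :
  in_P Om mu -> in_P Om nu -> cells k ->
  coupling (fun i => fine (mu (k @^-1` [set i]))) (fun j => fine (nu (k @^-1` [set j]))) P ->
  exists2 g, transport_plan Om mu nu g &
    forall i j, g ((Om `&` k @^-1` [set i]) `*` (Om `&` k @^-1` [set j])) = (P i j)%:E.
Proof.
move=> m1 n1 ck [P0 Pa Pb]; have mO := td_m H.
have mk i : measurable (k @^-1` [set i]) by exact: ck.
pose a i := fine (mu (k @^-1` [set i])); pose b j := fine (nu (k @^-1` [set j])).
have {}Pa i : \sum_j P i j = a i by exact: Pa.
have {}Pb j : \sum_i P i j = b j by exact: Pb.
have aE i : mu (k @^-1` [set i]) = (a i)%:E by rewrite fineK// fin_num_measure.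
have bE i : nu (k @^-1` [set i]) = (b i)%:E by rewrite fineK// fin_num_measure.
have a0 i : 0 <= a i by rewrite fine_ge0.
have b0 i : 0 <= b i by rewrite fine_ge0.
have Pa0 i j : a i = 0 -> P i j = 0.
  move=> ai; apply/eqP; rewrite eq_le P0 andbT -ai -Pa (bigD1 j)//= lerDl sumr_ge0//.
have Pb0 i j : b j = 0 -> P i j = 0.
  move=> bj; apply/eqP; rewrite eq_le P0 andbT -bj -Pb (bigD1 i)//= lerDl sumr_ge0//.
pose w (ij : I * I) := P ij.1 ij.2 / a ij.1 / b ij.2.
have w0 ij : 0 <= w ij by rewrite !divr_ge0.
pose K (z : T * T) := (k z.1, k z.2).
have KE i j (A B : set T) :
    (A `*` B) `&` K @^-1` [set (i, j)] = (A `&` k @^-1` [set i]) `*` (B `&` k @^-1` [set j]).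
  apply/seteqP; split => z /=.
    by move=> [[Az Bz] [k1 k2]].
  by move=> [[Az k1] [Bz k2]]; split => //; rewrite /K k1 k2.
have cK : cells K.
  apply: cells_fibres => -[i j].
  have -> : K @^-1` [set (i, j)] = k @^-1` [set i] `*` k @^-1` [set j].
    by rewrite -[LHS]setTI -setXTT KE !setTI.
  exact: measurableX.
pose f z := (w (K z))%:E.
have mf : measurable_fun setT f.
  by apply/measurable_EFinP; exact: cells_measurable_fun.
have f0 z : (0 <= f z)%E by rewrite lee_fin.
have fX (A B : set T) : measurable A -> measurable B ->
    (\int[mu \x nu]_(z in A `*` B) f z =
    (\sum_i \sum_j w (i, j) * (fine (mu (A `&` k @^-1` [set i])) *
       fine (nu (B `&` k @^-1` [set j]))))%:E)%E.
  move=> mA mB; rewrite /f integral_cells//; last exact: measurableX.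
  rewrite pair_big/= -sumEFin; apply: eq_bigr => -[i j] _ /=.
  have mAi : measurable (A `&` k @^-1` [set i]) by exact: measurableI.
  have mBj : measurable (B `&` k @^-1` [set j]) by exact: measurableI.
  have -> : ((mu \x nu) ((A `*` B) `&` K @^-1` [set (i, j)]) =
     mu (A `&` k @^-1` [set i]) * nu (B `&` k @^-1` [set j]))%E.
    by rewrite KE; exact: product_measure1E.
  by rewrite !EFinM !fineK// fin_num_measure.
have sumR (m : probability T R) (A : set T) : measurable A ->
    (\sum_i fine (m (A `&` k @^-1` [set i])))%:E = m A.
  move=> mA; rewrite -(measure_cells m k A mA ck) -sumEFin; apply: eq_bigr => i _.
  by rewrite fineK// fin_num_measure//; exact: measurableI.
have fle (m : probability T R) (A : set T) i : measurable A ->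
    0 <= fine (m (A `&` k @^-1` [set i])) <= fine (m (k @^-1` [set i])).
  move=> mA; have mAi : measurable (A `&` k @^-1` [set i]) by exact: measurableI.
  rewrite fine_ge0//= fine_le ?fin_num_measure//.
  by apply: le_measure; rewrite ?inE.
have f1A (A : set T) : measurable A -> (\int[mu \x nu]_(z in A `*` setT) f z = mu A)%E.
  move=> mA; rewrite fX// -sumR//; congr EFin; apply: eq_bigr => i _.
  have /andP[al0 alle] := fle mu A i mA; rewrite -/(a i) in alle.
  set al := fine (mu _) in al0 alle *.
  transitivity (\sum_j P i j * (al / a i)).
    apply: eq_bigr => j _; rewrite setTI -/(b j) /w /=.
    have [bj|bj] := eqVneq (b j) 0; first by rewrite Pb0// !mul0r.
    by move: (a i)^-1 => ai; field.
  rewrite -mulr_suml Pa; have [ai|ai] := eqVneq (a i) 0.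
    by rewrite ai mul0r; apply/eqP; rewrite eq_le al0 /= -[leRHS]ai.
  by rewrite mulrC divfK.
have f1B (A : set T) : measurable A -> (\int[mu \x nu]_(z in setT `*` A) f z = nu A)%E.
  move=> mA; rewrite fX// -sumR//; congr EFin; rewrite exchange_big; apply: eq_bigr => j _.
  have /andP[al0 alle] := fle nu A j mA; rewrite -/(b j) in alle.
  set al := fine (nu _) in al0 alle *.
  transitivity (\sum_i P i j * (al / b j)).
    apply: eq_bigr => i _; rewrite setTI -/(a i) /w /=.
    have [ai|ai] := eqVneq (a i) 0; first by rewrite Pa0// !mul0r.
    by move: (b j)^-1 => bj; field.
  rewrite -mulr_suml Pb; have [ai|ai] := eqVneq (b j) 0.
    by rewrite ai mul0r; apply/eqP; rewrite eq_le al0 /= -[leRHS]ai.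
  by rewrite mulrC divfK.
have fT : (\int[mu \x nu]_z f z = 1)%E by rewrite -setXTT f1A// probability_setT.
have [g gE] := density_probability (mu \x nu)%E f mf f0 fT.
have inOm (m : probability T R) i : in_P Om m -> m (Om `&` k @^-1` [set i]) = m (k @^-1` [set i]).
  by move=> mO1; exact: prob_full_setI.
exists g; first split.
- rewrite gE fX//.
  under eq_bigr do under eq_bigr do rewrite !inOm//.
  have <- : mu setT = 1%E by exact: probability_setT.
  rewrite -(f1A setT)// fX//.
  by under [in RHS]eq_bigr do under eq_bigr do rewrite !setTI.
- by move=> A mA; rewrite !gE f1A// f1B.
move=> i j; rewrite gE.
rewrite (eq_integral (fun=> (w (i, j))%:E)); last first.
  by move=> z /set_mem[[_ k1] [_ k2]]; rewrite /f /K k1 k2.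
have mi : measurable (Om `&` k @^-1` [set i]) by exact: measurableI.
have mj : measurable (Om `&` k @^-1` [set j]) by exact: measurableI.
transitivity ((w (i, j))%:E * (mu (Om `&` k @^-1` [set i]) * nu (Om `&` k @^-1` [set j])))%E.
  rewrite -(product_measure1E mu nu mi mj); apply: integral_cst; exact: measurableX.
rewrite !inOm// aE bE.
rewrite -EFinM /w /=; congr EFin.
have [ai|ai] := eqVneq (a i) 0; first by rewrite Pa0// !mul0r.
have [bj|bj] := eqVneq (b j) 0; first by rewrite Pb0// !mul0r.
by field; apply/andP.
Qed.

(** The cost is sampled at one point per cell and the finite problem is solved nearly optimally. Its
    coupling is glued into a plan; its second potential, constant on cells, is replaced by its
    c-transform, which is c-concave and loses little. *)
Lemma strong_duality mu nu (e : R) : in_P Om mu -> in_P Om nu -> 0 < e ->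
  exists2 phi, c_concave p Om phi & (Tp p Om mu nu <= (dual mu nu phi + e)%:E)%E.
Proof.
move=> m1 n1 e0; have mO := td_m H; have BC := td_bc H.
have mOO : measurable (Om `*` Om) by exact: measurableX.
(* Five errors: two for sampling the cost in the primal value, one for the finite program, two for
   sampling the cost in the dual value. *)
pose t := e / 5; have t0 : 0 < t by rewrite divr_gt0.
have [I [k [ck hk]]] := td_cells H _ (td_dl H _ t0).
have mk i : measurable (k @^-1` [set i]) by exact: ck.
have [x0 Ox0] := bc_ne BC.
(* Representatives lie in their cell when it meets [Om]; otherwise an arbitrary point of [Om] is
   taken. *)
have /choice[r hr] : forall i, exists x, Om x /\ forall y, Om y -> k y = i -> k x = i.
  move=> i; have [[x [Ox kx]]|h] := pselect (exists x, Om x /\ k x = i); first by exists x.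
  by exists x0; split => // y Oy ky; exfalso; apply: h; exists y.
pose cc i j := c (r i) (r j).
have Or i : Om (r i) by case: (hr i).
have kr x : Om x -> near_by (dl t) x (r (k x)).
  move=> Ox; apply: hk => //; have [_ /(_ x Ox erefl) //] := hr (k x).
have ccP x y : Om x -> Om y -> `|c x y - cc (k x) (k y)| <= 2 * t.
  move=> Ox Oy; rewrite -(subrKA (c (r (k x)) y)).
  apply: le_trans (ler_normD _ _) _; rewrite [leRHS]mulrDl mul1r lerD//.
    by apply: (td_mod H _ t0) => //; exact: kr.
  rewrite /cc (cost_sym _ _ y) (cost_sym _ _ (r (k y))).
  by apply: (td_mod H _ t0) => //; exact: kr.
have one (m : probability T R) : \sum_i fine (m (k @^-1` [set i])) = 1.
  apply: EFin_inj; rewrite -sumEFin -(@probability_setT _ _ _ m).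
  rewrite -(measure_cells m k setT measurableT ck).
  by apply: eq_bigr => i _; rewrite setTI fineK// fin_num_measure.
have [||||P [phi [chi [Pc pc opt]]]] := finite_transport_duality_ge0
   (fun i => fine (mu (k @^-1` [set i]))) (fun j => fine (nu (k @^-1` [set j]))) cc t t0.
- by move=> i; rewrite fine_ge0.
- by move=> i; rewrite fine_ge0.
- exact: one.
- exact: one.
have [g gp gE] := cell_plan mu nu I k P m1 n1 ck Pc.
have mc : measurable_fun setT (fun z : T * T => (c z.1 z.2)%:E).
  by apply/measurable_EFinP; exact: measurable_cost.
pose S := \sum_i \sum_j cc i j * P i j.
have P1 : \sum_i \sum_j P i j = 1.
  by have [_ Pa _] := Pc; under eq_bigr do rewrite Pa; exact: one.
have prim : (Tp p Om mu nu <= (S + 2 * t)%:E)%E.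
  apply: (@le_trans _ _ (\int[g]_z (c z.1 z.2)%:E)%E).
    by apply: ereal_inf_lbound; exists g.
  have g1 : g (~` (Om `*` Om)) = 0%E.
    by rewrite probability_setC// gp.1 subee.
  rewrite (ge0_negligible_integral _ measurableT _ _ g1)//; last 2 first.
  - exact: measurableC.
  - by move=> z _; rewrite lee_fin cost_ge0.
  rewrite setTD setCK.
  pose K (z : T * T) := (k z.1, k z.2).
  have KE i j : (Om `*` Om) `&` K @^-1` [set (i, j)] =
      (Om `&` k @^-1` [set i]) `*` (Om `&` k @^-1` [set j]).
    apply/seteqP; split => z /=.
      by move=> [[Az Bz] [k1 k2]].
    by move=> [[Az k1] [Bz k2]]; split => //; rewrite /K k1 k2.
  have cK : cells K.
    apply: cells_fibres => -[i j].
    have -> : K @^-1` [set (i, j)] = k @^-1` [set i] `*` k @^-1` [set j].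
      by apply/seteqP; split => z /=; [move=> [-> ->]|move=> [k1 k2]; rewrite /K k1 k2].
    exact: measurableX.
  pose s (ij : I * I) := cc ij.1 ij.2 + 2 * t.
  apply: (@le_trans _ _ (\int[g]_(z in Om `*` Om) (s (K z))%:E)%E).
    apply: ge0_le_integral => //.
    + by move=> z _; rewrite lee_fin cost_ge0.
    + exact: measurable_funTS.
    + by apply/measurable_EFinP; exact: cells_measurable_fun.
    + move=> z [Oz1 Oz2]; rewrite lee_fin /s /=.
      have := ccP _ _ Oz1 Oz2; rewrite ler_norml => /andP[_ h].
      by rewrite -lerBlDl.
  rewrite integral_cells//; last first.
    by move=> ij; rewrite addr_ge0 ?cost_ge0// mulr_ge0// ltW.
  rewrite (eq_bigr (fun ij => (s ij * P ij.1 ij.2)%:E)); last first.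
    by move=> [i j] _; rewrite KE EFinM; congr (_ * _)%E; exact: gE.
  rewrite sumEFin lee_fin -(pair_big xpredT xpredT (fun i j => s (i, j) * P i j))/=.
  under eq_bigr do under eq_bigr do rewrite /s mulrDl.
  under eq_bigr do rewrite big_split/= -mulr_sumr.
  by rewrite big_split/= -mulr_sumr P1 mulr1.
pose chis := chi \o k.
have achi : admissible Om chis by exact: adm_cells.
have bchi : bnd Om chis by case: achi.
have bf := ct_bnd BC _ bchi.
exists (ct chis); first exact: (c_concave_ct H).
apply: (le_trans prim); rewrite lee_fin.
have d1 : \sum_i phi i * fine (mu (k @^-1` [set i])) - 2 * t <= mean Om mu (ct chis).
  have -> : \sum_i phi i * fine (mu (k @^-1` [set i])) = mean Om mu (phi \o k).
    rewrite (mean_cells mO)//; apply: eq_bigr => i _.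
    by rewrite prob_full_setI.
  rewrite -(mean_shift mO)//; last exact: adm_cells.
  apply: (mean_le mO).
  - have := adm_lin _ _ 1 1 (adm_cells mO k phi ck) (adm_cst (Om := Om) (- (2 * t))).
    by congr admissible; apply/funext => x; rewrite !mul1r.
  - exact: (ct_adm H).
  move=> x Ox; apply: (ct_ge BC) => y Oy; rewrite cost_sym.
  have := ccP _ _ Ox Oy; rewrite ler_norml => /andP[h _].
  by have := pc (k x) (k y); rewrite /chis /=; move: h; clear; lra.
have d2 : \sum_i chi i * fine (nu (k @^-1` [set i])) <= mean Om nu (ct (ct chis)).
  have -> : \sum_i chi i * fine (nu (k @^-1` [set i])) = mean Om nu (chi \o k).
    rewrite (mean_cells mO)//; apply: eq_bigr => i _.
    by rewrite prob_full_setI.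
  apply: (mean_le mO) => //; first exact: (ct_adm H).
  by move=> y Oy; exact: (ct_ct_ge BC).
have te : e = 5 * t by rewrite /t mulrC divfK.
rewrite /dual te; move: d1 d2 opt; rewrite -/S; clear; lra.
Qed.

End Duality.

(** * Stability of nearly optimal potentials *)

Lemma measurable_near_by {R : realType} {n : nat} (d : R) (y : n.-tuple R) :
  measurable [set z | near_by d y z].
Proof.
rewrite (_ : [set z | _] = \bigcap_(i in [set: 'I_n])
   [set z : n.-tuple R | `[tnth y i - d, tnth y i + d]%classic (tnth z i)]).
  apply: fin_bigcap_measurable; first exact: finite_finset.
  by move=> i _; exact: measurable_tnth_preimage.
by apply/seteqP; split => z /= h i; [move=> _ /=; have := h i|have := h i Logic.I];
  rewrite /= in_itv/= ler_distlC.
Qed.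

(** One step of summation by parts: the leftover increment P - Q is replaced by the next one, P' -
    P, at the price t of a second difference. *)
Lemma telescope_step {R : realType} {D D' D'' A P P' Q S m m' t s : R} :
  D' - D <= A - (P - Q) + m * t + m' * s -> D'' - D' <= (P' - P) - S + s ->
  (P' - P) - (P - Q) <= t -> D'' - D <= A - S + (m + 1) * t + (m' + 1) * s.
Proof. by lra. Qed.

Definition segment_point {R : realType} {n : nat} (a b : n.-tuple R) (N j : nat) : n.-tuple R :=
  [tuple tnth a i + j%:R / N.+1%:R * (tnth b i - tnth a i) | i < n].

Section Stability.
Context {R : realType} {n : nat} {p C B : R} {Om U : set (n.-tuple R)} {dl : R -> R}.
Context (H : transport_domain p C Om dl).
Local Notation T := (n.-tuple R).
Local Notation c := (cost p).
Local Notation ct := (ct Om (cost p)).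
Context (mu nu : probability T R).
Context (psi : T -> R) (Hpsi : kantorovich_potential p Om mu nu psi).
Context (B0 : 0 <= B) (OB : forall x, Om x -> boxed B x).
Context (UOm : U `<=` Om).
Context (Uopen : forall y, U y -> exists2 d : R, 0 < d & near_by d y `<=` U).
Context (Unu : forall y, U y -> forall d : R, 0 < d ->
  (0 < nu (Om `&` [set z | near_by d y z]))%E).
Implicit Types (phi : T -> R) (x y z : T).

Definition near_optimal (d : R) phi : Prop := c_concave p Om phi /\
  dual (p := p) (Om := Om) mu nu psi - dual (p := p) (Om := Om) mu nu phi <= d.

Lemma near_optimal_le (d e : R) phi : d <= e -> near_optimal d phi -> near_optimal e phi.
Proof. by move=> de [cp h]; split => //; exact: le_trans de. Qed.

Let mid phi x := 2^-1 * phi x + 2^-1 * psi x.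
(** The concavity defect of the transform at the midpoint of [phi] and [psi]. *)
Let gap phi y := ct (mid phi) y - (2^-1 * ct phi y + 2^-1 * ct psi y).

Let psi_adm : admissible Om psi.
Proof. by have [cp _] := Hpsi; exact: (c_concave_adm H). Qed.

Let mid_adm phi : c_concave p Om phi -> admissible Om (mid phi).
Proof. by move=> cp; apply: adm_lin => //; exact: (c_concave_adm H). Qed.

Let gap_ge0 phi y : c_concave p Om phi -> 0 <= gap phi y.
Proof.
move=> cp; have [bphi _] := c_concave_adm H _ cp; have [bpsi _] := psi_adm.
rewrite /gap subr_ge0; apply: (ct_ge (td_bc H)) => x Ox.
have := ct_le (td_bc H) _ _ y bphi Ox; have := ct_le (td_bc H) _ _ y bpsi Ox.
rewrite /mid; lra.
Qed.

Let gap_adm phi : c_concave p Om phi -> admissible Om (gap phi).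
Proof.
move=> cp; have [bphi _] := c_concave_adm H _ cp; have [bpsi _] := psi_adm.
have [bm _] := mid_adm _ cp.
have a1 := adm_lin _ _ 2^-1 2^-1 (ct_adm H _ bphi) (ct_adm H _ bpsi).
have := adm_lin _ _ 1 (- 1) (ct_adm H _ bm) a1; congr admissible.
by apply/funext => y; rewrite /gap mul1r mulN1r.
Qed.

(* The midpoint of two potentials cannot beat [psi], which bounds the mean of the gap. *)
Let gap_mean (d : R) phi : near_optimal d phi -> mean Om nu (gap phi) <= d / 2.
Proof.
move=> [cp hd]; have mO := td_m H.
have aphi := c_concave_adm H _ cp; have [bphi _] := aphi; have [bpsi _] := psi_adm.
have am := mid_adm _ cp; have [bm _] := am.
have a1 := adm_lin _ _ 2^-1 2^-1 (ct_adm H _ bphi) (ct_adm H _ bpsi).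
have e1 : mean Om nu (gap phi) = mean Om nu (ct (mid phi)) -
    (2^-1 * mean Om nu (ct phi) + 2^-1 * mean Om nu (ct psi)).
  rewrite -(mean_lin mO); [|exact: (ct_adm H)|exact: (ct_adm H)].
  have := mean_lin mO nu _ _ 1 (- 1) (ct_adm H _ bm) a1; rewrite mul1r mulN1r => <-.
  by apply: mean_eq => y _; rewrite /gap mul1r mulN1r.
have e2 : mean Om mu (mid phi) = 2^-1 * mean Om mu phi + 2^-1 * mean Om mu psi.
  exact: (mean_lin mO).
have := potential_max H _ _ _ _ Hpsi am; move: hd; rewrite e1 /dual e2; lra.
Qed.

(** From the mean to a point: the gap varies by at most e/2 on the neighbourhood [E] of [y], so a
    value above e at [y] would make the mean exceed e/2 times [nu E], which is positive because [y]
    lies in [U]. *)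
Lemma gap_small y (e : R) : U y -> 0 < e -> exists2 d : R, 0 < d &
  forall phi, near_optimal d phi -> gap phi y <= e.
Proof.
move=> Uy e0; have mO := td_m H; have Oy := UOm _ Uy.
have e4 : 0 < e / 4 by rewrite divr_gt0.
pose E := Om `&` [set z | near_by (dl (e / 4)) y z].
have mE : measurable E by apply: measurableI => //; exact: measurable_near_by.
have nE : (0 < nu E)%E by apply: Unu => //; exact: (td_dl H).
have nEf : nu E \is a fin_num by exact: fin_num_measure.
have nE0 : 0 < fine (nu E) by rewrite fine_gt0// nE ltey_eq nEf.
exists (e * fine (nu E)); first by rewrite mulr_gt0.
move=> phi nphi; have [cp _] := nphi.
have [bphi _] := c_concave_adm H _ cp; have [bpsi _] := psi_adm.
have [bm _] := mid_adm _ cp.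
rewrite leNgt; apply/negP => ge.
pose s := gap phi y - e / 2.
have s0 : 0 < s by move: ge e0; rewrite /s; lra.
have aE : admissible Om (\1_E : T -> R) by exact: adm_indic.
have sE z : Om z -> s * \1_E z + 0 * \1_E z <= gap phi z.
  move=> Oz; rewrite mul0r addr0 indicE; have [|zE] := boolP (z \in E); last first.
    by rewrite mulr0 gap_ge0.
  rewrite inE => -[_ /= yz]; rewrite mulr1 /s.
  have := ct_equi H _ bm _ e4 _ _ Oy Oz yz.
  have := ct_equi H _ bphi _ e4 _ _ Oy Oz yz.
  have := ct_equi H _ bpsi _ e4 _ _ Oy Oz yz.
  rewrite /gap; move: (ct (mid phi) y) (ct (mid phi) z) (ct phi y) (ct phi z).
  move: (ct psi y) (ct psi z) => a1 a2 a3 a4 a5 a6.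
  rewrite !ler_norml; move=> /andP[? ?] /andP[? ?] /andP[? ?]; lra.
have := mean_le mO nu _ _ (adm_lin _ _ s 0 aE aE) (gap_adm _ cp) sE.
rewrite (mean_lin mO)// mul0r addr0 (mean_indic mO)//; last by move=> z [].
have := gap_mean _ _ nphi.
have : e / 2 * fine (nu E) < s * fine (nu E).
  by rewrite ltr_pM2r//; move: ge; rewrite /s; lra.
by move: (mean _ _ _) => ?; lra.
Qed.

(** A point within e of the infimum for the midpoint has two nonnegative slacks, one per transform,
    whose average is at most 2e; each is thus at most 4e. *)
Lemma gap_witness phi y (e : R) : c_concave p Om phi -> Om y -> 0 < e -> gap phi y <= e ->
  exists x, [/\ Om x, c x y - phi x - 4 * e <= ct phi y & c x y - psi x - 4 * e <= ct psi y].
Proof.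
move=> cp Oy e0 ge; have [bphi _] := c_concave_adm H _ cp; have [bpsi _] := psi_adm.
have [bm _] := mid_adm _ cp.
have [x Ox hx] := ct_adherent (td_bc H) _ y e bm e0.
exists x; have h1 := ct_le (td_bc H) _ _ y bphi Ox.
have h2 := ct_le (td_bc H) _ _ y bpsi Ox.
by split => //; move: hx ge h1 h2; rewrite /gap /mid; lra.
Qed.

Let ddiff phi y := ct phi y - ct psi y.

(* Telescoping along the segment: [x_j] is nearly optimal at [y_j] for both transforms,
   so each increment of the difference is a mixed difference of the cost. After summation by
   parts only second differences in [y] survive, and these are o(1/N) each. *)
Lemma segment_step a b (e : R) : (forall N j, (j <= N.+1)%N -> U (segment_point a b N j)) ->
  0 < e -> exists2 d : R, 0 < d & forall phi, near_optimal d phi ->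
    ddiff phi b - ddiff phi a <= e.
Proof.
move=> Uab e0.
have e8 : 0 < e / 8 by rewrite divr_gt0.
have [N0 hN0] := @cost_second_difference R n p B (e / 8) (td_p H) B0 e8.
have dl0 := td_dl H _ e8.
(* Large enough for the bound on second differences, and for a single step to change the cost by at
   most e/8. *)
pose N := maxn N0 (Num.truncn (2 * B / dl (e / 8))).
have NN0 : (N0 <= N)%N by exact: leq_maxl.
have stepN : 2 * B / N.+1%:R <= dl (e / 8).
  rewrite ler_pdivrMr// -ler_pdivrMl// mulrC; apply: ltW.
  by apply: (lt_le_trans (truncnS_gt _)); rewrite ler_nat ltnS leq_maxr.
have tN : N.+1%:R != 0 :> R by rewrite pnatr_eq0.
pose y j := segment_point a b N j.
have Uy j : (j <= N.+1)%N -> U (y j) by exact: Uab.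
have Oy j : (j <= N.+1)%N -> Om (y j) by move=> /Uy/UOm.
have yE j i : tnth (y j) i = tnth a i + j%:R / N.+1%:R * (tnth b i - tnth a i).
  by rewrite tnth_mktuple.
have y0 : y 0%N = a by apply: eq_from_tnth => i; rewrite yE mul0r mul0r addr0.
have yN : y N.+1 = b by apply: eq_from_tnth => i; rewrite yE divff// mul1r subrKC.
have dy j i : tnth (y j.+1) i - tnth (y j) i = (tnth b i - tnth a i) / N.+1%:R.
  by rewrite !yE -(natr1 j); move: N.+1%:R tN => t tN; field.
have nb j : near_by (2 * B / N.+1%:R) (y j.+1) (y j).
  move=> i; rewrite dy normrM (@ger0_norm _ N.+1%:R^-1) ?invr_ge0//.
  rewrite ler_wpM2r ?invr_ge0//.
  have := OB _ (Oy 0%N isT) i; have := OB _ (Oy N.+1 (leqnn _)) i; rewrite y0 yN.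
  rewrite !ler_norml; move=> /andP[? ?] /andP[? ?]; apply/andP; split; lra.
have snd x j : Om x -> (j.+2 <= N.+1)%N ->
    (c x (y j.+2) - c x (y j.+1)) - (c x (y j.+1) - c x (y j)) <= e / 8 / N.+1%:R.
  move=> Ox jN; have := hN0 N NN0 x (y j.+1) (y j.+2) (y j) (OB _ Ox).
  move=> /(_ (OB _ (Oy _ (ltnW jN))) (OB _ (Oy _ jN)) (OB _ (Oy _ (ltnW (ltnW jN))))).
  move=> /(_ _ (nb _)) h; have {}h := h (fun i => etrans (dy _ i) (esym (dy _ i))).
  by move: h; move: (e / 8 / N.+1%:R) (c _ _) (c _ _) (c _ _) => ? ? ? ?; lra.
(* The N+1 increments each lose 8s, in total e/16; the two boundary terms and the sum of second
   differences cost e/8 each. *)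
pose s := e / 32 / N.+1%:R / 4.
have s0 : 0 < s by rewrite !divr_gt0.
have /choice[ds hds] : forall j, exists d : R, 0 < d /\ ((j <= N.+1)%N ->
    forall phi, near_optimal d phi -> gap phi (y j) <= s).
  move=> j; have [jN|jN] := leqP j N.+1; last by exists 1.
  by have [d d0 hd] := gap_small _ _ (Uy _ jN) s0; exists d.
pose d := \big[Num.min/1]_(j < N.+2) ds j.
have d0 : 0 < d by apply: (big_ind (fun x : R => 0 < x)) => //; [by move=> u v u0 v0; rewrite lt_min u0|move=> j _; case: (hds j)].
have dds j : (j <= N.+1)%N -> d <= ds j.
  by move=> jN; have := bigmin_le_cond 1 (fun j : 'I_N.+2 => ds j) (isT : xpredT (Ordinal (jN : (j < N.+2)%N))).
exists d => // phi nphi; have [cp _] := nphi.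
have [bphi _] := c_concave_adm H _ cp; have [bpsi _] := psi_adm.
have [x0 Ox0] := bc_ne (td_bc H).
have /choice[x hx] : forall j, exists x, Om x /\ ((j <= N.+1)%N ->
    c x (y j) - phi x - 4 * s <= ct phi (y j) /\ c x (y j) - psi x - 4 * s <= ct psi (y j)).
  move=> j; have [jN|jN] := leqP j N.+1; last by exists x0.
  have [_ /(_ jN phi (near_optimal_le _ _ _ (dds _ jN) nphi)) g] := hds j.
  by have [z [Oz h1 h2]] := gap_witness _ _ _ cp (Oy _ jN) s0 g; exists z.
have Ox j : Om (x j) by case: (hx j).
(* The witness [x j] bounds the increment of [ct phi], the next one [x j.+1] that of [ct psi]; the
   values of [phi] and [psi] cancel. *)
have inc j : (j < N.+1)%N -> ddiff phi (y j.+1) - ddiff phi (y j) <=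
    (c (x j) (y j.+1) - c (x j) (y j)) - (c (x j.+1) (y j.+1) - c (x j.+1) (y j)) + 8 * s.
  move=> jN; have [_ /(_ (ltnW jN))[h1 _]] := hx j; have [_ /(_ jN)[_ h2]] := hx j.+1.
  have h3 := ct_le (td_bc H) _ _ (y j.+1) bphi (Ox j).
  have h4 := ct_le (td_bc H) _ _ (y j) bpsi (Ox j.+1).
  move: h1 h2 h3 h4; rewrite /ddiff; move: (ct phi _) (ct phi _) (ct psi _) (ct psi _).
  move: (c (x j) _) (c (x j) _) (c (x j.+1) _) (c (x j.+1) _) (phi _) (psi _).
  by move=> ? ? ? ? ? ? ? ? ? ? ? ? ? ?; lra.
have tel m : (m < N.+1)%N -> ddiff phi (y m.+1) - ddiff phi (y 0%N) <=
    (c (x 0%N) (y 1%N) - c (x 0%N) (y 0%N)) -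
    (c (x m.+1) (y m.+1) - c (x m.+1) (y m)) + m%:R * (e / 8 / N.+1%:R) + m.+1%:R * (8 * s).
  elim: m => [h|m IH h]; first by have := inc 0%N h; rewrite mul0r mul1r addr0.
  rewrite -(natr1 m.+1) -(natr1 m).
  have := telescope_step (IH (ltnW h)) (inc m.+1 h) (snd _ _ (Ox m.+1) h).
  by rewrite -(natr1 m).
have := tel N (ltnSn N); rewrite y0 yN.
have h1 : c (x 0%N) (y 1%N) - c (x 0%N) a <= e / 8.
  have := td_mod H _ e8 (y 1%N) (y 0%N) (x 0%N) (Oy 1%N isT) (Oy 0%N isT) (Ox 0%N).
  move=> /(_ (near_by_le _ _ _ _ stepN (nb _))).
  by rewrite y0 ler_norml !(cost_sym _ (x _)); move=> /andP[].
have h2 : c (x N.+1) (y N) - c (x N.+1) b <= e / 8.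
  have := td_mod H _ e8 (y N.+1) (y N) (x N.+1) (Oy N.+1 (leqnn _)) (Oy N (leqnSn _)) (Ox N.+1).
  move=> /(_ (near_by_le _ _ _ _ stepN (nb _))).
  rewrite yN ler_norml !(cost_sym _ (x _)); move: (c _ _) (c _ _).
  by move=> ? ? /andP[? ?]; lra.
have h3 : N%:R * (e / 8 / N.+1%:R) <= e / 8.
  rewrite mulrCA ger_pMr// ler_pdivrMr// mul1r ler_nat//.
have h4 : N.+1%:R * (8 * s) = e / 16 by rewrite /s; move: N.+1%:R tN => t tN; field.
rewrite h4; move: h1 h2 h3 e0.
move: (N%:R * _) (ddiff phi _) (ddiff phi _) (c (x 0%N) _) (c (x 0%N) _) (c (x N.+1) _).
by move: (c (x N.+1) _) => ? ? ? ? ? ? ? ? ? ? ?; lra.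
Qed.

(** The difference of the two transforms takes asymptotically the same value at [a] and [b] as [phi]
    approaches optimality. Each pair has its own d; uniformity is recovered later from a finite
    partition. *)
Definition linked a b := forall e : R, 0 < e -> exists2 d : R, 0 < d &
  forall phi, near_optimal d phi -> `|ddiff phi b - ddiff phi a| <= e.

Lemma linked_sym a b : linked a b -> linked b a.
Proof.
move=> h e /h[d d0 hd]; exists d; first exact: d0.
by move=> phi /hd; move: (ddiff phi a) (ddiff phi b) => ? ?; rewrite distrC.
Qed.

Lemma linked_trans b a z : linked a b -> linked b z -> linked a z.
Proof.
move=> h1 h2 e e0; have e2 : 0 < e / 2 by rewrite divr_gt0.
have [d d0 hd] := h1 _ e2; have [d' d'0 hd'] := h2 _ e2.
exists (Num.min d d'); first by rewrite lt_min d0.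
move=> phi nphi; apply: le_trans (ler_distD (ddiff phi b) _ _) _.
rewrite (splitr e); apply: lerD.
  by apply: hd'; apply: near_optimal_le nphi; rewrite ge_min lexx orbT.
by apply: hd; apply: near_optimal_le nphi; rewrite ge_min lexx.
Qed.

(** Boxes are convex, so segments from [a] to its neighbours stay in [U]; travelling in both
    directions yields the absolute value. *)
Lemma linked_near a : U a -> exists2 d : R, 0 < d & near_by d a `<=` linked a.
Proof.
move=> Ua; have [d d0 hd] := Uopen _ Ua; exists d => // b ab.
have near_seg (t : R) i : 0 <= t <= 1 ->
    `|tnth a i - (tnth a i + t * (tnth b i - tnth a i))| <= d.
  move=> /andP[t0 t1]; rewrite opprD addNKr normrN normrM (ger0_norm t0).
  by apply: le_trans (ler_piMl _ t1) _ => //; rewrite distrC; exact: ab.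
have frac N j : (j <= N.+1)%N -> 0 <= (j%:R / N.+1%:R : R) <= 1.
  by move=> jN; rewrite divr_ge0//= ler_pdivrMr// mul1r ler_nat.
have U1 N j : (j <= N.+1)%N -> U (segment_point a b N j).
  by move=> jN; apply: hd => i; rewrite tnth_mktuple; apply: near_seg; exact: frac.
have U2 N j : (j <= N.+1)%N -> U (segment_point b a N j).
  move=> jN; apply: hd => i; rewrite tnth_mktuple.
  have := near_seg (1 - j%:R / N.+1%:R) i; set t := j%:R / N.+1%:R.
  have /andP[t0 t1] := frac _ _ jN.
  have -> : tnth a i + (1 - t) * (tnth b i - tnth a i) =
    tnth b i + t * (tnth a i - tnth b i) by ring.
  by apply; rewrite subr_ge0 t1 gerBl.
move=> e e0; have [d1 d10 h1] := segment_step _ _ _ U1 e0.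
have [d2 d20 h2] := segment_step _ _ _ U2 e0.
exists (Num.min d1 d2); first by rewrite lt_min d10.
move=> phi nphi; rewrite ler_norml h1 ?andbT; last first.
  by apply: near_optimal_le nphi; rewrite ge_min lexx.
by rewrite lerNl opprB h2//; apply: near_optimal_le nphi; rewrite ge_min lexx orbT.
Qed.

(** Connectedness links all points of [U] to [u0]. One point of [U] close to each cell of a finite
    partition makes the estimate uniform on [Om], and transforming once more carries it from
    [ct phi - ct psi] to [phi - psi]. *)
Theorem potential_stability (e : R) :
  U !=set0 ->
  (forall x, Om x -> forall d : R, 0 < d -> exists2 y, U y & near_by d x y) ->
  (forall E : T -> T -> Prop,
    (forall x y, E x y -> E y x) -> (forall y x z, E x y -> E y z -> E x z) ->
    (forall y, U y -> exists2 d : R, 0 < d & near_by d y `<=` E y) ->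
    forall y z, U y -> U z -> E y z) ->
  0 < e -> exists2 d : R, 0 < d & forall phi, near_optimal d phi ->
    exists K : R, forall x, Om x -> `|phi x - psi x - K| <= e.
Proof.
move=> [u0 Uu0] dense conn e0.
have lk := conn _ linked_sym linked_trans linked_near.
(* Five errors: each of the two transforms moves from x to the representative and from there to the
   point of [U], and one link leads to [u0]. *)
have e5 : 0 < e / 5 by rewrite divr_gt0.
have dl0 := td_dl H _ e5.
have [I [k [_ hk]]] := td_cells H _ dl0.
have /choice[r hr] : forall i, exists ru : T * T, [/\ Om ru.1, U ru.2,
    near_by (dl (e / 5)) ru.1 ru.2 & forall y, Om y -> k y = i -> k ru.1 = i].
  move=> i; have [[x [Ox kx]]|h] := pselect (exists x, Om x /\ k x = i).
    by have [u Uu xu] := dense _ Ox _ dl0; exists (x, u).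
  exists (u0, u0); split => //=; first exact: UOm.
    by apply: near_by_refl; exact: ltW.
  by move=> y Oy ky; exfalso; apply: h; exists y.
have /choice[ds hds] : forall i, exists d : R, 0 < d /\
    forall phi, near_optimal d phi -> `|ddiff phi (r i).2 - ddiff phi u0| <= e / 5.
  move=> i; have [_ Uri _ _] := hr i.
  by have [d d0 hd] := lk _ _ Uu0 Uri _ e5; exists d.
pose d := \big[Num.min/1]_(i : I) ds i.
have d0 : 0 < d by apply: (big_ind (fun x : R => 0 < x)) => //; [by move=> u v u0' v0; rewrite lt_min u0'|move=> j _; case: (hds j)].
have dds i : d <= ds i by exact: (bigmin_le_cond 1 ds (isT : xpredT i)).
exists d => // phi nphi; have [cp _] := nphi.
have [bphi phiE] := c_concave_bnd H _ cp; have [cpsi _] := Hpsi.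
have [bpsi psiE] := c_concave_bnd H _ cpsi.
have DD x : Om x -> `|ddiff phi x - ddiff phi u0| <= e.
  move=> Ox; have [Or Uu ru /(_ x Ox erefl) kr] := hr (k x).
  have xr := hk _ _ Ox Or (esym kr).
  have := ct_equi H _ bphi _ e5 _ _ Ox Or xr.
  have := ct_equi H _ bpsi _ e5 _ _ Ox Or xr.
  have := ct_equi H _ bphi _ e5 _ _ Or (UOm _ Uu) ru.
  have := ct_equi H _ bpsi _ e5 _ _ Or (UOm _ Uu) ru.
  have [_ h] := hds (k x); have := h _ (near_optimal_le _ _ _ (dds _) nphi).
  rewrite /ddiff; move: (ct phi _) (ct phi _) (ct phi _) (ct phi _) => ? ? ? ?.
  move: (ct psi _) (ct psi _) (ct psi _) (ct psi _) => ? ? ? ?; rewrite !ler_norml.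
  move=> /andP[? ?] /andP[? ?] /andP[? ?] /andP[? ?] /andP[? ?].
  by apply/andP; split; lra.
(* The transform reverses the sign of constants and does not increase uniform distances. *)
set K := ddiff phi u0 in DD; exists (- K) => x Ox.
have bcphi := ct_bnd (td_bc H) _ bphi; have bcpsi := ct_bnd (td_bc H) _ bpsi.
have g1 : ct (ct psi) x - K - e <= ct (ct phi) x.
  apply: (ct_ge (td_bc H)) => z Oz; have := ct_le (td_bc H) _ _ x bcpsi Oz.
  have := DD _ Oz; rewrite ler_norml /ddiff; move: (ct _ x) (ct phi _) (ct psi _) (c _ _).
  by move=> ? ? ? ? /andP[? ?] ?; lra.
have g2 : ct (ct phi) x + K - e <= ct (ct psi) x.
  apply: (ct_ge (td_bc H)) => z Oz; have := ct_le (td_bc H) _ _ x bcphi Oz.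
  have := DD _ Oz; rewrite ler_norml /ddiff; move: (ct _ x) (ct phi _) (ct psi _) (c _ _).
  by move=> ? ? ? ? /andP[? ?] ?; lra.
rewrite phiE// psiE// ler_norml; move: g1 g2; move: (ct (ct _) _) (ct (ct _) _).
by move=> ? ? ? ?; apply/andP; split; lra.
Qed.

End Stability.

(** * The convex energy and its derivative *)

Lemma is_derive_approx {R : realType} (f : R -> R) (s l e : R) :
  is_derive s (1 : R) f l -> 0 < e -> exists2 d : R, 0 < d &
    forall h, `|h| < d -> `|f (s + h) - f s - l * h| <= e * `|h|.
Proof.
move=> [df fl] e0.
have : h^-1 *: ((f \o shift s) (h *: (1 : R)) - f s) @[h --> 0^'] --> l.
  by rewrite -fl; exact: df.
move=> /cvgrPdist_le /(_ e e0) [d /= d0 hd]; exists d => // h hd'.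
have [->|h0] := eqVneq h 0; first by rewrite addr0 subrr mulr0 subrr normr0 mulr0.
have := hd h; rewrite /ball_ /= sub0r normrN => /(_ hd' h0).
rewrite distrC /shift /= [h *: 1]mulr1 (addrC h) => hh.
have -> : f (s + h) - f s - l * h = (h^-1 *: (f (s + h) - f s) - l) * h.
  by rewrite /GRing.scale/=; field.
by rewrite normrM ler_wpM2r.
Qed.

Record energy {R : realType} (f df : R -> R) := {
  en_0 : f 0 = 0;
  en_ge0 : forall t : R, 0 <= t -> 0 <= f t;
  en_conv : forall x y l : R, 0 <= x -> 0 <= y -> x != y -> 0 < l < 1 ->
    f (l * x + (1 - l) * y) < l * f x + (1 - l) * f y;
  en_der : forall t : R, 0 < t -> is_derive t (1 : R) f (df t);
  en_cont : {within `[0, +oo[, continuous df};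
  en_d0 : df 0 = 0 }.

Arguments en_0 {R f df}.
Arguments en_ge0 {R f df}.
Arguments en_conv {R f df}.
Arguments en_der {R f df}.
Arguments en_cont {R f df}.
Arguments en_d0 {R f df}.

Section Energy.
Context {R : realType} {f df : R -> R} (H : energy f df).

(** Convexity compares f at s + r(t - s) with the chord and differentiability compares it with the
    tangent; dividing by a small r gives the claim up to e. At s = 0 it is the positivity of f. *)
Lemma energy_tangent (s t : R) : 0 <= s -> 0 <= t -> f s + df s * (t - s) <= f t.
Proof.
rewrite le_eqVlt => /predU1P[<- t0|s0 t0].
  by rewrite (en_0 H) (en_d0 H) mul0r add0r (en_ge0 H).
have [->|ts] := eqVneq t s; first by rewrite subrr mulr0 addr0.
apply/ler_addgt0Pr => e e0.
have N0 : 0 < `|t - s| by rewrite normr_gt0 subr_eq0.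
have e'0 : 0 < e / `|t - s| by rewrite divr_gt0.
have [d d0 hd] := is_derive_approx _ _ _ _ (en_der H _ s0) e'0.
pose r := Num.min 2^-1 (d / (2 * `|t - s|)).
have r0 : 0 < r by rewrite lt_min invr_gt0 ltr0n/= divr_gt0// mulr_gt0.
have r1 : r < 1.
  apply: (@le_lt_trans _ _ 2^-1); first by rewrite ge_min lexx.
  by rewrite invf_lt1// ltr1n.
have rd : `|r * (t - s)| < d.
  rewrite normrM (gtr0_norm r0); apply: (@le_lt_trans _ _ (d / 2)); last first.
    by rewrite ltr_pdivrMr// ltr_pMr// ltr1n.
  rewrite -ler_pdivlMr// -mulrA -invfM ge_min lexx orbT//.
have := hd _ rd.
have rconv := en_conv H t s r t0 (ltW s0) ts; rewrite r0 r1 in rconv.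
have {}rconv := rconv isT.
have -> : s + r * (t - s) = r * t + (1 - r) * s by ring.
have -> : e / `|t - s| * `|r * (t - s)| = r * e.
  by rewrite normrM (gtr0_norm r0); field; rewrite gt_eqF.
rewrite ler_norml => /andP[h _].
have : r * (df s * (t - s)) <= r * (f t - f s + e).
  have e1 : df s * (r * (t - s)) = r * (df s * (t - s)) by ring.
  rewrite e1 in h; move: h rconv; move: (f (r * t + _)) (df s * _) => ? ?; lra.
rewrite ler_pM2l//; lra.
Qed.

(** The tangents at s and t, both evaluated at the midpoint, are compared with strict convexity
    there. *)
Lemma energy_dmono (s t : R) : 0 <= s -> s < t -> df s < df t.
Proof.
move=> s0 st; have t0 : 0 <= t by rewrite (le_trans s0)// ltW.
pose m := 2^-1 * s + (1 - 2^-1) * t.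
have m0 : 0 <= m by rewrite /m; lra.
have h1 := energy_tangent s m s0 m0.
have h2 := energy_tangent t m t0 m0.
have h3 : f m < 2^-1 * f s + (1 - 2^-1) * f t.
  by apply: (en_conv H) => //; [rewrite lt_eqF|rewrite invr_gt0 ltr0n/= invf_lt1// ltr1n].
rewrite -(ltr_pM2r (_ : 0 < t - s)); last by rewrite subr_gt0.
have e1 : m - s = (t - s) / 2 by rewrite /m; field.
have e2 : m - t = - ((t - s) / 2) by rewrite /m; field.
rewrite e1 in h1; rewrite e2 in h2; move: h1 h2 h3; rewrite mulrN !mulrA.
by move: (df s * _) (df t * _) (f m) => ? ? ?; lra.
Qed.

Lemma energy_dle (s t : R) : 0 <= s -> s <= t -> df s <= df t.
Proof.
move=> s0; rewrite le_eqVlt => /predU1P[->//|st]; apply: ltW; exact: energy_dmono.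
Qed.

Lemma energy_dge0 (t : R) : 0 <= t -> 0 <= df t.
Proof. by move=> t0; rewrite -(en_d0 H) energy_dle. Qed.

Lemma energy_dinj (s t : R) : 0 <= s -> 0 <= t -> df s = df t -> s = t.
Proof.
move=> s0 t0 st; case: (ltgtP s t) => // h.
  by have := energy_dmono _ _ s0 h; rewrite st ltxx.
by have := energy_dmono _ _ t0 h; rewrite st ltxx.
Qed.

Lemma energy_le (s t : R) : 0 <= s -> s <= t -> f s <= f t.
Proof.
move=> s0 st; apply: le_trans (energy_tangent s t s0 (le_trans s0 st)).
by rewrite lerDl mulr_ge0 ?energy_dge0// subr_ge0.
Qed.

(** The hypotheses control f on nonnegative reals only; composing with max(0, t) gives a monotone
    function on the line. *)
Lemma energy_measurable {d : measure_display} {T : measurableType d} (D : set T) (u : T -> R) :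
  measurable D -> measurable_fun D u -> (forall x, D x -> 0 <= u x) ->
  measurable_fun D (f \o u).
Proof.
move=> mD mu u0.
apply: (eq_measurable_fun ((fun t => f (Num.max 0 t)) \o u)).
  by move=> x /set_mem /u0 ux /=; rewrite max_r.
apply: (measurable_comp measurableT) => //.
apply: nondecreasing_measurable => // s t st; apply: energy_le.
  by rewrite le_max lexx.
by rewrite ge_max !le_max lexx/= st orbT.
Qed.

Lemma energy_dcont (a e : R) : 0 <= a -> 0 < e -> exists2 d : R, 0 < d &
  forall t, 0 <= t -> `|t - a| < d -> `|df t - df a| < e.
Proof.
move=> a0 e0; have /subspace_continuousP h := en_cont H.
have /h : (`[0, +oo[%classic : set R) a by rewrite /= in_itv/= a0.
move=> /cvgrPdist_lt /(_ e e0) [d /= d0 hd]; exists d => // t t0 ta.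
rewrite distrC; apply: hd; first by rewrite /ball_ /= distrC.
by rewrite /= in_itv/= t0.
Qed.

End Energy.

(** * Lebesgue measure, negligible sets and densities *)

Section LebesgueFacts.
Context {R : realType} {n : nat} (leb : {measure set (n.-tuple R) -> \bar R}).
Context (Hleb : is_lebesgue leb).
Local Notation T := (n.-tuple R).

Lemma leb_near_by (y : T) (d : R) : 0 <= d ->
  leb [set z | near_by d y z] = ((2 * d) ^+ n)%:E.
Proof.
move=> d0; pose a := [tuple tnth y i - d | i < n]; pose b := [tuple tnth y i + d | i < n].
have aE i : tnth a i = tnth y i - d by rewrite tnth_mktuple.
have bE i : tnth b i = tnth y i + d by rewrite tnth_mktuple.
rewrite (_ : [set z | _] = [set x | forall i, tnth a i <= tnth x i <= tnth b i]).
  rewrite Hleb; last by move=> i; rewrite aE bE; lra.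
  rewrite (eq_bigr (fun=> 2 * d)) => [|i _]; last by rewrite aE bE; ring.
  by rewrite prodr_const card_ord.
apply/seteqP; split => z /= h i; first by rewrite aE bE -ler_distlC; exact: h.
by rewrite ler_distlC -aE -bE; exact: h.
Qed.

Lemma domain_leb_fin (Om : set T) : bounded_domain leb Om -> (leb Om < +oo)%E.
Proof.
move=> HOm; have [B [B0 hB]] := domain_boxed _ _ HOm.
have := leb_near_by [tuple 0 | i < n] B B0.
set E := [set z | _] => EE; apply: (@le_lt_trans _ _ (leb E)); last by rewrite EE ltry.
apply: le_measure; rewrite ?inE.
- exact: domain_measurable HOm.
- exact: measurable_near_by.
- by move=> x /hB bx i; rewrite tnth_mktuple sub0r normrN; exact: bx.
Qed.

Lemma domain_leb_gt0 (Om : set T) : bounded_domain leb Om -> (0 < leb Om)%E.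
Proof.
move=> HOm; have [U [[x Ux] UO Uo _ _]] := domain_core _ _ HOm.
have [d d0 hd] := Uo _ Ux.
apply: (@lt_le_trans _ _ (leb [set z | near_by d x z])).
  by rewrite leb_near_by ?ltW// lte_fin exprn_gt0// mulr_gt0.
apply: le_measure; rewrite ?inE; [exact: measurable_near_by|exact: domain_measurable HOm|].
by move=> z /hd /UO.
Qed.

End LebesgueFacts.

Lemma ae_notin_null {d : measure_display} {T : measurableType d} {R : realType}
  (m : {measure set T -> \bar R}) (E : set T) :
  measurable E -> {ae m, forall x, ~ E x} -> m E = 0%E.
Proof.
move=> mE h; apply: (negligibleP m mE).1.
by apply: negligibleS h => x Ex /=; exact.
Qed.

Lemma integral_pos_null {d : measure_display} {T : measurableType d} {R : realType}
  (m : {measure set T -> \bar R}) (E : set T) (g : T -> R) :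
  measurable E -> measurable_fun E g -> {ae m, forall x, E x -> 0 < g x} ->
  (\int[m]_(x in E) (g x)%:E = 0)%E -> m E = 0%E.
Proof.
move=> mE mg gp g0.
have mgE : measurable_fun E (EFin \o g) by exact/measurable_EFinP.
have : ae_eq m E (EFin \o g) (cst 0%E).
  apply/(ae_eq_integral_abs m mE mgE); rewrite -[RHS]g0.
  apply: ae_eq_integral => //; first exact: measurableT_comp.
  by apply: filterS gp => x h /h gx; rewrite /= ger0_norm// ltW.
move=> ae0; apply: ae_notin_null => //.
apply: filterS2 gp ae0 => x h1 h2 Ex; have := h1 Ex.
by have [->] := h2 Ex; rewrite ltxx.
Qed.

Lemma density_unique {R : realType} {n : nat} (leb : {measure set (n.-tuple R) -> \bar R})
  (Om : set (n.-tuple R)) (mu : probability (n.-tuple R) R) (u w : n.-tuple R -> R) :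
  measurable Om -> is_density leb Om mu u -> is_density leb Om mu w ->
  ae_eq leb Om (EFin \o u) (EFin \o w).
Proof.
move=> mO [mu_ [u0 hu]] [mw [w0 hw]].
apply: integral_ae_eq => //.
- apply/integrableP; split; first exact/measurable_EFinP.
  apply: (@le_lt_trans _ _ (mu Om)); last first.
    by apply: (@le_lt_trans _ _ 1%E); [exact: probability_le1|exact: ltry].
  rewrite hu// setIid le_eqVlt; apply/orP; left; apply/eqP.
  by apply: eq_integral => x /set_mem Ox; rewrite /= ger0_norm// u0.
- exact/measurable_EFinP.
- move=> E EO mE; have := hu E mE; rewrite hw// (setIidl EO) => ->//.
Qed.

(** Densities agree almost everywhere, so the infimum that defines the entropy runs over a single
    value. *)
Lemma Fent_density {R : realType} {n : nat} (f df : R -> R)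
  (leb : {measure set (n.-tuple R) -> \bar R})
  (Om : set (n.-tuple R)) (mu : probability (n.-tuple R) R) (u : n.-tuple R -> R) :
  energy f df -> measurable Om -> is_density leb Om mu u ->
  Fent f leb Om mu = (\int[leb]_(x in Om) (f (u x))%:E)%E.
Proof.
move=> Hf mO hu; apply/eqP; rewrite eq_le; apply/andP; split.
  by apply: ereal_inf_lbound; exists u.
apply: le_ereal_inf_tmp => _ [w hw <-].
have [mu_ [u0 _]] := hu; have [mw [w0 _]] := hw.
rewrite (ae_eq_integral (fun x => (f (w x))%:E)) ?lexx//.
- by apply/measurable_EFinP; exact: (energy_measurable Hf).
- by apply/measurable_EFinP; exact: (energy_measurable Hf).
- by apply: filterS (density_unique _ _ _ _ _ mO hu hw) => x h /h[->].
Qed.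

(** * Transfer of mass between two sets *)

Section MassTransfer.
Context {R : realType} {n : nat} {p C : R} {Om : set (n.-tuple R)} {dl : R -> R}.
Context (H : transport_domain p C Om dl).
Context (leb : {measure set (n.-tuple R) -> \bar R}).
Local Notation T := (n.-tuple R).

(* [P] is obtained from [Q] by removing the fraction [e] of its mass on [B] and spreading it
   uniformly over [A]. *)
Definition mass_transfer (P Q : probability T R) (A B : set T) (e K : R) : Prop :=
  forall E, measurable E -> fine (P E) =
    fine (Q E) + e * (K * fine (leb (A `&` E)) - fine (Q (B `&` E))).

(** The transfer is known on sets only, so h is replaced by a function constant on small cells;
    equicontinuity controls the error on [A] and [B] as well as in the means. *)
Lemma mass_transfer_mean (P Q : probability T R) (A B : set T) (e K al be : R) (h : T -> R) :
  in_P Om P -> in_P Om Q -> measurable A -> measurable B -> A `<=` Om -> B `<=` Om ->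
  (leb A < +oo)%E -> 0 <= e -> 0 <= K -> K * fine (leb A) = fine (Q B) ->
  mass_transfer P Q A B e K -> bnd Om h -> equi (Om := Om) (dl := dl) h ->
  (forall x, A x -> h x <= al) -> (forall x, B x -> be <= h x) ->
  mean Om P h - mean Om Q h <= e * fine (Q B) * (al - be).
Proof.
move=> P1 Q1 mA mB AO BO lA e0 K0 KAB PQ bh eh hA hB.
have mO := td_m H; have ah : admissible Om h by split => //; exact: (equi_measurable H).
have QB0 : 0 <= fine (Q B) by rewrite fine_ge0.
(* Replacing h costs t in each of the two means and t on each of [A] and [B], the latter two
   weighted by [e * Q B]; the total is at most [t * L]. *)
pose L := 2 + 2 * e * fine (Q B).
have L0 : 0 < L by rewrite ltr_pwDl// !mulr_ge0.
apply/ler_addgt0Pr => g g0; pose t := g / L.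
have t0 : 0 < t by rewrite divr_gt0.
have [I [k [ck hk]]] := td_cells H _ (td_dl H _ t0).
have mk i : measurable (k @^-1` [set i]) by exact: ck.
have [x0 Ox0] := bc_ne (td_bc H).
have /choice[r hr] : forall i, exists x, Om x /\ forall y, Om y -> k y = i -> k x = i.
  move=> i; have [[x [Ox kx]]|no] := pselect (exists x, Om x /\ k x = i); first by exists x.
  by exists x0; split => // y Oy ky; exfalso; apply: no; exists y.
pose w i := h (r i).
have wh x : Om x -> `|h x - w (k x)| <= t.
  move=> Ox; have [Or /(_ x Ox erefl) kr] := hr (k x).
  by apply: eh => //; apply: hk.
have aw : admissible Om (w \o k) by exact: adm_cells.
have sh (m : probability T R) : in_P Om m ->
    mean Om m h <= mean Om m (w \o k) + t /\ mean Om m (w \o k) - t <= mean Om m h.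
  move=> m1; split.
    rewrite -(mean_shift mO)//; apply: (mean_le mO) => //.
      have := adm_lin _ _ 1 1 aw (adm_cst (Om := Om) t).
      by congr admissible; apply/funext => x; rewrite !mul1r.
    by move=> x /wh; rewrite ler_norml /= => /andP[_]; rewrite lerBlDl.
  rewrite -(mean_shift mO)//; apply: (mean_le mO) => //.
    have := adm_lin _ _ 1 1 aw (adm_cst (Om := Om) (- t)).
    by congr admissible; apply/funext => x; rewrite !mul1r.
  by move=> x /wh; rewrite ler_norml /= => /andP[+ _]; rewrite lerBrDl addrC.
have [hP _] := sh P P1; have [_ hQ] := sh Q Q1.
have full (m : probability T R) i : in_P Om m -> m (Om `&` k @^-1` [set i]) = m (k @^-1` [set i]).
  by move=> m1; exact: prob_full_setI.
have wP : mean Om P (w \o k) = mean Om Q (w \o k) +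
    e * (\sum_i w i * (K * fine (leb (A `&` k @^-1` [set i]))) -
         \sum_i w i * fine (Q (B `&` k @^-1` [set i]))).
  rewrite !(mean_cells mO)// -sumrB mulr_sumr -big_split; apply: eq_bigr => i _ /=.
  by rewrite !full// PQ// mulrDr mulrCA mulrBr.
have lAfin i : leb (A `&` k @^-1` [set i]) \is a fin_num.
  rewrite ge0_fin_numE//; apply: le_lt_trans lA; apply: le_measure; rewrite ?inE//.
  exact: measurableI.
have sA : \sum_i w i * (K * fine (leb (A `&` k @^-1` [set i]))) <= (al + t) * fine (Q B).
  rewrite -KAB -(measure_cells leb k A mA ck).
  rewrite -sum_fine; last by move=> i _; exact: lAfin.
  rewrite !mulr_sumr; apply: ler_sum => i _; rewrite /=.
  set z := fine _; have z0 : 0 <= z by rewrite fine_ge0.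
  have [->|zn] := eqVneq z 0; first by rewrite !mulr0.
  have [x [Ax kx]] : A `&` k @^-1` [set i] !=set0.
    apply/set0P; apply/eqP => e0'; move: zn; rewrite /z e0' measure0 eqxx//.
  rewrite ler_wpM2r ?mulr_ge0//.
  have := wh _ (AO _ Ax); rewrite kx ler_norml => /andP[h1 _].
  by have := hA _ Ax; move: h1; rewrite /w; move: (h x) (h (r i)) => ? ?; lra.
have sB : (be - t) * fine (Q B) <= \sum_i w i * fine (Q (B `&` k @^-1` [set i])).
  rewrite -{1}(measure_cells Q k B mB ck).
  rewrite -sum_fine; last by move=> i _; rewrite fin_num_measure//; exact: measurableI.
  rewrite !mulr_sumr; apply: ler_sum => i _; rewrite /=.
  set z := fine _; have z0 : 0 <= z by rewrite fine_ge0.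
  have [->|zn] := eqVneq z 0; first by rewrite !mulr0.
  have [x [Ax kx]] : B `&` k @^-1` [set i] !=set0.
    apply/set0P; apply/eqP => e0'; move: zn; rewrite /z e0' measure0 eqxx//.
  rewrite ler_wpM2r//.
  have := wh _ (BO _ Ax); rewrite kx ler_norml => /andP[_ h1].
  by have := hB _ Ax; move: h1; rewrite /w; move: (h x) (h (r i)) => ? ?; lra.
have gE : g = t * L by rewrite /t divfK// gt_eqF.
rewrite gE /L; move: hP hQ wP sA sB QB0.
move: (mean Om P h) (mean Om Q h) (mean Om P _) (mean Om Q _) (fine (Q B)).
move: (\sum_i _) (\sum_i _) => s2 s1 a1 a2 a3 a4 q h1 h2 h3 h4 h5 q0.
have : e * (s1 - s2) <= e * ((al + t) * q - (be - t) * q) by rewrite ler_wpM2l// lerB.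
by move: h1 h2 h3; lra.
Qed.

(** Taking e <= 1 keeps the new density nonnegative, and the relation between [K] and [mu B] keeps
    its mass equal to 1. *)
Lemma competitor (mu : probability T R) (u : T -> R) (A B : set T) (e K : R) :
  in_P Om mu -> is_density leb Om mu u -> (leb Om < +oo)%E ->
  measurable A -> measurable B -> A `<=` Om -> B `<=` Om ->
  0 <= e <= 1 -> 0 <= K -> K * fine (leb A) = fine (mu B) ->
  exists P : probability T R, [/\ in_P Om P,
    is_density leb Om P (fun x => u x + e * (K * \1_A x - u x * \1_B x)) &
    mass_transfer P mu A B e K].
Proof.
move=> m1 [mu_ [u0 hu]] lO mA mB AO BO /andP[e0 e1] K0 KAB; have mO := td_m H.
pose v x := u x + e * (K * \1_A x - u x * \1_B x).
have v0 x : Om x -> 0 <= v x.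
  move=> Ox; have := u0 x Ox; rewrite /v !indicE.
  have : 0 <= e * K by rewrite mulr_ge0.
  by case: (x \in A); case: (x \in B) => /= ? ?; nra.
have mv : measurable_fun Om v.
  apply: measurable_funD => //; apply: measurable_funM => //.
  apply: measurable_funB; apply: measurable_funM => //; exact: measurable_indic.
have lfin (E : set T) : measurable E -> E `<=` Om -> leb E \is a fin_num.
  move=> mE EO; rewrite ge0_fin_numE//; apply: le_lt_trans lO.
  by apply: le_measure; rewrite ?inE.
have key (E : set T) : measurable E -> (\int[leb]_(x in E `&` Om) (v x)%:E =
    (fine (mu E) + e * (K * fine (leb (A `&` E)) - fine (mu (B `&` E))))%:E)%E.
  move=> mE; have mEO : measurable (E `&` Om) by exact: measurableI.
  have mE1 (f : T -> R) : measurable_fun Om f -> measurable_fun (E `&` Om) (EFin \o f).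
    by move=> mf; apply/measurable_EFinP; apply: measurable_funS mf => // x [].
  have mAE : measurable (A `&` E) by exact: measurableI.
  have mBE : measurable (B `&` E) by exact: measurableI.
  have i1 : (\int[leb]_(x in E `&` Om) (e * (u x * \1_B x))%:E = (e * fine (mu (B `&` E)))%:E)%E.
    under eq_integral do rewrite EFinM.
    rewrite ge0_integralZl_EFin//; last 2 first.
    - by move=> x [_ Ox]; rewrite lee_fin mulr_ge0// u0.
    - apply: mE1; apply: measurable_funM => //; exact: measurable_indic.
    rewrite EFinM; congr (_ * _)%E; rewrite fineK ?fin_num_measure// hu//.
    rewrite (_ : B `&` E `&` Om = (E `&` Om) `&` B); last by apply/seteqP; split => x [[? ?] ?].
    rewrite [RHS]integral_mkcondr; apply: eq_integral => x _; rewrite patchE indicE.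
    by case: (x \in B); rewrite ?mulr1 ?mulr0.
  have i2 : (\int[leb]_(x in E `&` Om) (e * K * \1_A x)%:E = (e * (K * fine (leb (A `&` E))))%:E)%E.
    under eq_integral do rewrite EFinM.
    rewrite ge0_integralZl_EFin ?mulr_ge0//; last by apply: mE1; exact: measurable_indic.
    rewrite (integral_indic _ mEO mA) setIA (setIidl (_ : A `&` E `<=` Om)); last first.
      by move=> x [/AO].
    by rewrite mulrA [in RHS]EFinM fineK//; apply: lfin => // x [/AO].
  have i3 : (\int[leb]_(x in E `&` Om) (u x)%:E = (fine (mu E))%:E)%E.
    by rewrite fineK ?fin_num_measure// hu.
  (* The removed mass is moved to the other side, so that only nonnegative functions are
     integrated. *)
  have : (\int[leb]_(x in E `&` Om) ((v x)%:E + (e * (u x * \1_B x))%:E) =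
      \int[leb]_(x in E `&` Om) ((u x)%:E + (e * K * \1_A x)%:E))%E.
    by apply: eq_integral => x _; rewrite -!EFinD /v; congr EFin; ring.
  rewrite !ge0_integralD//.
  - rewrite i1 i2 i3; case: (\int[leb]_(x in E `&` Om) (v x)%:E)%E => [r| |]//=.
    by rewrite -!EFinD => -[] h; congr EFin; move: h; lra.
  - by move=> x [_ Ox]; rewrite lee_fin u0.
  - exact: mE1.
  - by move=> x [_ Ox]; rewrite lee_fin !mulr_ge0.
  - by apply: mE1; apply: measurable_funM => //; exact: measurable_indic.
  - by move=> x [_ Ox]; rewrite lee_fin v0.
  - exact: mE1.
  - by move=> x [_ Ox]; rewrite lee_fin !mulr_ge0// u0.
  - apply: mE1; apply: measurable_funM => //; apply: measurable_funM => //; exact: measurable_indic.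
have [||| P hP] := @density_probability _ _ R leb ((EFin \o v) \_ Om).
- by apply/(measurable_restrictT _ mO); exact/measurable_EFinP.
- by move=> x; rewrite patchE; case: ifPn => // /set_mem Ox; rewrite lee_fin v0.
- rewrite -integral_mkcondr; have := key setT measurableT.
  rewrite !setIT -KAB subrr mulr0 addr0 => ->.
  by rewrite probability_setT.
have PE (E : set T) : measurable E -> P E = (\int[leb]_(x in E `&` Om) (v x)%:E)%E.
  by move=> mE; rewrite hP -integral_mkcondr.
exists P; split.
- rewrite /in_P PE// setIid; have := key Om mO; rewrite setIid => ->.
  rewrite (setIidl AO) (setIidl BO) KAB subrr mulr0 addr0.
  by rewrite m1.
- by split => //; split => // E mE; exact: PE.
- by move=> E mE; rewrite PE// key.
Qed.

End MassTransfer.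

(** The infima defining h at x and at y run over the same points, with costs that differ by at most
    C. *)
Lemma c_concave_osc {R : realType} {n : nat} {p C : R} {Om : set (n.-tuple R)} {dl : R -> R}
  (H : transport_domain p C Om dl) (h : n.-tuple R -> R) (x y : n.-tuple R) :
  c_concave p Om h -> Om x -> Om y -> h x <= h y + C.
Proof.
move=> /(c_concave_bnd H)[bh hE] Ox Oy; have BC := td_bc H.
rewrite -lerBlDr [h y]hE//; apply: (ct_ge BC) => z Oz; rewrite [h x]hE//.
have := ct_le BC _ _ x (ct_bnd BC _ bh) Oz; have := bc_le BC _ _ Oz Ox.
by have := bc_ge0 BC z y; move: (ct _ _ (ct _ _ _) x) (ct _ _ _ z) (cost _ _ _) (cost _ _ _) => ? ? ? ?; lra.
Qed.

(** * First variations of the transport cost and of the energy *)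

Section FirstVariation.
Context {R : realType} {n : nat} {p C : R} {Om : set (n.-tuple R)} {dl : R -> R}.
Context (H : transport_domain p C Om dl).
Context {leb : {measure set (n.-tuple R) -> \bar R}} {f df : R -> R} (Hf : energy f df).
Local Notation T := (n.-tuple R).
Local Notation dual := (@dual R n p Om).

Lemma Tp_fin (mu nu : probability T R) : in_P Om mu -> in_P Om nu -> Tp p Om mu nu \is a fin_num.
Proof.
move=> m1 n1; have [phi _ h] := strong_duality H mu nu 1 m1 n1 ltr01.
rewrite ge0_fin_numE ?(Tp_ge0 mu nu)//.
exact: le_lt_trans h (ltry _).
Qed.

(* First variation of the transport cost: only the upper bound needs the potential of the
   perturbed measure to stay close to [psi]. *)
Lemma transport_variation (mu nu : probability T R) (psi : T -> R) (A B : set T)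
    (K al be th : R) :
  in_P Om mu -> in_P Om nu -> kantorovich_potential p Om mu nu psi ->
  (forall e : R, 0 < e -> exists2 d : R, 0 < d &
    forall phi, near_optimal (p := p) (Om := Om) mu nu psi d phi ->
    exists c : R, forall x, Om x -> `|phi x - psi x - c| <= e) ->
  measurable A -> measurable B -> A `<=` Om -> B `<=` Om -> (leb A < +oo)%E ->
  0 <= K -> K * fine (leb A) = fine (mu B) -> 0 < fine (mu B) ->
  (forall x, A x -> psi x <= al) -> (forall x, B x -> be <= psi x) -> 0 < th ->
  exists2 e0 : R, 0 < e0 & forall e P, 0 < e <= e0 -> in_P Om P ->
    mass_transfer leb P mu A B e K ->
    fine (Tp p Om P nu) <= fine (Tp p Om mu nu) + e * fine (mu B) * (al - be + 3 * th).
Proof.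
move=> m1 n1 Hpsi stab mA mB AO BO lA K0 KAB MB0 psA psB th0.
have [d0 d00 hd0] := stab _ th0.
have [x0 Ox0] := bc_ne (td_bc H); have BC := td_bc H.
have C0 : 0 <= C by exact: le_trans (bc_ge0 BC x0 x0) (bc_le BC _ _ Ox0 Ox0).
set MB := fine (mu B) in KAB MB0 *.
have MB1 : MB <= 1.
  by rewrite -lee_fin fineK ?fin_num_measure//; exact: probability_le1.
(* Losses in near-optimality for [mu], in units of the mass moved: [th] from the approximate
   duality, and 2C from each of [phi] and [psi] when [P] replaces [mu]. *)
pose L := th + 4 * C.
have L0 : 0 < L by rewrite ltr_pwDl// mulr_ge0.
exists (d0 / L); first by rewrite divr_gt0.
move=> e P /andP[e0 eL] P1 PQ.
(* The duality error is proportional to the mass moved, so that it is a small first-order term; this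
   is one of the three [th] of the conclusion. *)
have tol : 0 < e * MB * th by rewrite !mulr_gt0.
have [phi cphi hphi] := strong_duality H P nu _ P1 n1 tol.
have [cpsi _] := Hpsi.
have aphi := c_concave_adm H _ cphi; have apsi := c_concave_adm H _ cpsi.
have [[bphi _] [bpsi _]] := (aphi, apsi).
have ephi := c_concave_equi H _ cphi; have epsi := c_concave_equi H _ cpsi.
have w1 := weak_duality H P nu psi P1 n1 apsi.
have w2 := weak_duality H mu nu phi m1 n1 aphi.
have TP := Tp_fin P nu P1 n1; have TM := Tp_fin mu nu m1 n1.
rewrite -(fineK TP) lee_fin in hphi; rewrite -(fineK TP) lee_fin in w1.
rewrite -(fineK TM) lee_fin in w2.
have tr h a b : bnd Om h -> equi (Om := Om) (dl := dl) h -> (forall x, A x -> h x <= a) ->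
    (forall x, B x -> b <= h x) -> mean Om P h - mean Om mu h <= e * MB * (a - b).
  by move=> bh eh hA hB; apply: (mass_transfer_mean H leb P mu A B e K a b h) => //; exact: ltW.
have t1 : mean Om P phi - mean Om mu phi <= e * MB * (2 * C).
  have -> : 2 * C = (phi x0 + C) - (phi x0 - C) by ring.
  apply: tr => // x; first by move=> /AO Ox; exact: (c_concave_osc H).
  by move=> /BO Ox; rewrite lerBlDr; exact: (c_concave_osc H).
(* The transfer estimate is one-sided, so it is applied to the opposite of [psi]. *)
have t2 : mean Om mu psi - mean Om P psi <= e * MB * (2 * C).
  have an : admissible Om (fun x => -1 * psi x + 0 * psi x) by exact: adm_lin.
  have nE x : -1 * psi x + 0 * psi x = - psi x by rewrite mulN1r mul0r addr0.
  have := tr (fun x => -1 * psi x + 0 * psi x) (- psi x0 + C) (- psi x0 - C).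
  rewrite !(mean_lin (td_m H))// !mulN1r !mul0r !addr0.
  have -> : (- psi x0 + C) - (- psi x0 - C) = 2 * C by ring.
  have -> : - mean Om P psi - - mean Om mu psi = mean Om mu psi - mean Om P psi by ring.
  apply.
  - by case: an.
  - by move=> g g0 x y Ox Oy xy; rewrite !nE -opprD normrN; exact: epsi.
  - by move=> x /AO Ox; rewrite nE; have := c_concave_osc H psi x0 x cpsi Ox0 Ox; move: (psi x) (psi x0) => ? ?; lra.
  - by move=> x /BO Ox; rewrite nE; have := c_concave_osc H psi x x0 cpsi Ox Ox0; move: (psi x) (psi x0) => ? ?; lra.
have nopt : near_optimal (p := p) (Om := Om) mu nu psi d0 phi.
  split => //.
  have eMB : e * MB * L <= d0.
    rewrite mulrAC -[leRHS]mulr1 ler_pM ?(ltW MB0) ?mulr_ge0 ?(ltW e0) ?(ltW L0)//.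
    by rewrite -ler_pdivlMr.
  move: hphi w1 t1 t2 eMB; rewrite /dual /L.
  move: (mean Om P phi) (mean Om P psi) (mean Om mu phi) (mean Om mu psi) (mean Om nu _) (mean Om nu _).
  move: (fine _) (e * MB).
  by move=> ? ? ? ? ? ? ? ?; lra.
have [c hc] := hd0 _ nopt.
(* The constant [c] cancels because the mass gained on [A] equals the mass lost on [B]; the two [th]
   come from the distance to [psi] on each set. *)
have t3 : mean Om P phi - mean Om mu phi <= e * MB * (al - be + 2 * th).
  have -> : al - be + 2 * th = (al + c + th) - (be + c - th) by ring.
  apply: tr => // x Ax.
    have := hc _ (AO _ Ax); have := psA _ Ax; rewrite ler_norml.
    by move: (phi x) (psi x) => ? ? ? /andP[? ?]; lra.
  have := hc _ (BO _ Ax); have := psB _ Ax; rewrite ler_norml.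
  by move: (phi x) (psi x) => ? ? ? /andP[? ?]; lra.
move: hphi w2 t3; rewrite /dual.
move: (mean Om P phi) (mean Om mu phi) (mean Om nu _) (fine (Tp _ _ _ _)) (fine (Tp _ _ _ _)).
by move: (e * MB) => ? ? ? ? ? ?; lra.
Qed.

(** The tangent is taken at the new density v, not at u: this bounds f(v) from above for a fixed e,
    with f' evaluated at the extreme new values a + eK on [A] and (1 - e)b on [B]. *)
Lemma energy_variation (mu P : probability T R) (u : T -> R) (A B : set T) (e K a b : R) :
  is_density leb Om mu u ->
  is_density leb Om P (fun x => u x + e * (K * \1_A x - u x * \1_B x)) ->
  measurable A -> measurable B -> A `<=` Om -> B `<=` Om -> A `&` B = set0 ->
  (leb A < +oo)%E -> (\int[leb]_(x in Om) (f (u x))%:E < +oo)%E ->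
  0 <= e <= 1 -> 0 <= K -> 0 <= a -> 0 <= b -> K * fine (leb A) = fine (mu B) ->
  (forall x, A x -> u x <= a) -> (forall x, B x -> b <= u x) ->
  (Fent f leb Om P <= (fine (Fent f leb Om mu) +
     e * fine (mu B) * (df (a + e * K) - df ((1 - e) * b)))%:E)%E.
Proof.
move=> hu hv mA mB AO BO AB lA fu /andP[e0 e1] K0 a0 b0 KAB uA uB; have mO := td_m H.
rewrite (Fent_density f df leb Om P _ Hf mO hv) (Fent_density f df leb Om mu _ Hf mO hu).
have [mu_ [u0 hmu]] := hu; have [mv [v0 _]] := hv.
set v := (fun x : T => u x + _) in mv v0 *.
have aK0 : 0 <= a + e * K by rewrite addr_ge0// mulr_ge0.
have eb0 : 0 <= (1 - e) * b by rewrite mulr_ge0// subr_ge0.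
set D := df (a + e * K); set D' := df ((1 - e) * b).
have D0 : 0 <= D by exact: (energy_dge0 Hf).
have D'0 : 0 <= D' by exact: (energy_dge0 Hf).
have pt x : Om x -> f (v x) + e * D' * (u x * \1_B x) <= f (u x) + e * K * D * \1_A x.
  move=> Ox; have ux := u0 x Ox; have vx := v0 x Ox.
  have tg := energy_tangent Hf (v x) (u x) vx ux.
  have [xA|xA] := boolP (x \in A).
    have xB : (x \in B) = false.
      apply/negP => /set_mem xB; have : (A `&` B) x by split => //; exact: set_mem xA.
      by rewrite AB.
    have vE : v x = u x + e * K by rewrite /v !indicE xA xB mulr1 mulr0 subr0.
    have dv : df (v x) <= D.
      by apply: (energy_dle Hf) => //; rewrite vE lerD2r; apply: uA; exact: set_mem.
    rewrite !indicE xA xB !mulr0 mulr1 addr0.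
    have : e * K * df (v x) <= e * K * D by rewrite ler_wpM2l// mulr_ge0.
    have e2 : df (v x) * (u x - v x) = - (e * K * df (v x)) by rewrite vE; ring.
    by rewrite e2 in tg; move: tg; move: (f (v x)) (f (u x)) (e * K * df (v x)) (e * K * D) => ? ? ? ?; lra.
  have [xB|xB] := boolP (x \in B).
    have vE : v x = (1 - e) * u x by rewrite /v !indicE (negbTE xA) xB mulr0 mulr1; ring.
    have bu : b <= u x by apply: uB; exact: set_mem.
    have dv : D' <= df (v x).
      by apply: (energy_dle Hf) => //; rewrite vE ler_wpM2l// subr_ge0.
    rewrite !indicE (negbTE xA) xB mulr0 addr0 mulr1.
    have : e * u x * D' <= e * u x * df (v x) by rewrite ler_wpM2l// mulr_ge0.
    have e2 : df (v x) * (u x - v x) = e * u x * df (v x) by rewrite vE; ring.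
    rewrite e2 in tg; rewrite (mulrAC e); move: tg.
    by move: (f (v x)) (f (u x)) (e * u x * df (v x)) (e * u x * D') => ? ? ? ?; lra.
  rewrite !indicE (negbTE xA) (negbTE xB) !mulr0 !addr0.
  by rewrite (_ : v x = u x)// /v !indicE (negbTE xA) (negbTE xB) !mulr0 subr0 mulr0 addr0.
have mfu : measurable_fun Om (fun x => (f (u x))%:E).
  by apply/measurable_EFinP; exact: (energy_measurable Hf).
have mfv : measurable_fun Om (fun x => (f (v x))%:E).
  by apply/measurable_EFinP; exact: (energy_measurable Hf).
have muB : measurable_fun Om (fun x => (u x * \1_B x)%:E).
  by apply/measurable_EFinP; apply: measurable_funM => //; exact: measurable_indic.
have mA1 : measurable_fun Om (fun x => (\1_A x : R)%:E).
  by apply/measurable_EFinP; exact: measurable_indic.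
have pB x : Om x -> (0 <= (u x * \1_B x)%:E)%E by move=> Ox; rewrite lee_fin mulr_ge0// u0.
have mcA : measurable_fun Om (fun x => (e * K * D * \1_A x)%:E).
  apply/measurable_EFinP; apply: (measurable_funM (f := cst (e * K * D))).
    exact: measurable_cst.
  exact: measurable_indic.
have mcB : measurable_fun Om (fun x => (e * D' * (u x * \1_B x))%:E).
  apply/measurable_EFinP; apply: (measurable_funM (f := cst (e * D'))).
    exact: measurable_cst.
  exact/measurable_EFinP.
have iB : (\int[leb]_(x in Om) (e * D' * (u x * \1_B x))%:E = (e * D' * fine (mu B))%:E)%E.
  under eq_integral do rewrite EFinM.
  rewrite ge0_integralZl_EFin ?mulr_ge0// [RHS]EFinM; congr (_ * _)%E.
  rewrite fineK ?fin_num_measure// hmu// setIC [RHS]integral_mkcondr.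
  apply: eq_integral => x _; rewrite patchE indicE.
  by case: (x \in B); rewrite ?mulr1 ?mulr0.
have iA : (\int[leb]_(x in Om) (e * K * D * \1_A x)%:E = (e * D * fine (mu B))%:E)%E.
  under eq_integral do rewrite EFinM.
  rewrite ge0_integralZl_EFin ?mulr_ge0// (integral_indic _ mO mA) (setIidl AO).
  have lAf : leb A \is a fin_num by rewrite ge0_fin_numE.
  by rewrite -(fineK lAf) -EFinM -KAB; congr EFin; ring.
have : (\int[leb]_(x in Om) ((f (v x))%:E + (e * D' * (u x * \1_B x))%:E) <=
    \int[leb]_(x in Om) ((f (u x))%:E + (e * K * D * \1_A x)%:E))%E.
  apply: ge0_le_integral => //.
  - move=> x Ox; rewrite -EFinD lee_fin addr_ge0 ?(en_ge0 Hf) ?v0//.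
    by rewrite mulr_ge0 ?mulr_ge0// u0.
  - exact: emeasurable_funD.
  - exact: emeasurable_funD.
rewrite !ge0_integralD//.
- rewrite iA iB -(fineK (_ : (\int[leb]_(x in Om) (f (u x))%:E)%E \is a fin_num)); last first.
    rewrite ge0_fin_numE//; apply: integral_ge0 => x Ox.
    by rewrite lee_fin (en_ge0 Hf)// u0.
  case: (\int[leb]_(x in Om) (f (v x))%:E)%E => [r| |]//=.
  rewrite -!EFinD !lee_fin mulrBr; move: (fine (integral _ _ _)) (fine (mu B)) => ? ?; nra.
  by move=> _; exact: leNye.
- by move=> x Ox; rewrite lee_fin (en_ge0 Hf)// u0.
- by move=> x Ox; rewrite lee_fin !mulr_ge0.
- by move=> x Ox; rewrite lee_fin (en_ge0 Hf)// v0.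
- by move=> x Ox; rewrite lee_fin mulr_ge0 ?mulr_ge0// u0.
Qed.

End FirstVariation.

(** * Countable families of null sets and the exchange inequality *)

Section AlmostEverywhere.
Context {d : measure_display} {T : measurableType d} {R : realType}.
Context (m : {measure set T -> \bar R}).

Lemma ae_forall_countable {I : countType} (P : I -> T -> Prop) :
  (forall i, {ae m, forall x, P i x}) -> {ae m, forall x, forall i, P i x}.
Proof.
move=> h; have : {ae m, forall x, forall k : nat, if unpickle k is Some i then P i x else True}.
  apply: ae_foralln => k; case: unpickle => [i|]; first exact: h.
  exact: aeW.
by apply: filterS => x hx i; have := hx (pickle i); rewrite pickleK.
Qed.

Lemma ae_notin (E : set T) : measurable E -> m E = 0%E -> {ae m, forall x, ~ E x}.
Proof.
move=> mE E0; have := (negligibleP m mE).2 E0; apply: negligibleS => x /= h.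
exact: contrapT.
Qed.

End AlmostEverywhere.

Section Optimality.
Context {R : realType} {n : nat} {p C : R} {Om : set (n.-tuple R)} {dl : R -> R}.
Context (H : transport_domain p C Om dl).
Context {leb : {measure set (n.-tuple R) -> \bar R}} {f df : R -> R} (Hf : energy f df).
Local Notation T := (n.-tuple R).
Context {mu nu : probability T R} (m1 : in_P Om mu) (n1 : in_P Om nu).
Context {u : T -> R} (Hu : is_density leb Om mu u) (lO : (leb Om < +oo)%E).
Context (Hmin : forall mu' : probability T R, in_P Om mu' ->
      (Ffun p f leb Om nu mu <= Ffun p f leb Om nu mu')%E).
Context {psi : T -> R} (Hpsi : kantorovich_potential p Om mu nu psi).

Definition below (psi u : T -> R) (al a : R) : set T :=
  Om `&` (psi @^-1` `]-oo, al]) `&` (Om `&` (u @^-1` `]-oo, a])).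
Definition above (psi u : T -> R) (be b : R) : set T :=
  Om `&` (psi @^-1` `[be, +oo[) `&` (Om `&` (u @^-1` `[b, +oo[)).

Lemma belowP (g w : T -> R) al a x : below g w al a x <-> [/\ Om x, g x <= al & w x <= a].
Proof. by rewrite /below /= !in_itv/=; split => [[[? ?] [? ?]]|[? ? ?]]. Qed.

Lemma aboveP (g w : T -> R) be b x : above g w be b x <-> [/\ Om x, be <= g x & b <= w x].
Proof. by rewrite /above /= !in_itv/= !andbT; split => [[[? ?] [? ?]]|[? ? ?]]. Qed.

Let mpsi : measurable_fun Om psi.
Proof. by have [cp _] := Hpsi; have [] := c_concave_adm H _ cp. Qed.

Let mu_ : measurable_fun Om u. Proof. by case: Hu. Qed.

Lemma below_measurable al a : measurable (below psi u al a).
Proof. by apply: measurableI; [apply: mpsi|apply: mu_] => //; exact: (td_m H). Qed.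

Lemma above_measurable be b : measurable (above psi u be b).
Proof. by apply: measurableI; [apply: mpsi|apply: mu_] => //; exact: (td_m H). Qed.

(** The uniform probability on [Om] is a competitor with finite energy and finite transport cost. *)
Lemma energy_finite : (0 < leb Om)%E -> (\int[leb]_(x in Om) (f (u x))%:E < +oo)%E.
Proof.
move=> lO0; have mO := td_m H.
have lOf : leb Om \is a fin_num by rewrite ge0_fin_numE.
have L0 : 0 < fine (leb Om) by rewrite fine_gt0// lO0.
pose s := (fine (leb Om))^-1; have s0 : 0 < s by rewrite invr_gt0.
have iE (E : set T) : measurable E ->
    (\int[leb]_(x in E) ((cst s%:E) \_ Om) x = \int[leb]_(x in E `&` Om) s%:E)%E.
  by move=> mE; rewrite -integral_mkcondr.
have [||| P hP] := @density_probability _ _ R leb ((cst s%:E) \_ Om).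
- by apply/(measurable_restrictT _ mO); exact: measurable_cst.
- by move=> x; rewrite patchE; case: ifPn => // _; rewrite lee_fin ltW.
- by rewrite iE// setTI integral_cst// -(fineK lOf) -EFinM mulVf// gt_eqF.
have P1 : in_P Om P.
  by rewrite /in_P hP iE// setIid integral_cst// -(fineK lOf) -EFinM mulVf// gt_eqF.
have Pd : is_density leb Om P (fun=> s).
  split; first exact: measurable_cst.
  by split => [x _|E mE]; [exact: ltW|exact: etrans (hP E) (iE E mE)].
have := Hmin P P1; rewrite /Ffun (Fent_density f df leb Om P _ Hf (td_m H) Pd).
rewrite (Fent_density f df leb Om mu _ Hf (td_m H) Hu) integral_cst//.
rewrite -(fineK lOf) -(fineK (Tp_fin H P nu P1 n1)) -(fineK (Tp_fin H mu nu m1 n1)).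
by case: (\int[leb]_(x in Om) _)%E => [r| |]//=; rewrite ?ltry ?ltNye.
Qed.

(** If both sets had mass, moving a small fraction from the second to the first would lower the
    functional, the sum of the two first variations being negative. *)
Lemma optimal_exchange (al be a b : R) :
  (forall e : R, 0 < e -> exists2 d : R, 0 < d &
    forall phi, near_optimal (p := p) (Om := Om) mu nu psi d phi ->
    exists c : R, forall x, Om x -> `|phi x - psi x - c| <= e) ->
  (0 < leb Om)%E ->
  0 <= a -> 0 <= b -> al + df a < be + df b ->
  leb (below psi u al a) = 0%E \/ mu (above psi u be b) = 0%E.
Proof.
move=> stab lO0 a0 b0 gap.
set A := below _ _ _ _; set B := above _ _ _ _.
have mA : measurable A by exact: below_measurable.
have mB : measurable B by exact: above_measurable.
have AO : A `<=` Om by move=> x /belowP[].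
have BO : B `<=` Om by move=> x /aboveP[].
have lA : (leb A < +oo)%E.
  by apply: le_lt_trans lO; apply: le_measure; rewrite ?inE//; exact: (td_m H).
have lAf : leb A \is a fin_num by rewrite ge0_fin_numE.
have [->|lA0] := eqVneq (leb A) 0%E; first by left.
have [->|mB0] := eqVneq (mu B) 0%E; first by right.
exfalso.
have LA0 : 0 < fine (leb A) by rewrite fine_gt0// lA andbT lt_neqAle eq_sym lA0 measure_ge0.
have MB0 : 0 < fine (mu B).
  rewrite fine_gt0// lt_neqAle eq_sym mB0 measure_ge0/=.
  by rewrite -ge0_fin_numE// fin_num_measure.
pose K := fine (mu B) / fine (leb A).
have K0 : 0 < K by rewrite divr_gt0.
have KAB : K * fine (leb A) = fine (mu B) by rewrite divfK// gt_eqF.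
(* On a common point b <= u <= a and be <= psi <= al, which contradicts the strict gap since f' is
   monotone. *)
have AB : A `&` B = set0.
  apply/seteqP; split => // x [/belowP[Ox h1 h2] /aboveP[_ h3 h4]].
  have := energy_dle Hf _ _ b0 (le_trans h4 h2).
  by move: gap h1 h3; move: (df a) (df b) (psi x) => ? ? ?; lra.
(* The gap is 8 [th]: three are spent on the transport cost and one on the continuity of f' at each
   of a and b, which leaves a strict decrease. *)
pose th := (be + df b - (al + df a)) / 8.
have th0 : 0 < th by rewrite divr_gt0// subr_gt0.
have [e1 e10 he1] := transport_variation H mu nu psi A B K al be th m1 n1 Hpsi stab mA mB AO BO lA
  (ltW K0) KAB MB0 (fun x Ax => let: And3 _ h _ := (belowP _ _ _ _ _).1 Ax in h)
  (fun x Bx => let: And3 _ h _ := (aboveP _ _ _ _ _).1 Bx in h) th0.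
have [da da0 hda] := energy_dcont Hf a th a0 th0.
have [db db0 hdb] := energy_dcont Hf b th b0 th0.
pose e := Num.min e1 (Num.min 2^-1 (Num.min (da / (2 * K)) (db / (b + 1)))).
have b1 : 0 < b + 1 by lra.
have e0 : 0 < e by rewrite !lt_min e10 invr_gt0 ltr0n/= !divr_gt0// mulr_gt0.
have ee1 : e <= e1 by rewrite ge_min lexx.
have eh : e <= 2^-1 by rewrite !ge_min lexx orbT.
have eda : e <= da / (2 * K) by rewrite !ge_min lexx !orbT.
have edb : e <= db / (b + 1) by rewrite !ge_min lexx !orbT.
have e01 : 0 <= e <= 1 by apply/andP; split; lra.
have [P [P1 Pd PQ]] := competitor H leb mu u A B e K m1 Hu lO mA mB AO BO e01 (ltW K0) KAB.
have tv := he1 e P; rewrite e0 ee1 in tv; have {}tv := tv isT P1 PQ.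
have fu := energy_finite lO0.
have ev := energy_variation H Hf mu P u A B e K a b Hu Pd mA mB AO BO AB lA fu e01 (ltW K0)
  a0 b0 KAB (fun x Ax => let: And3 _ _ h := (belowP _ _ _ _ _).1 Ax in h)
  (fun x Bx => let: And3 _ _ h := (aboveP _ _ _ _ _).1 Bx in h).
have Da : df (a + e * K) < df a + th.
  have aK : 0 <= a + e * K by rewrite addr_ge0// mulr_ge0// ltW.
  have : `|a + e * K - a| < da.
    rewrite addrAC subrr add0r ger0_norm; last by rewrite mulr_ge0// ltW.
    apply: (@le_lt_trans _ _ (da / 2)); last by rewrite ltr_pdivrMr// ltr_pMr// ltr1n.
    by rewrite -ler_pdivlMr// -mulrA -invfM.
  by move=> /(hda _ aK); rewrite ltr_norml => /andP[_]; rewrite ltrBlDl.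
have Db : df b - th < df ((1 - e) * b).
  have bK : 0 <= (1 - e) * b by rewrite mulr_ge0//; lra.
  have : `|(1 - e) * b - b| < db.
    have -> : (1 - e) * b - b = - (e * b) by ring.
    rewrite normrN ger0_norm; last by rewrite mulr_ge0// ltW.
    apply: (@lt_le_trans _ _ (e * (b + 1))); first by rewrite ltr_pM2l//; lra.
    by rewrite -ler_pdivlMr.
  by move=> /(hdb _ bK); rewrite ltr_norml => /andP[+ _]; move: (df _) (df b) => ? ?; lra.
have := Hmin P P1; rewrite /Ffun => hm.
have FM : Fent f leb Om mu \is a fin_num.
  rewrite (Fent_density f df leb Om mu _ Hf (td_m H) Hu) ge0_fin_numE//.
  apply: integral_ge0 => x Ox; rewrite lee_fin (en_ge0 Hf)//.
  by have [_ [u0 _]] := Hu; exact: u0.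
have : (Tp p Om mu nu + Fent f leb Om mu <= Tp p Om P nu +
   (fine (Fent f leb Om mu) + e * fine (mu B) * (df (a + e * K) - df ((1 - e) * b)))%:E)%E.
  by apply: (le_trans hm); rewrite leeD2l.
rewrite -(fineK (Tp_fin H P nu P1 n1)) -(fineK (Tp_fin H mu nu m1 n1)) -{1}(fineK FM).
rewrite -!EFinD lee_fin.
have z0 : 0 < e * fine (mu B) by rewrite mulr_gt0.
have thE : be + df b - (al + df a) = 8 * th by rewrite /th mulrC divfK.
move: tv Da Db thE z0 th0.
move: (fine (Tp _ _ _ _)) (fine (Tp _ _ _ _)) (fine (Fent _ _ _ _)) (e * fine (mu B)).
move: (df (a + _)) (df (_ * b)) (df a) (df b) => D D' dA dB tM tP F z tv h1 h2 h3 z0 t0 h4.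
have : z * (al - be + 3 * th + (D - D')) < z * 0 by rewrite ltr_pM2l//; lra.
rewrite mulr0 mulrDr; lra.
Qed.

End Optimality.

(** * Null sets of the reference measure and the top level of the potential *)

(** The singular part only adds mass, so [nu E = 0] forces the integral over [E] of the almost
    everywhere positive [v] to vanish. *)
Lemma reference_pos {R : realType} {n : nat} (leb : {measure set (n.-tuple R) -> \bar R})
  (Om : set (n.-tuple R)) (nu : probability (n.-tuple R) R)
  (nus : {measure set (n.-tuple R) -> \bar R}) (v : n.-tuple R -> R) (E : set (n.-tuple R)) :
  measurable_fun Om v -> {ae leb, forall x, Om x -> 0 < v x} ->
  (forall A, measurable A -> nu A = (nus A + \int[leb]_(x in A `&` Om) (v x)%:E)%E) ->
  measurable Om -> measurable E -> E `<=` Om -> nu E = 0%E -> leb E = 0%E.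
Proof.
move=> mv vp dec mO mE EO; rewrite dec// (setIidl EO) => h0.
have mvE : measurable_fun E v by exact: measurable_funS mv.
have vpE : {ae leb, forall x, E x -> 0 < v x} by apply: filterS vp => x hx /EO.
apply: (integral_pos_null leb E v) => //.
have i0 : (0 <= \int[leb]_(x in E) (v x)%:E)%E.
  rewrite (ae_eq_integral (fun x => `|v x|%:E)) => //.
  - exact: integral_ge0.
  - exact/measurable_EFinP.
  - by apply/measurable_EFinP; exact: measurableT_comp.
  - by apply: filterS vpE => x hx /hx vx; rewrite /= ger0_norm// ltW.
by apply/eqP; rewrite eq_le i0 andbT -h0 leeDr// measure_ge0.
Qed.

(* Lowering [psi] by [t] on [{psi > l - t}] raises its transform by [t] on [{psi >= l}],
   since [c(y, y) = 0]; maximality of [psi] then compares the two masses. *)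
Lemma top_level_null {R : realType} {n : nat} {p C : R} {Om : set (n.-tuple R)} {dl : R -> R}
  (H : transport_domain p C Om dl) (mu nu : probability (n.-tuple R) R)
  (psi : n.-tuple R -> R) (l : R) :
  in_P Om mu -> in_P Om nu -> kantorovich_potential p Om mu nu psi ->
  mu (Om `&` psi @^-1` `[l, +oo[) = 0%E -> nu (Om `&` psi @^-1` `[l, +oo[) = 0%E.
Proof.
move=> m1 n1 Hpsi; have [cp _] := Hpsi; have ap := c_concave_adm H _ cp.
have [bp mp] := ap; have mO := td_m H; have BC := td_bc H.
set Z := Om `&` _ => muZ; have mZ : measurable Z by exact: mp.
pose W k := Om `&` psi @^-1` `]l - k.+1%:R^-1, +oo[.
have mW k : measurable (W k) by exact: mp.
have WZ : \bigcap_k W k = Z.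
  apply/seteqP; split => x.
    move=> h; have [Ox _] := h 0%N I; split => //=; rewrite in_itv/= andbT.
    apply/ler_addgt0Pr => e e0.
    have [_] := h (Num.truncn e^-1) I; rewrite /= in_itv/= andbT => hx.
    have : (Num.truncn e^-1).+1%:R^-1 < e by rewrite invf_plt ?posrE//; exact: truncnS_gt.
    by move: hx; move: (_^-1) (psi x) => ? ?; lra.
  move=> [Ox]; rewrite /= in_itv/= andbT => h k _; split => //=; rewrite in_itv/= andbT.
  by rewrite ltrBlDr (le_lt_trans h)// ltrDl invr_gt0.
have cvW : (mu \o W) x @[x --> \oo] --> mu Z.
  rewrite -WZ; apply: nonincreasing_cvg_mu => //.
  - by apply: (le_lt_trans (probability_le1 _ _)); rewrite ?ltry.
  - by rewrite WZ.
  - move=> i j ij; apply/subsetPset => x [Ox]; rewrite /= in_itv/= andbT => hx.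
    split => //=; rewrite in_itv/= andbT; apply: le_lt_trans hx.
    by rewrite lerD2l lerN2 lef_pV2 ?posrE// ler_nat.
apply/eqP; apply/negPn/negP => nZ.
have nZ0 : (0 < nu Z)%E by rewrite lt_neqAle eq_sym nZ measure_ge0.
(* The sets [W k] decrease to [Z], which is [mu]-null, so their [mu]-mass eventually drops below a
   positive [nu Z]; t = 1/(k+1) is the amount of lowering. *)
have [k hk] : exists k, (mu (W k) < nu Z)%E.
  have : \forall k \near \oo, (mu (W k) < nu Z)%E.
    apply: (cvW [set x | (x < nu Z)%E]); rewrite muZ.
    by apply: open_nbhs_nbhs; split => //; exact: open_ereal_lt_ereal.
  by move=> [N _ hN]; exists N; apply: (hN N) => /=.
pose t : R := k.+1%:R^-1; have t0 : 0 < t by rewrite invr_gt0.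
have aW : admissible Om (\1_(W k) : n.-tuple R -> R) by exact: adm_indic.
have aZ : admissible Om (\1_Z : n.-tuple R -> R) by exact: adm_indic.
pose phi x := 1 * psi x + (- t) * \1_(W k) x.
have aphi : admissible Om phi by exact: adm_lin.
have [bphi _] := aphi.
(* For y in [Z]: if x is in [W k] the lowering itself yields t; otherwise psi x <= l - t, while the
   transform of [psi] at y is at most - psi y <= - l. *)
have gain y : Om y -> 1 * ct Om (cost p) psi y + t * \1_Z y <= ct Om (cost p) phi y.
  move=> Oy; apply: (ct_ge BC) => x Ox; rewrite mul1r /phi mul1r mulNr.
  have h1 := ct_le BC _ _ y bp Ox; have h2 := ct_le BC _ _ y bp Oy.
  rewrite (cost_diag _ _ (td_p H)) in h2; have h3 := bc_ge0 BC x y.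
  rewrite !indicE; have [/set_mem[_]|yZ] := boolP (y \in Z); last first.
    rewrite mulr0 addr0; apply: (le_trans h1).
    by rewrite opprB addrCA lerDr mulr_ge0// ltW.
  rewrite /= in_itv/= andbT => ly; have [xW|xW] := boolP (x \in W k).
    by rewrite !mulr1; move: h1; move: (ct _ _ _ _) (cost _ _ _) (psi x) => ? ? ?; lra.
  have : psi x <= l - t.
    rewrite leNgt; apply/negP => lx; move: xW; rewrite notin_setE; apply.
    by split => //=; rewrite in_itv/= andbT.
  rewrite !mulr1 mulr0; move: h2 h3 ly.
  by move: (ct _ _ _ _) (cost _ _ _) (psi x) (psi y) => ? ? ? ?; lra.
have bct := ct_adm H _ bp.
have := mean_le mO nu _ _ (adm_lin _ _ 1 t bct aZ) (ct_adm H _ bphi) gain.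
have := potential_max H mu nu psi phi Hpsi aphi.
rewrite /dual /phi !(mean_lin mO)// !(mean_indic mO)//; [|by move=> x []|by move=> x []].
have : t * fine (mu (W k)) < t * fine (nu Z).
  by rewrite ltr_pM2l// fine_lt// fin_num_measure.
rewrite mulNr; move: (mean Om mu psi) (mean Om nu _) (mean Om nu _) (t * _) (t * _).
by move=> ? ? ? ? ?; lra.
Qed.

(** * Construction of the constant l and conclusion *)

Theorem theorem3p3 (R : realType) (n : nat)
  (leb : {measure set (n.-tuple R) -> \bar R}) (Hleb : is_lebesgue leb)
  (Om : set (n.-tuple R)) (HOm : bounded_domain leb Om)
  (p : R) (Hp : 1 < p)
  (f df k : R -> R)
  (Hf0 : f 0 = 0) (Hfpos : forall t : R, 0 <= t -> 0 <= f t)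
  (Hfconv : forall x y l : R, 0 <= x -> 0 <= y -> x != y -> 0 < l < 1 ->
      f (l * x + (1 - l) * y) < l * f x + (1 - l) * f y)
  (Hdf : forall t : R, 0 < t -> is_derive t (1 : R) f (df t))
  (Hdf0 : (f h - f 0) / h @[h --> (0:R)^'+] --> df 0)
  (Hdfc : {within `[0, +oo[, continuous df})
  (Hdf00 : df 0 = 0)
  (Hsuper : (fun t : R => f t / t) @ +oo --> +oo)
  (Hk : forall y : R, 0 <= y -> 0 <= k y /\ df (k y) = y)
  (nu : probability (n.-tuple R) R) (Hnu : in_P Om nu)
  (nus : {measure set (n.-tuple R) -> \bar R}) (v : n.-tuple R -> R)
  (Hnus : exists N, measurable N /\ leb N = 0%E /\ nus (~` N) = 0%E)
  (Hvm : measurable_fun Om v)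
  (Hvinf : exists M : R, {ae leb, forall x, Om x -> `|v x| <= M})
  (Hvpos : {ae leb, forall x, Om x -> 0 < v x})
  (Hnudec : forall A, measurable A ->
      nu A = (nus A + \int[leb]_(x in A `&` Om) (v x)%:E)%E)
  (mu : probability (n.-tuple R) R) (u : n.-tuple R -> R)
  (Hmu : in_P Om mu) (Hu : is_density leb Om mu u)
  (Hmin : forall mu' : probability (n.-tuple R) R, in_P Om mu' ->
      (Ffun p f leb Om nu mu <= Ffun p f leb Om nu mu')%E)
  (psi : n.-tuple R -> R) (Hpsi : kantorovich_potential p Om mu nu psi) :
  exists l : R,
    {ae leb, forall x, Om x -> 0 <= l - psi x} /\
    {ae leb, forall x, Om x -> u x = k (l - psi x)}.
Proof.
have [C [dl H]] := transport_domain_ex p leb Om Hp HOm.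
have Hf : energy f df by split.
have mO := td_m H.
have [B [B0 hB]] := domain_boxed _ _ HOm.
have [U [U0 UO Uopen Ucl Uconn]] := domain_core _ _ HOm.
have lO := domain_leb_fin _ Hleb _ HOm; have lO0 := domain_leb_gt0 _ Hleb _ HOm.
have npos E : measurable E -> E `<=` Om -> nu E = 0%E -> leb E = 0%E.
  by move=> mE EO; exact: (reference_pos leb Om nu nus v E).
have Unu y : U y -> forall d : R, 0 < d -> (0 < nu (Om `&` [set z | near_by d y z]))%E.
  move=> Uy d d0; have [d' d'0 hd'] := Uopen _ Uy.
  have mE : measurable (Om `&` [set z | near_by d y z]).
    by apply: measurableI => //; exact: measurable_near_by.
  rewrite lt_neqAle measure_ge0 andbT; apply/negP => /eqP /esym /npos -/(_ mE) l0.
  pose r := Num.min d d'; have r0 : 0 < r by rewrite lt_min d0.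
  have : (leb [set z | near_by r y z] <= leb (Om `&` [set z | near_by d y z]))%E.
    apply: le_measure; rewrite ?inE//; first exact: measurable_near_by.
    move=> z yz; split; last by apply: near_by_le yz; rewrite ge_min lexx.
    by apply: UO; apply: hd'; apply: near_by_le yz; rewrite ge_min lexx orbT.
  rewrite l0; last by move=> x [].
  rewrite (leb_near_by _ Hleb _ _ (ltW r0)) lee_fin leNgt exprn_gt0//.
  by rewrite mulr_gt0.
have stab e : 0 < e -> exists2 d : R, 0 < d &
    forall phi, near_optimal (p := p) (Om := Om) mu nu psi d phi ->
    exists c : R, forall x, Om x -> `|phi x - psi x - c| <= e.
  move=> e0; apply: (potential_stability H mu nu psi Hpsi B0 hB UO Uopen Unu) => //.
  by move=> x /Ucl.
have key al be a b := optimal_exchange H Hf Hmu Hnu Hu lO Hmin Hpsi al be a b stab lO0.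
have [um [u0 uE]] := Hu.
have [cpsi _] := Hpsi; have [[M hM] psim] := c_concave_adm H _ cpsi.
have hM' x : Om x -> - M <= psi x <= M by move=> /hM; rewrite ler_norml.
pose low := below (Om := Om) psi u; pose high := above (Om := Om) psi u.
pose E := [set r | exists al a, [/\ 0 <= a, r = al + df a & leb (low al a) != 0%E]].
(* Otherwise the sets {psi <= M, u <= j}, which exhaust [Om], would all be negligible. *)
have E0 : E !=set0.
  apply: contrapT => nE.
  suff : leb Om = 0%E by move=> z; rewrite z ltxx in lO0.
  apply: ae_notin_null => //.
  have : {ae leb, forall x, forall j : nat, ~ low M j%:R x}.
    apply: ae_forall_countable => j; apply: ae_notin; first exact: (below_measurable H Hu Hpsi).
    by apply/eqP; apply/negPn/negP => nz; apply: nE; exists (M + df j%:R), M, j%:R.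
  apply: filterS => x hx Ox; apply: (hx (Num.truncn (u x)).+1); apply/belowP; split => //.
    by have /andP[] := hM' _ Ox.
  by apply: ltW; exact: truncnS_gt.
(* With be = - M and b = 0 the upper set is all of [Om], which has [mu]-mass 1; the exchange
   inequality then bounds the levels below. *)
have Elb : lbound E (- M).
  move=> _ [al [a [a0 -> nz]]]; rewrite leNgt; apply/negP => lt.
  have [|/eqP z|z] := key al (- M) a 0 a0 (lexx _).
  - by rewrite Hdf00 addr0.
  - by rewrite /low z in nz.
  - have : mu Om = 0%E.
      rewrite -z; congr (mu _); apply/seteqP; split => x; last by move=> /aboveP[].
      by move=> Ox; apply/aboveP; split => //; [have /andP[] := hM' _ Ox|exact: u0].
    by rewrite Hmu => /eqP; rewrite onee_eq0.
have infE : has_inf E by split => //; exists (- M).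
pose l := inf E; exists l.
(* Rational levels make the exceptional set a countable union. A point violating the inequality lies
   in a rational lower set whose level is still below l, by continuity of f'. *)
have ae1 : {ae leb, forall x, Om x -> l <= psi x + df (u x)}.
  have : {ae leb, forall x, forall q : rat * rat, 0 <= ratr q.2 :> R ->
      ratr q.1 + df (ratr q.2) < l -> ~ low (ratr q.1) (ratr q.2) x}.
    apply: ae_forall_countable => -[q1 q2] /=.
    have [h1|h1] := pselect (0 <= ratr q2 :> R); last by apply: aeW => x /h1.
    have [h2|h2] := pselect (ratr q1 + df (ratr q2) < l); last by apply: aeW => x _ /h2.
    have : leb (low (ratr q1) (ratr q2)) = 0%E.
      apply/eqP; apply/negPn/negP => nz; move: h2; apply/negP; rewrite -leNgt.
      by apply: ge_inf; [exists (- M)|exists (ratr q1), (ratr q2)].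
    move=> /ae_notin -/(_ (below_measurable H Hu Hpsi _ _)).
    by apply: filterS => x hx _ _.
  apply: filterS => x hx Ox; rewrite leNgt; apply/negP => lt.
  pose e := (l - (psi x + df (u x))) / 2.
  have e0 : 0 < e by rewrite divr_gt0// subr_gt0.
  have [d d0 hd] := energy_dcont Hf (u x) e (u0 _ Ox) e0.
  have [q1] := rat_in_itvoo (ltr_pwDr e0 (lexx (psi x))).
  rewrite in_itv/= => /andP[a1 a2].
  have [q2] := rat_in_itvoo (ltr_pwDr d0 (lexx (u x))).
  rewrite in_itv/= => /andP[b1 b2].
  have q20 : 0 <= ratr q2 :> R by rewrite (le_trans (u0 _ Ox))// ltW.
  have := hd _ q20; rewrite gtr0_norm ?subr_gt0// ltrBlDl => /(_ b2).
  rewrite ltr_norml => /andP[_ dq].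
  apply: (hx (q1, q2)) => //=; last by apply/belowP; split => //; exact: ltW.
  have eE : l = psi x + df (u x) + 2 * e by rewrite /e mulrC divfK// subrKC.
  by rewrite eE; move: a2 dq; move: (df _) (df _) (psi x) => ? ? ?; lra.
(* Here rational levels approach from below, with q2 >= 0, which is possible where u > 0. A level
   above l exceeds some element of [E], so the upper set is [mu]-null, and Lebesgue-null where u >
   0. *)
have ae2 : {ae leb, forall x, Om x -> 0 < u x -> psi x + df (u x) <= l}.
  pose pos := Om `&` u @^-1` `]0, +oo[.
  have mpos : measurable pos by exact: um.
  have : {ae leb, forall x, forall q : rat * rat, 0 <= ratr q.2 :> R ->
      l < ratr q.1 + df (ratr q.2) -> ~ (high (ratr q.1) (ratr q.2) `&` pos) x}.
    apply: ae_forall_countable => -[q1 q2] /=.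
    have [h1|h1] := pselect (0 <= ratr q2 :> R); last by apply: aeW => x /h1.
    have [h2|h2] := pselect (l < ratr q1 + df (ratr q2)); last by apply: aeW => x _ /h2.
    have hh0 : 0 < ratr q1 + df (ratr q2) - l by rewrite subr_gt0.
    have [r [al [a [a0 rE nz]]] rl] := inf_adherent hh0 infE.
    have {}rl : al + df a < ratr q1 + df (ratr q2).
      by move: rl; rewrite -/l subrKC rE.
    have muh : mu (high (ratr q1) (ratr q2)) = 0%E.
      by have [/eqP z|//] := key _ _ _ _ a0 h1 rl; rewrite /low z in nz.
    have mh : measurable (high (ratr q1) (ratr q2)) by exact: (above_measurable H Hu Hpsi).
    have mE : measurable (high (ratr q1) (ratr q2) `&` pos) by exact: measurableI.
    have sE : high (ratr q1) (ratr q2) `&` pos `<=` Om by move=> x [_ []].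
    have : leb (high (ratr q1) (ratr q2) `&` pos) = 0%E.
      apply: (integral_pos_null leb _ u) => //; first exact: measurable_funS um.
        by apply: aeW => x [_ [_]]; rewrite /= in_itv/= andbT.
      rewrite -[X in integral _ X _](setIidl sE) -uE//.
      apply/eqP; rewrite eq_le measure_ge0 andbT -muh.
      by apply: le_measure; rewrite ?inE//; exact: subIsetl.
    by move=> /ae_notin -/(_ mE); apply: filterS => x hx _ _.
  apply: filterS => x hx Ox ux; rewrite leNgt; apply/negP => lt.
  pose e := (psi x + df (u x) - l) / 2.
  have e0 : 0 < e by rewrite divr_gt0// subr_gt0.
  have [d d0 hd] := energy_dcont Hf (u x) e (u0 _ Ox) e0.
  have a0 : psi x - e < psi x by rewrite ltrBlDr ltrDl.
  have [q1] := rat_in_itvoo a0; rewrite in_itv/= => /andP[a1 a2].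
  have b0 : Num.max 0 (u x - d) < u x by rewrite gt_max ux ltrBlDr ltrDl.
  have [q2] := rat_in_itvoo b0; rewrite in_itv/= gt_max => /andP[/andP[b1 b2] b3].
  have := hd _ (ltW b1); rewrite distrC gtr0_norm ?subr_gt0// ltrBlDr -ltrBlDl => /(_ b2).
  rewrite ltr_norml => /andP[dq _].
  apply: (hx (q1, q2)) => //=; first exact: ltW.
    have eE : l = psi x + df (u x) - 2 * e by rewrite /e mulrC divfK// opprB addrC subrK.
    by rewrite eE; move: a1 dq; move: (df _) (df _) (psi x) => ? ? ?; lra.
  split; first by apply/aboveP; split => //; exact: ltW.
  by split => //=; rewrite in_itv/= ux.
pose Z := Om `&` psi @^-1` `[l, +oo[.
have mZ : measurable Z by exact: psim.
have ZO : Z `<=` Om by move=> x [].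
(* Where psi >= l and u > 0, the previous inequality would give f'(u) <= 0, whereas f' is positive
   on positive reals. *)
have muZ : mu Z = 0%E.
  rewrite uE// (setIidl ZO) (ae_eq_integral (cst 0%E)) ?integral0//.
  - by apply/measurable_EFinP; exact: measurable_funS um.
  apply: filterS ae2 => x hx [Ox]; rewrite /= in_itv/= andbT => lx; congr EFin.
  apply/eqP; rewrite eq_le u0// andbT leNgt; apply/negP => ux.
  have := hx Ox ux; have := energy_dmono Hf 0 (u x) (lexx _) ux; rewrite Hdf00.
  by move: lx; move: (df _) (psi x) => ? ?; lra.
have aeZ : {ae leb, forall x, ~ Z x}.
  apply: ae_notin => //; apply: npos => //.
  exact: (top_level_null H mu nu psi l Hmu Hnu Hpsi muZ).
have lt x : Om x -> ~ Z x -> psi x < l.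
  move=> Ox nZ; rewrite ltNge; apply/negP => lx; apply: nZ.
  by split => //=; rewrite in_itv/= lx.
split; first by apply: filterS aeZ => x nZ Ox; rewrite subr_ge0 ltW// lt.
apply: filterS3 ae1 ae2 aeZ => x h1 h2 nZ Ox.
have lx := lt _ Ox nZ; have l1 := h1 Ox.
(* If u vanished, the lower inequality would read l <= psi, which is excluded off [Z]. *)
have ux : 0 < u x.
  rewrite lt_neqAle u0// andbT; apply/negP => /eqP ux; move: l1.
  by rewrite -ux Hdf00 addr0 leNgt lx.
have l2 := h2 Ox ux.
have d0 : 0 <= l - psi x by rewrite subr_ge0 ltW.
have [k0 kE] := Hk _ d0.
apply: (energy_dinj Hf) => //; first exact: ltW.
by rewrite kE; apply/eqP; rewrite eq_le lerBrDl l2 lerBlDl l1.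
Qed.
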